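(* Let $\beta,\kappa>0$ and let $V$ be as in the context. (i) If there exists $C>0$ such that $V(x)\le \frac{\kappa}{|x|^{2+2\beta}}-\frac{C}{|x|^{2+\beta}}$ for all $x\in\mathbb{R}^d_0$ with $|x|\le1$, then there are no constants $c_1,c_2,c_3>0$ such that $$p(t,x,y)\le c_1\Big(1\wedge\frac{h_{\beta,\kappa}(|x|)}{h_{\beta,\kappa}(\eta_1t^{1/(2+\beta)})}\Big)\Big(1\wedge\frac{h_{\beta,\kappa}(|y|)}{h_{\beta,\kappa}(\eta_1t^{1/(2+\beta)})}\Big)\exp\Big(-\frac{c_2t}{(|x|\vee|y|\vee t^{1/(2+\beta)})^{2+2\beta}}\Big)q(c_3t,x,y)$$ for all $t\in(0,1]$ and $x,y\in\mathbb{R}^d_0$. (ii) If there exists $C>0$ such that $V(x)\ge \frac{\kappa}{|x|^{2+2\beta}}+\frac{C}{|x|^{2+\beta}}$ for all $x\in\mathbb{R}^d_0$ with $|x|\le1$, then there are no constants $c_4,c_5,c_6>0$ such that $$p(t,x,y)\ge c_4\Big(1\wedge\frac{h_{\beta,\kappa}(|x|)}{h_{\beta,\kappa}(\eta_1t^{1/(2+\beta)})}\Big)\Big(1\wedge\frac{h_{\beta,\kappa}(|y|)}{h_{\beta,\kappa}(\eta_1t^{1/(2+\beta)})}\Big)\exp\Big(-\frac{c_5t}{(|x|\vee|y|\vee t^{1/(2+\beta)})^{2+2\beta}}\Big)q(c_6t,x,y)$$ for all $t\in(0,1]$ and all $x,y\in\mathbb{R}^d_0$ (when $d=1$: all $x,y\in\mathbb{R}^1_0$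 with $xy>0$).
   Context: Let $d\ge1$, $\mathbb{R}^d_0:=\mathbb{R}^d\setminus\{0\}$. $V$ is a non-negative locally bounded Borel function on $\mathbb{R}^d_0$ with $\sup_{|x|\ge1}V(x)<\infty$ and $\int_{B(0,1)\setminus\{0\}}V(x)dx=\infty$. $W$ is Brownian motion on $\mathbb{R}^d$ with generator $\Delta$, transition density $q(t,x,y)=(4\pi t)^{-d/2}e^{-|x-y|^2/(4t)}$. $X$ is the process on $\mathbb{R}^d_0$ with semigroup $P_tf(x)=\mathbb{E}_x[e^{-\int_0^tV(W_s)ds}f(W_t);\,t<\tau^W_{\mathbb{R}^d_0}]$ (generator $\Delta-V$), and $p(t,x,y)$ is its transition density ($=\lim_n p^{\overline B(0,1/n)^c}(t,x,y)$, with $p^U$ the transition density of $X$ killed upon exiting $U$). $h_{\beta,\kappa}(r):=(r\wedge 1)^{-(d-2-\beta)/2}\exp\big(-\frac{\sqrt\kappa}{\beta(r\wedge1)^\beta}\big)$; $\eta_0:=(2^{-4-\beta/(2+\beta)}\beta\sqrt\kappa)^{1/(2+\beta)}$, $\eta_1:=2^{-2/(2+\beta)}\eta_0$. *)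

(* Defs.v *)
From HB Require Import structures.
From mathcomp Require Import all_boot all_order all_algebra.
From mathcomp Require Import all_classical all_reals all_analysis.

Set Implicit Arguments.
Unset Strict Implicit.
Unset Printing Implicit Defensive.
Import Order.TTheory GRing.Theory Num.Theory.
Import numFieldNormedType.Exports.
Local Open Scope classical_set_scope.
Local Open Scope ring_scope.

(* R^d is modelled as d.-tuple R, with the product (= Borel) sigma-algebra
   provided by MathComp-Analysis (measurable_structure.v). *)

Section Rd.
Variable R : realType.
Variable d : nat.

Definition origin : d.-tuple R := [tuple (0 : R) | _ < d].
Definition tadd (x y : d.-tuple R) : d.-tuple R := [tuple tnth x i + tnth y i | i < d].
Definition tsub (x y : d.-tuple R) : d.-tuple R := [tuple tnth x i - tnth y i | i < d].
Definition enorm (x : d.-tuple R) : R := Num.sqrt (\sum_(i < d) tnth x i ^+ 2).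
End Rd.

(* Lebesgue integral over R^d of a function with values in \bar R, defined as the
   iterated one-dimensional Lebesgue integral (Tonelli; used only for
   non-negative measurable integrands). *)
Fixpoint intRd (R : realType) (n : nat) : (n.-tuple R -> \bar R) -> \bar R :=
  match n as n0 return ((n0.-tuple R -> \bar R) -> \bar R) with
  | 0%N => fun f => f [tuple]
  | m.+1 => fun f =>
      (\int[@lebesgue_measure R]_x intRd (fun t : m.-tuple R => f (cons_tuple x t)))%E
  end.

Section Kernels.
Variable R : realType.
Variable d : nat.

(* Gaussian kernel q(t,x,y) = (4 pi t)^{-d/2} exp(-|x-y|^2/(4t)) of Brownian motion
   with generator Delta. *)
Definition qker (t : R) (x y : d.-tuple R) : R :=
  powR (4 * pi * t) (- (d%:R / 2)) * expR (- (enorm (tsub x y) ^+ 2) / (4 * t)).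

Definition hbk (beta kappa r : R) : R :=
  let s := Num.min r 1 in
  powR s (- ((d%:R - 2 - beta) / 2)) * expR (- (Num.sqrt kappa / (beta * powR s beta))).

Definition eta0 (beta kappa : R) : R :=
  powR (powR 2 (- 4 - beta / (2 + beta)) * beta * Num.sqrt kappa) (2 + beta)^-1.
Definition eta1 (beta kappa : R) : R := powR 2 (- (2 / (2 + beta))) * eta0 beta kappa.

Definition bound_expr (beta kappa c c' t : R) (x y : d.-tuple R) : R :=
  let st := eta1 beta kappa * powR t (2 + beta)^-1 in
  Num.min 1 (hbk beta kappa (enorm x) / hbk beta kappa st) *
  Num.min 1 (hbk beta kappa (enorm y) / hbk beta kappa st) *
  expR (- (c * t / powR (Num.max (Num.max (enorm x) (enorm y)) (powR t (2 + beta)^-1))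
                         (2 + 2 * beta))) *
  qker (c' * t) x y.
End Kernels.

Section BM.
Variable R : realType.
Variable d : nat.
Variables (dO : measure_display) (Omega : measurableType dO).
Variable P : probability Omega R.

(* B is a d-dimensional Brownian motion with generator Delta started at 0:
   B_0 = 0, continuous paths on [0,oo), measurable marginals, and independent
   Gaussian increments: for 0 = t_0 < t_1 < ... < t_n and Borel A_0,...,A_{n-1},
   P(B_{t_{k+1}} - B_{t_k} in A_k for all k < n) = prod_k int_{A_k} q(t_{k+1}-t_k,0,y) dy.
   The Brownian motion started at x is W^x_s = x + B_s. *)
Definition is_BM (B : R -> Omega -> d.-tuple R) : Prop :=
  [/\ (forall w, B 0 w = origin R d),
      (forall w (i : 'I_d),
          {within `[0, +oo[, continuous (fun s => tnth (B s w) i)}),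
      (forall t, measurable_fun setT (B t)) &
      (forall (n : nat) (tt : nat -> R) (A : nat -> set (d.-tuple R)),
          tt 0%N = 0 -> (forall k, tt k < tt k.+1) -> (forall k, measurable (A k)) ->
          P (\bigcap_(k in [set k | (k < n)%N])
                [set w | A k (tsub (B (tt k.+1) w) (B (tt k) w))]) =
          (\prod_(k < n)
             intRd (fun y => (\1_(A k) y * qker (tt k.+1 - tt k) (origin R d) y)%:E))%E)].

(* Feynman-Kac semigroup of X (generator Delta - V, killed at the exit time of
   R^d_0, i.e. upon hitting 0), applied to the indicator of A:
   P_t 1_A (x) = E_x[ exp(-int_0^t V(W_s) ds) 1_A(W_t) ; t < tau ].
   By path continuity, t < tau iff W_s <> 0 for all s in [0,t]. *)
Definition FKsemigroup (B : R -> Omega -> d.-tuple R) (V : d.-tuple R -> R)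
    (t : R) (x : d.-tuple R) (A : set (d.-tuple R)) : \bar R :=
  (\int[P]_w
     (expeR (- \int[@lebesgue_measure R]_(s in `[0%R, t]%classic) (V (tadd x (B s w)))%:E) *
      (\1_A (tadd x (B t w)))%:E *
      (\1_[set w' | forall s, 0 <= s <= t -> tadd x (B s w') <> origin R d] w)%:E))%E.

Definition is_trans_density (B : R -> Omega -> d.-tuple R) (V : d.-tuple R -> R)
    (p : R -> d.-tuple R -> d.-tuple R -> R) : Prop :=
  (forall t x y, 0 <= p t x y) /\
  (forall t x A, 0 < t -> x <> origin R d -> measurable A ->
     FKsemigroup B V t x A = intRd (fun y => (p t x y * \1_A y)%:E)).
End BM.

Definition potential_assumptions (R : realType) (d : nat) (V : d.-tuple R -> R) : Prop :=
  [/\ measurable_fun [set x | x <> origin R d] V,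
      (forall x, x <> origin R d -> 0 <= V x),
      (forall x, x <> origin R d -> exists e M : R, 0 < e /\
          forall y, enorm (tsub y x) < e -> V y <= M),
      (exists M : R, forall x, 1 <= enorm x -> V x <= M) &
      intRd (fun x => (\1_[set y | y <> origin R d /\ enorm y < 1] x * V x)%:E) = +oo%E].

(* Main.v *)
Require Import Defs.
From HB Require Import structures.
From mathcomp Require Import all_boot all_order all_algebra.
From mathcomp Require Import all_classical all_reals all_analysis.
From mathcomp Require Import measurable_realfun normal_distribution random_variable ring lra.
Set Implicit Arguments.
Unset Strict Implicit.
Import Order.TTheory GRing.Theory Num.Theory.
Import numFieldNormedType.Exports.
Local Open Scope classical_set_scope.
Local Open Scope ring_scope.

(** The bounds are refuted at time 1 as x tends to 0.  Put
    phi(x) = F(|x|^2) with F(u) = (u/(1+u))^p exp(- b u^(-beta/2)),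
    b = sqrt kappa / beta and p = (2 + beta - d)/4 + theta, so that near 0
    phi(x) is comparable to |x|^(2 theta) h(|x|).  There the quotient
    (Delta phi)/phi equals
      kappa/|x|^(2+2beta) + 4 sqrt kappa theta / |x|^(2+beta)
    up to lower order terms, so the correction C/|x|^(2+beta) in V leaves room for
    theta < 0 with (Delta - V) phi >= - K phi in (i), and for theta > 0 with
    (Delta - V) phi <= K phi in (ii).  Hence the Feynman-Kac functional at time 1
    is at least c phi(x) (total mass), resp. at most c phi(x) (mass of a box),
    whereas the kernel bound integrates to a constant multiple of h(|x|): the
    factor |x|^(2 theta) gives the contradiction.

    The Feynman-Kac estimate avoids stochastic calculus: along n Gaussian steps of
    length s = 1/n a Taylor expansion gives E phi(x+z) = phi(x) + s Delta phi(x)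
    + O(s^(3/2)), uniformly in x, so the discrete product functionals satisfy the
    bounds up to O(n^(-1/2)), and one passes to the limit on continuous paths
    with Fatou's lemma. *)

(** Only integrals of p over Borel sets are given, so the kernel bounds are tested after integration
    in y: over all of the punctured space in (i), over the cube [1,2]^d in (ii), where h(|y|), the
    Gaussian factor and phi are bounded below and, for d = 1, the sign condition holds.

    The main obstacle is uniformity: phi must be expanded from points arbitrarily close to the
    origin with one error constant. This works because exp(- b u^(-beta/2)) absorbs every power of
    1/u produced by differentiation, so that the third derivatives of phi stay bounded; dividing by
    (1+u)^p takes care of infinity.

    V is merely Borel, and Riemann sums along a path need continuity. So V is compared with a
    continuous radial potential v(|x|^2), above it in (i) and below it in (ii).

    The halves are not symmetric. In (ii), exp(-sv)(1+sv) <= 1 costs nothing and Fatou's lemma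
    points the right way. In (i), the reverse inequality costs (sv)^2 phi, affordable because phi
    v^2 is bounded, and Fatou's lemma has to be applied to the complement 1 - psi of a normalised
    functional. *)

(** * Iterated integrals, independence and densities *)

(** The integral of a non-negative function is a supremum over simple functions below it, so it is
    monotone for arbitrary functions. This allows comparisons with integrands built from [p] or from
    [V] along a path, whose measurability is not at hand. *)
Lemma ge0_le_integral_any d (T : measurableType d) (R : realType)
    (mu : {measure set T -> \bar R}) (D : set T) (f g : T -> \bar R) :
  (forall x, D x -> 0 <= f x)%E -> (forall x, D x -> f x <= g x)%E ->
  (\int[mu]_(x in D) f x <= \int[mu]_(x in D) g x)%E.
Proof.
move=> f0 fg.
have g0 x : D x -> (0 <= g x)%E by move=> Dx; exact: le_trans (f0 x Dx) (fg x Dx).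
rewrite !ge0_integralE//; apply: ereal_sup_le => _ [h hf <-].
exists h => // x; apply: le_trans (hf x) _.
rewrite /patch; case: ifPn => // /set_mem Dx; exact: fg.
Qed.

Lemma intRd_ge0 (R : realType) n (f : n.-tuple R -> \bar R) :
  (forall x, 0 <= f x)%E -> (0 <= intRd f)%E.
Proof.
elim: n f => [|n IH] f f0 /=; first exact: f0.
by apply: integral_ge0 => x _; apply: IH => t; exact: f0.
Qed.

Lemma le_intRd (R : realType) n (f g : n.-tuple R -> \bar R) :
  (forall x, 0 <= f x)%E -> (forall x, f x <= g x)%E -> (intRd f <= intRd g)%E.
Proof.
elim: n f g => [|n IH] f g f0 fg /=; first exact: fg.
apply: ge0_le_integral_any => x _; first exact: intRd_ge0.
exact: IH.
Qed.

Lemma eq_intRd (R : realType) n (f g : n.-tuple R -> \bar R) :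
  f =1 g -> intRd f = intRd g.
Proof. by move=> fg; congr intRd; apply/funext. Qed.

Lemma measurable_cylinder d (T : measurableType d) n (C : 'I_n -> set T) :
  (forall i, measurable (C i)) ->
  measurable [set t : n.-tuple T | forall i, C i (tnth t i)].
Proof.
move=> mC.
have -> : [set t : n.-tuple T | forall i, C i (tnth t i)] =
   \bigcap_(i in [set: 'I_n]) ((fun t => tnth t i) @^-1` C i).
  by apply/seteqP; split => t h; [move=> i _; exact: (h i)|move=> i; exact: (h i I)].
apply: fin_bigcap_measurable => // i _; rewrite -[X in measurable X]setTI.
exact: measurable_tnth.
Qed.

Section Independence.
Context d (T : measurableType d) (R : realType) (P : probability T R).

(** Factorization on rectangles identifies the joint law with the product of the two laws; Tonelli
    then integrates out [Y] with [X] frozen. *)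
Lemma indep_integral d1 d2 (T1 : measurableType d1) (T2 : measurableType d2)
    (X : T -> T1) (Y : T -> T2) (f : T1 -> T2 -> \bar R) :
  measurable_fun setT X -> measurable_fun setT Y ->
  (forall A B, measurable A -> measurable B ->
     P (X @^-1` A `&` Y @^-1` B) = P (X @^-1` A) * P (Y @^-1` B))%E ->
  measurable_fun [set: T1 * T2] (fun z => f z.1 z.2) ->
  (forall x y, 0 <= f x y)%E ->
  (\int[P]_w f (X w) (Y w) = \int[P]_w \int[P]_w' f (X w) (Y w'))%E.
Proof.
move=> mX mY XY mf f0.
have mXY : measurable_fun setT (fun w => (X w, Y w)) by exact/measurable_fun_pair.
pose hX := isMeasurableFun.Build _ _ _ _ _ mX.
pose rX : {RV P >-> T1} := HB.pack X hX.
pose hY := isMeasurableFun.Build _ _ _ _ _ mY.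
pose rY : {RV P >-> T2} := HB.pack Y hY.
pose hZ := isMeasurableFun.Build _ _ _ _ _ mXY.
pose rZ : {RV P >-> (T1 * T2)%type} := HB.pack (fun w => (X w, Y w)) hZ.
have prodE : forall S : set (T1 * T2), measurable S ->
    (distribution P rX \x distribution P rY)%E S = distribution P rZ S.
  apply: product_measure_unique => A B mA mB.
  by rewrite /= /distribution/= /pushforward/= -XY//.
transitivity (\int[distribution P rZ]_z f z.1 z.2)%E.
  by rewrite ge0_integral_distribution.
transitivity (\int[distribution P rX \x distribution P rY]_z f z.1 z.2)%E.
  apply: eq_measure_integral => A mA _; exact/esym/prodE.
rewrite fubini_tonelli1//.
rewrite ge0_integral_distribution//=; last 2 first.
- exact: (@measurable_fun_fubini_tonelli_F _ _ _ _ _ (distribution P rY) (fun z => f z.1 z.2)).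
- by move=> x; apply: integral_ge0 => y _; exact: f0.
apply: eq_integral => w _ /=.
have mfw : measurable_fun setT (fun y => f (X w) y).
  exact: (measurableT_comp mf (pair1_measurable (X w))).
by rewrite /fubini_F ge0_integral_distribution.
Qed.

(* Cylinder sets form a pi-system generating the sigma-algebra of tuples. *)
Lemma indep_tuple d1 d2 (T1 : measurableType d1) (T2 : measurableType d2) n
    (X : T -> n.-tuple T1) (Y : T -> T2) :
  measurable_fun setT X -> measurable_fun setT Y ->
  (forall (A : 'I_n -> set T1) B, (forall i, measurable (A i)) -> measurable B ->
     P ([set w | forall i, A i (tnth (X w) i)] `&` Y @^-1` B) =
     P [set w | forall i, A i (tnth (X w) i)] * P (Y @^-1` B))%E ->
  forall A B, measurable A -> measurable B ->
     (P (X @^-1` A `&` Y @^-1` B) = P (X @^-1` A) * P (Y @^-1` B))%E.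
Proof.
move=> mX mY XY A B mA mB.
have mYB : measurable (Y @^-1` B) by rewrite -[X in measurable X]setTI; exact: mY.
(* For fixed [B] both sides of the claim are finite measures in [A]; it remains to compare them on
   cylinders. *)
pose m1 := pushforward (mrestr P mYB) X.
have PYB : (P (Y @^-1` B) = (fine (P (Y @^-1` B)))%:E)%E.
  by rewrite fineK// fin_num_measure.
have r0 : 0 <= fine (P (Y @^-1` B)) by exact: fine_ge0.
pose m2 := pushforward (mscale (NngNum r0) P) X.
pose hX := isMeasurableFun.Build _ _ _ _ _ mX.
pose rX : {mfun T >-> n.-tuple T1} := HB.pack X hX.
pose M1 : {measure set (n.-tuple T1) -> \bar R} := pushforward (mrestr P mYB) rX.
pose M2 : {measure set (n.-tuple T1) -> \bar R} := pushforward (mscale (NngNum r0) P) rX.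
pose cyl : set (set (n.-tuple T1)) :=
  [set C | exists2 A : 'I_n -> set T1, (forall i, measurable (A i)) &
     C = [set t | forall i, A i (tnth t i)]].
have mcyl := @measurable_cylinder _ T1 n.
have cylI : setI_closed cyl.
  move=> _ _ [C1 mC1 ->] [C2 mC2 ->]; exists (fun i => C1 i `&` C2 i).
    by move=> i; exact: measurableI.
  by apply/seteqP; split => t /=; [move=> [h1 h2] i|move=> h; split=> i; case: (h i)].
have eM : M1 mX A = M2 mX A.
  apply: (measure_unique cyl (fun _ => setT)) => //.
  - apply/seteqP; split; last first.
      apply: smallest_sub; first exact: sigma_algebra_measurable.
      by move=> _ [C mC ->]; exact: mcyl.
    rewrite {1}/measurable/= /g_sigma_preimage.
    apply: smallest_sub; first exact: smallest_sigma_algebra.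
    move=> C; rewrite -bigcup_seq => -[i _ [D mD <-]].
    apply: sub_sigma_algebra; rewrite /cyl/=; exists (fun j => if j == i then D else setT).
      by move=> j; case: ifP.
    apply/seteqP; split => t /=; first by move=> [_ h] j; case: eqP => // ->.
    by move=> /(_ i); rewrite eqxx.
  - move=> _; exists (fun _ => setT) => //.
    by apply/seteqP; split.
  - by rewrite bigcup_const.
  - move=> _ [C mC ->].
    by have := XY C B mC mB; rewrite [in RHS]PYB muleC.
  - move=> _; apply: (@le_lt_trans _ _ 1%E); last exact: ltry.
    by apply: probability_le1; rewrite preimage_setT setTI.
by rewrite [in RHS]PYB muleC; exact: eM.
Qed.

End Independence.

Section Density.
Context d (T : measurableType d) (R : realType).
Variables (m mu : {measure set T -> \bar R}) (p : T -> R).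
Hypotheses (mp : measurable_fun setT p) (p0 : forall x, 0 <= p x).
Hypothesis mE : forall A, measurable A -> m A = (\int[mu]_(x in A) (p x)%:E)%E.

Import HBNNSimple.

Let density_nnsfun (h : {nnsfun T >-> R}) :
  (\int[m]_x (h x)%:E = \int[mu]_x ((h x)%:E * (p x)%:E))%E.
Proof.
have mpE : measurable_fun setT (fun x => (p x)%:E) by exact/measurable_EFinP.
under [LHS]eq_integral do rewrite fimfunE -fsumEFin//.
rewrite [LHS]ge0_integral_fsum//; last 2 first.
  - by move=> r; exact/measurable_EFinP/measurableT_comp.
  - by move=> n x _; rewrite EFinM nnfun_muleindic_ge0.
under [RHS]eq_integral.
  move=> x xD; rewrite fimfunE -fsumEFin// muleC ge0_mule_fsumr; last first.
    by move=> r; rewrite EFinM nnfun_muleindic_ge0.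
  over.
rewrite [RHS]ge0_integral_fsum//; last 2 first.
  - move=> r; apply: emeasurable_funM => //.
    by apply/measurable_EFinP; do 2 apply/measurableT_comp => //.
  - move=> n x _; rewrite EFinM mule_ge0//; last by rewrite nnfun_muleindic_ge0.
    by rewrite lee_fin.
apply: eq_fsbigr => r _.
rewrite integralZl_indic_nnsfun//= integral_indic// setIT mE//.
have [r0|r0] := ltP r 0.
  have -> : h @^-1` [set r] = set0.
    by apply/seteqP; split => // x /= hx; move: r0; rewrite -hx ltNge fun_ge0.
  rewrite integral_set0 mule0 -[LHS](@integral0 _ _ _ mu setT).
  by apply: eq_integral => x _; rewrite indicE in_set0 mulr0 mule0.
rewrite -ge0_integralZl//; last by move=> x _; rewrite lee_fin.
- rewrite integral_mkcond; apply: eq_integral => x _.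
  rewrite patchE indicE; case: (x \in _); first by rewrite mulr1 muleC.
  by rewrite mulr0 mule0.
- exact: measurable_funTS.
Qed.

(** Passes from a law known on sets to expectations: simple functions by linearity, then monotone
    limits. *)
Lemma integral_density (f : T -> \bar R) : measurable_fun setT f ->
  (forall x, 0 <= f x)%E -> (\int[m]_x f x = \int[mu]_x (f x * (p x)%:E))%E.
Proof.
move=> mf f0; pose g := nnsfun_approx measurableT mf.
have cvgg x : (EFin \o g^~ x) @ \oo --> f x by exact: cvg_nnsfun_approx.
transitivity (limn (fun n => \int[m]_x (g n x)%:E))%E.
  rewrite -monotone_convergence//.
  - by apply: eq_integral => y _; apply/esym/cvg_lim => //; exact: cvgg.
  - by move=> n; exact/measurable_EFinP/measurable_funP.
  - by move=> n y _; rewrite lee_fin.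
  - by move=> y _ i j ij; rewrite lee_fin; exact/lefP/nd_nnsfun_approx.
under eq_fun do rewrite density_nnsfun.
rewrite -monotone_convergence//.
- apply: eq_integral => y _; apply/cvg_lim => //.
  by apply: cvgeZr => //; exact: cvgg.
- move=> n; apply: emeasurable_funM; last exact/measurable_EFinP.
  exact/measurable_EFinP/measurable_funP.
- by move=> n y _; rewrite mule_ge0// lee_fin.
- move=> y _ i j ij; apply: lee_wpmul2r; first by rewrite lee_fin.
  by rewrite lee_fin; exact/lefP/nd_nnsfun_approx.
Qed.

End Density.

Section IntRdProd.
Context (R : realType).
Notation leb := (@lebesgue_measure R).

(** The scalar [c] serves the induction: it takes up the factor of the first coordinate while the
    other coordinates are integrated. *)
Lemma intRd_prod n (c : R) (f : 'I_n -> R -> R) : 0 <= c ->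
  (forall i, measurable_fun setT (f i)) -> (forall i x, 0 <= f i x) ->
  (intRd (fun y : n.-tuple R => (c * \prod_(i < n) f i (tnth y i))%:E) =
   c%:E * \prod_(i < n) \int[leb]_x (f i x)%:E)%E.
Proof.
elim: n c f => [|n IH] c f c0 mf f0 /=.
  by rewrite !big_ord0 mulr1 mule1.
pose K := (\prod_(i < n) \int[leb]_x (f (lift ord0 i) x)%:E)%E.
have K0 : (0 <= K)%E.
  by apply: prode_ge0 => i _; apply: integral_ge0 => x _; rewrite lee_fin.
transitivity (\int[leb]_x ((c%:E * K) * (f ord0 x)%:E))%E.
  apply: eq_integral => x _.
  rewrite -[RHS]muleA [(K * _)%E]muleC muleA -EFinM -IH//; last by rewrite mulr_ge0.
  apply: eq_intRd => t; rewrite big_ord_recl tnth0 mulrA.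
  by congr ((_ * _)%:E); apply: eq_bigr => i _; rewrite tnthS.
rewrite ge0_integralZl//.
- by rewrite big_ord_recl -muleA; congr (_ * _)%E; rewrite muleC.
- by apply/measurable_EFinP; apply: mf.
- by move=> x _; rewrite lee_fin.
- by rewrite mule_ge0// lee_fin.
Qed.

(** The generator is Delta and not Delta/2, so each coordinate has variance 2s; this is where the
    standard deviation sqrt(2s) comes from. *)
Lemma qker_prod n (s : R) (y : n.-tuple R) : 0 < s ->
  qker s (origin R n) y = \prod_(i < n) normal_pdf 0 (Num.sqrt (2 * s)) (tnth y i).
Proof.
move=> s0; have sp0 : 0 < 4 * pi * s by rewrite !mulr_gt0 ?pi_gt0.
have s20 : 0 < 2 * s by rewrite mulr_gt0.
have sq : Num.sqrt (2 * s) ^+ 2 = 2 * s by rewrite sqr_sqrtr// ltW.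
under eq_bigr do rewrite normal_pdfE ?gt_eqF ?sqrtr_gt0//.
rewrite big_split/= /qker; congr (_ * _).
  rewrite prodr_const card_ord /normal_peak sq.
  have -> : 2 * s * pi *+ 2 = 4 * pi * s by ring.
  rewrite -powR12_sqrt ?ltW// -powRN -powR_mulrn ?powR_ge0// -powRrM.
  by congr (_ `^ _); field.
rewrite /normal_fun -expR_sum; congr expR.
rewrite /enorm sqr_sqrtr; last by apply: sumr_ge0 => i _; exact: sqr_ge0.
rewrite -sumrN mulr_suml; apply: eq_bigr => i _.
rewrite !tnth_mktuple sq subr0 add0r sqrrN.
by congr (_ / _); ring.
Qed.

End IntRdProd.

(** * Moments of a Gaussian variable *)

Section Expectation.
Context d (T : measurableType d) (R : realType) (P : probability T R).
Implicit Types f g : T -> R.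
Notation intg f := (P.-integrable setT (EFin \o f)).

Lemma ge0_integrable_Rintegral f (c : R) : measurable_fun setT f ->
  (forall w, 0 <= f w) -> (\int[P]_w (f w)%:E = c%:E)%E ->
  intg f /\ \int[P]_w f w = c.
Proof.
move=> mf f0 fc; split; last by rewrite /Rintegral fc.
apply/integrableP; split; first exact/measurable_EFinP.
under eq_integral do rewrite /= ger0_norm//.
by rewrite fc ltry.
Qed.

Lemma integrable_le_real f g : measurable_fun setT f ->
  (forall w, `|f w| <= g w) -> intg g -> intg f.
Proof.
move=> mf fg; apply: le_integrable => //; first exact/measurable_EFinP.
by move=> w _; rewrite lee_fin (le_trans (fg w))// ler_norm.
Qed.

Lemma integrable_bounded f (c : R) : measurable_fun setT f ->
  (forall w, `|f w| <= c) -> intg f.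
Proof.
move=> mf fc; apply: (@integrable_le_real _ (fun=> c)) => //.
by apply: finite_measure_integrable_cst.
Qed.

Lemma Rintegral_cst_prob (c : R) : \int[P]_w c = c.
Proof. by rewrite Rintegral_cst// [X in fine X]probability_setT mulr1. Qed.

Lemma integrable_scale (c : R) f : intg f -> intg (fun w => c * f w).
Proof. by move=> If; exact: (integrableZl measurableT c If). Qed.

Lemma integrable_add f g : intg f -> intg g -> intg (fun w => f w + g w).
Proof. by move=> If Ig; exact: (integrableD measurableT If Ig). Qed.

Lemma Rintegral_sum n (f : 'I_n -> T -> R) : (forall i, intg (f i)) ->
  intg (fun w => \sum_(i < n) f i w) /\
  \int[P]_w (\sum_(i < n) f i w) = \sum_(i < n) \int[P]_w f i w.
Proof.
elim: n f => [|n IH] f If.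
  have -> : (fun w => \sum_(i < 0) f i w) = (fun=> 0).
    by apply/funext => w; rewrite big_ord0.
  by rewrite big_ord0 Rintegral_cst// mul0r; split => //; exact: integrable0.
have [I2 E2] := IH (fun i => f (lift ord0 i)) (fun i => If _).
have -> : (fun w => \sum_(i < n.+1) f i w) =
    (fun w => f ord0 w + \sum_(i < n) f (lift ord0 i) w).
  by apply/funext => w; rewrite big_ord_recl.
rewrite big_ord_recl RintegralD// E2; split => //.
exact: integrable_add.
Qed.

End Expectation.

Section Gauss.
Context d (T : measurableType d) (R : realType) (P : probability T R).
Notation intg f := (P.-integrable setT (EFin \o f)).
Notation leb := (@lebesgue_measure R).

Lemma gauss_pdfE (m s x : R) : 0 < s -> normal_pdf m (Num.sqrt (2 * s)) x =
  (Num.sqrt (4 * pi * s))^-1 * expR (- (x - m) ^+ 2 / (4 * s)).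
Proof.
move=> s0; have s20 : 0 < 2 * s by rewrite mulr_gt0.
have sq : Num.sqrt (2 * s) ^+ 2 = 2 * s by rewrite sqr_sqrtr// ltW.
rewrite normal_pdfE ?gt_eqF ?sqrtr_gt0// /normal_peak /normal_fun sq.
have -> : 2 * s * pi *+ 2 = 4 * pi * s by ring.
by have -> : 2 * s *+ 2 = 4 * s by ring.
Qed.

Variables (Z : T -> R) (s : R).
Hypotheses (s0 : 0 < s) (mZ : measurable_fun setT Z).
Hypothesis lawZ : forall A, measurable A ->
  P (Z @^-1` A) = (\int[leb]_(x in A) (normal_pdf 0 (Num.sqrt (2 * s)) x)%:E)%E.

Lemma gauss_expect (f : R -> R) : measurable_fun setT f -> (forall x, 0 <= f x) ->
  (\int[P]_w (f (Z w))%:E =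
   \int[leb]_x (f x * normal_pdf 0 (Num.sqrt (2 * s)) x)%:E)%E.
Proof.
move=> mf f0.
pose hZ := isMeasurableFun.Build _ _ T (measurableTypeR R) Z mZ.
pose rZ : {RV P >-> measurableTypeR R} := HB.pack Z hZ.
transitivity (\int[distribution P rZ]_x (f x)%:E)%E.
  by rewrite ge0_integral_distribution//; exact/measurable_EFinP.
under [RHS]eq_integral do rewrite EFinM.
apply: (@integral_density _ (measurableTypeR R) _ (distribution P rZ) leb).
- exact: measurable_normal_pdf.
- exact: normal_pdf_ge0.
- exact: lawZ.
- exact/measurable_EFinP.
- by move=> x; rewrite lee_fin.
Qed.

(** Completing the square: tilting the centred density by exp(l x) gives the density centred at 2sl,
    times exp(s l^2). *)
Lemma gauss_mgf (l : R) :
  (\int[P]_w (expR (l * Z w))%:E = (expR (s * l ^+ 2))%:E)%E.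
Proof.
rewrite (gauss_expect (f := fun x => expR (l * x)))//; last first.
  by apply: measurableT_comp => //; exact: measurable_funM.
transitivity (\int[leb]_x ((expR (s * l ^+ 2))%:E *
    (normal_pdf (2 * s * l) (Num.sqrt (2 * s)) x)%:E))%E.
  apply: eq_integral => x _; rewrite -EFinM; congr EFin.
  rewrite !gauss_pdfE// mulrCA [RHS]mulrCA -!expRD; congr (_ * expR _).
  by field; rewrite gt_eqF.
rewrite ge0_integralZl//.
- by rewrite integral_normal_pdf mule1.
- by apply/measurable_EFinP; exact: measurable_normal_pdf.
- by move=> x _; rewrite lee_fin normal_pdf_ge0.
Qed.

(** The factor exp(h x^2) turns the density into the one with parameter s' = s/(1 - 4sh), since
    1/(4s') = 1/(4s) - h; only the normalization changes. *)
Lemma gauss_mgf2 (h : R) : 4 * s * h < 1 ->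
  (\int[P]_w (expR (h * Z w ^+ 2))%:E = ((Num.sqrt (1 - 4 * s * h))^-1)%:E)%E.
Proof.
move=> h1; have k0 : 0 < 1 - 4 * s * h by rewrite subr_gt0.
rewrite (gauss_expect (f := fun x => expR (h * x ^+ 2)))//; last first.
  by apply: measurableT_comp => //; apply: measurable_funM => //; exact: measurable_funX.
pose s' := s / (1 - 4 * s * h).
have s'0 : 0 < s' by rewrite divr_gt0.
transitivity (\int[leb]_x (((Num.sqrt (1 - 4 * s * h))^-1)%:E *
    (normal_pdf 0 (Num.sqrt (2 * s')) x)%:E))%E.
  apply: eq_integral => x _; rewrite -EFinM; congr EFin.
  rewrite !gauss_pdfE// mulrCA -expRD [RHS]mulrA -invfM -sqrtrM ?ltW//.
  congr (_ ^-1 * expR _).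
    by congr Num.sqrt; rewrite /s'; field; rewrite gt_eqF.
  by rewrite /s'; field; rewrite !gt_eqF.
rewrite ge0_integralZl//.
- by rewrite integral_normal_pdf mule1.
- by apply/measurable_EFinP; exact: measurable_normal_pdf.
- by move=> x _; rewrite lee_fin normal_pdf_ge0.
Qed.

Let inv_sqrt_le (a b : R) : 0 < a -> 0 <= b -> 1 <= a * b ^+ 2 -> (Num.sqrt a)^-1 <= b.
Proof.
move=> a0 b0 ab; rewrite -[leLHS]mul1r ler_pdivrMr ?sqrtr_gt0//.
rewrite -[b in leRHS]ger0_norm// -sqrtr_sqr -sqrtrM ?sqr_ge0//.
by rewrite -[leLHS]sqrtr1 ler_wsqrtr// mulrC.
Qed.

Let expZ2 (h : R) : 4 * s * h < 1 ->
  intg (fun w => expR (h * Z w ^+ 2)) /\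
  \int[P]_w expR (h * Z w ^+ 2) = (Num.sqrt (1 - 4 * s * h))^-1.
Proof.
move=> h1; apply: ge0_integrable_Rintegral; last exact: gauss_mgf2.
- by apply: measurableT_comp => //; apply: measurable_funM => //; exact: measurable_funX.
- by move=> w; exact: expR_ge0.
Qed.

Lemma gauss_integrable2 : intg (fun w => Z w ^+ 2).
Proof.
have [|I _] := @expZ2 (8 * s)^-1.
  by rewrite (_ : _ * _ = 1 / 2) ; [lra|field; rewrite gt_eqF].
apply: integrable_le_real (integrable_scale (8 * s) I); first exact: measurable_funX.
move=> w; rewrite ger0_norm ?sqr_ge0//.
have := expR_ge1Dx ((8 * s)^-1 * Z w ^+ 2).
set y := (8 * s)^-1 * _.
have -> : Z w ^+ 2 = (8 * s) * y by rewrite /y; field; rewrite gt_eqF.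
by move=> hy; rewrite ler_pM2l ?mulr_gt0//; lra.
Qed.

(** With y = Z^2/(8s), the inequality y/2 <= exp(y/2) gives Z^4 = 64 s^2 y^2 <= 256 s^2 exp(y), and
    E exp(y) = sqrt 2 <= 2; hence 512. *)
Lemma gauss_moment4 : intg (fun w => Z w ^+ 4) /\ \int[P]_w Z w ^+ 4 <= 512 * s ^+ 2.
Proof.
have k : 4 * s * (8 * s)^-1 = 1 / 2 by field; rewrite gt_eqF.
have [|I EI] := @expZ2 (8 * s)^-1; first by rewrite k; lra.
have I2 := integrable_scale (256 * s ^+ 2) I.
have le w : Z w ^+ 4 <= 256 * s ^+ 2 * expR ((8 * s)^-1 * Z w ^+ 2).
  set y := (8 * s)^-1 * _.
  have -> : Z w ^+ 4 = (64 * s ^+ 2) * y ^+ 2 by rewrite /y; field; rewrite gt_eqF.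
  have y0 : 0 <= y by rewrite mulr_ge0 ?sqr_ge0// invr_ge0 mulr_ge0// ltW.
  have := expR_ge1Dx (y / 2).
  have -> : expR y = expR (y / 2) ^+ 2 by rewrite expr2 -expRD; congr expR; field.
  set e := expR _ => he.
  have -> : 256 * s ^+ 2 * e ^+ 2 = 64 * s ^+ 2 * (4 * e ^+ 2) by ring.
  have e2 : 0 <= (e - y / 2) * (e + y / 2) by apply: mulr_ge0; lra.
  by apply: ler_wpM2l; [apply: mulr_ge0 => //; exact: sqr_ge0|lra].
have I4 : intg (fun w => Z w ^+ 4).
  apply: integrable_le_real I2; first exact: measurable_funX.
  by move=> w; rewrite ger0_norm ?exprn_even_ge0.
split=> //; apply: le_trans (_ : _ <= 256 * s ^+ 2 * \int[P]_w expR ((8 * s)^-1 * Z w ^+ 2)) _.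
  by rewrite -RintegralZl//; apply: le_Rintegral.
rewrite EI k.
have : (Num.sqrt (1 - 1 / 2 : R))^-1 <= 2 by apply: inv_sqrt_le; lra.
by have := sqr_ge0 s; nra.
Qed.

(** From 1 + y <= exp y the mean m satisfies 1 + l m <= E exp(l Z) = exp(s l^2) for every real l.
    The right side has no linear term at l = 0, which forces m = 0. *)
Lemma gauss_moment1 : intg Z /\ \int[P]_w Z w = 0.
Proof.
have I1 : intg (fun=> 1 : R) by apply: finite_measure_integrable_cst.
have I : intg Z.
  apply: integrable_le_real (integrable_add I1 gauss_integrable2) => // w.
  by rewrite ler_norml; have := sqr_ge0 (Z w - 1); have := sqr_ge0 (Z w + 1); nra.
split=> //; set m := Rintegral _ _ _.
have H l : 1 + l * m <= expR (s * l ^+ 2).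
  have [Ie <-] : intg (fun w => expR (l * Z w)) /\
      \int[P]_w expR (l * Z w) = expR (s * l ^+ 2).
    apply: ge0_integrable_Rintegral; last exact: gauss_mgf.
    - by apply: measurableT_comp => //; exact: measurable_funM.
    - by move=> w; exact: expR_ge0.
  rewrite /m -RintegralZl//.
  have -> : (1 : R) = \int[P]_w (1 : R).
    by rewrite Rintegral_cst_prob.
  rewrite -RintegralD//; last exact: integrable_scale.
  apply: le_Rintegral => //.
    by apply: integrable_add => //; exact: integrable_scale.
  by move=> w _; exact: expR_ge1Dx.
clearbody m; apply/eqP; apply/negPn/negP => m0.
have m20 : 0 < m ^+ 2 by rewrite exprn_even_gt0.
(* The test value is l = t m. This [t] ensures 4st <= 1 and t m^2 <= 1, so the exponent s l^2 is at
   most a quarter of l m = t m^2, too small for exp(s l^2) to reach 1 + l m. *)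
pose t := (1 + 4 * s + m ^+ 2)^-1.
have D0 : 0 < 1 + 4 * s + m ^+ 2 by rewrite !addr_gt0// mulr_gt0.
have t0 : 0 < t by rewrite invr_gt0.
have t1 : t * (1 + 4 * s + m ^+ 2) = 1 by rewrite mulVf// gt_eqF.
have st : 4 * (s * t) <= 1 by nra.
have mt : t * m ^+ 2 <= 1.
  have ts := mulr_gt0 t0 s0; move: t1; rewrite !mulrDr mulr1 => t1.
  clearbody t; lra.
have := H (t * m); have -> : t * m * m = t * m ^+ 2 by ring.
have -> : s * (t * m) ^+ 2 = (s * t) * (t * m ^+ 2) by ring.
set y := s * t * _.
have st0 : 0 < s * t by rewrite mulr_gt0.
have mt0 : 0 < t * m ^+ 2 by rewrite mulr_gt0.
have y0 : 0 < y by rewrite mulr_gt0.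
have y1 : 4 * y <= t * m ^+ 2 by rewrite /y; nra.
have := expR_ge1Dx (- y); rewrite expRN => ey.
have e0 := expR_gt0 y.
have : (1 - y) * expR y <= 1 by rewrite -ler_pdivlMr// mul1r.
by move: e0 => /=; nra.
Qed.

(** Again by 1 + y <= exp y: 1 + h m <= (1 - 4sh)^(-1/2) = 1 + 2sh + O(h^2) for small h of both
    signs, so the linear coefficients agree. *)
Lemma gauss_moment2 : \int[P]_w Z w ^+ 2 = 2 * s.
Proof.
set m := Rintegral _ _ _.
have I1 : intg (fun=> 1 : R) by apply: finite_measure_integrable_cst.
have H h : 4 * s * h < 1 -> 1 + h * m <= (Num.sqrt (1 - 4 * s * h))^-1.
  move=> h1; have [Ie <-] := expZ2 h1.
  rewrite /m -RintegralZl//; last exact: gauss_integrable2.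
  have -> : (1 : R) = \int[P]_w (1 : R).
    by rewrite Rintegral_cst_prob.
  have I2 := integrable_scale h gauss_integrable2.
  rewrite -RintegralD//; apply: le_Rintegral => //; first exact: integrable_add.
  by move=> w _; exact: expR_ge1Dx.
clearbody m; have B h : 0 < h -> 8 * s * h <= 1 -> `|m - 2 * s| <= 16 * s ^+ 2 * h.
  move=> h0 h1; pose y := 4 * s * h.
  have y0 : 0 < y by rewrite !mulr_gt0.
  have y1 : 2 * y <= 1 by rewrite /y; lra.
  have y2 : y ^+ 2 <= y / 2 by nra.
  (* With y = 4sh, the bound (1 - y)^(-1/2) <= 1 + y/2 + y^2 is checked by squaring; the next step
     is its counterpart for -h. *)
  have U : 1 + h * m <= 1 + y / 2 + y ^+ 2.
    apply: le_trans (H _ _) _; first by rewrite -/y; lra.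
    rewrite -/y; apply: inv_sqrt_le; [lra|nra|].
    have -> : (1 - y) * (1 + y / 2 + y ^+ 2) ^+ 2 =
        1 + y ^+ 2 * (5 / 4 - 5 / 4 * y - y * y ^+ 2) by field.
    by rewrite lerDl; apply: mulr_ge0; [exact: sqr_ge0|nra].
  have L : 1 + (- h) * m <= 1 - y / 2 + y ^+ 2.
    apply: le_trans (H _ _) _; first by rewrite mulrN -/y; lra.
    rewrite mulrN -/y opprK; apply: inv_sqrt_le; [lra|nra|].
    have -> : (1 + y) * (1 - y / 2 + y ^+ 2) ^+ 2 =
        1 + y ^+ 2 * (5 / 4 + 5 / 4 * y + y * y ^+ 2) by field.
    by rewrite lerDl; apply: mulr_ge0; [exact: sqr_ge0|nra].
  have E1 : h * (m - 2 * s) = h * m - y / 2 by rewrite /y; field.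
  have E2 : h * (16 * s ^+ 2 * h) = y ^+ 2 by rewrite /y; ring.
  by rewrite ler_norml -[X in _ && X](ler_pM2l h0) -[X in X && _](ler_pM2l h0) mulrN E1 E2; lra.
apply/eqP; rewrite -subr_eq0 -normr_le0 leNgt; apply/negP => d0.
set D := `|_| in B d0.
(* The denominator gives both 8sh <= 1, so that the bound applies, and 32 s^2 h < D, which
   contradicts D <= 16 s^2 h. *)
pose h := D / (32 * s ^+ 2 + 8 * s * D).
have den0 : 0 < 32 * s ^+ 2 + 8 * s * D.
  by rewrite addr_gt0// !mulr_gt0// exprn_gt0.
have h0 : 0 < h by rewrite divr_gt0.
have hd : h * (32 * s ^+ 2 + 8 * s * D) = D by rewrite /h divfK// gt_eqF.
have sh0 : 0 < h * s ^+ 2 by rewrite mulr_gt0// exprn_gt0.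
have h8 : 8 * s * h <= 1.
  by rewrite -(ler_pM2r d0) mul1r -[leRHS]hd; nra.
have := B h h0 h8.
have : 0 < h * s * D by apply: mulr_gt0 => //; exact: mulr_gt0.
clearbody D h; nra.
Qed.

End Gauss.

(** * Mean of a second-order expansion over one Gaussian step *)

Lemma normrM_le_sqr (R : realType) (x y : R) : `|x * y| <= x ^+ 2 + y ^+ 2.
Proof.
have := sqr_ge0 (x - y); have := sqr_ge0 (x + y); have := sqr_ge0 x; have := sqr_ge0 y.
by rewrite ler_norml => *; apply/andP; split; nra.
Qed.

Section StepExpectation.
Context dT (T : measurableType dT) (R : realType) (P : probability T R).
Notation intg f := (P.-integrable setT (EFin \o f)).
Variables (d : nat) (z : 'I_d -> T -> R) (s : R).
Hypothesis s0 : 0 < s.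
Hypotheses (Iz : forall i, intg (z i)) (Ez : forall i, \int[P]_w z i w = 0).
Hypotheses (I2 : forall i j, intg (fun w => z i w * z j w)).
Hypothesis E2 : forall i j, \int[P]_w (z i w * z j w) = if i == j then 2 * s else 0.
Hypotheses (I4 : forall i, intg (fun w => z i w ^+ 4)).
Hypothesis E4 : forall i, \int[P]_w z i w ^+ 4 <= 512 * s ^+ 2.

Lemma sqr_sum_le n (a : 'I_n -> R) :
  (\sum_(i < n) a i) ^+ 2 <= 2 ^+ n * \sum_(i < n) a i ^+ 2.
Proof.
elim: n a => [|n IH] a; first by rewrite !big_ord0 expr0n mulr0.
rewrite !big_ord_recl; set S := \sum_(i < n) _; set Q := \sum_(i < n) _.
have {IH} : S ^+ 2 <= 2 ^+ n * Q by exact: IH.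
have p1 : 1 <= 2 ^+ n :> R by rewrite exprn_ege1// ler1n.
have := sqr_ge0 (a ord0 - S); have := sqr_ge0 (a ord0).
have -> : 2 ^+ n.+1 = 2 * 2 ^+ n :> R by rewrite exprS.
move: (a ord0) (2 ^+ n : R) p1 => x N p1 hx hS hQ.
have : 0 <= (N - 1) * x ^+ 2 by apply: mulr_ge0; lra.
by clearbody S Q; lra.
Qed.

(** Linear terms and mixed products average to zero, so only the trace of [q] survives. The cubic
    remainder is controlled by second and fourth moments alone, which yields the order s^(3/2). *)
Lemma step_expectation (phi : T -> R) (D M a0 : R) (b : 'I_d -> R) (q : 'I_d -> 'I_d -> R) :
  0 <= M -> measurable_fun setT phi -> (forall w, `|phi w| <= D) ->
  (forall w, `|phi w - (a0 + \sum_(i < d) b i * z i w +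
       \sum_(i < d) \sum_(j < d) q i j * (z i w * z j w))| <=
     M * Num.sqrt (\sum_(i < d) z i w ^+ 2) ^+ 3) ->
  `|\int[P]_w phi w - (a0 + 2 * s * \sum_(i < d) q i i)| <=
    M * ((2 * d%:R + 512 * d%:R * 2 ^+ d) * (s * Num.sqrt s)).
Proof.
move=> M0 mphi Dphi H.
have Iphi := integrable_bounded P mphi Dphi.
have Ib i : intg (fun w => b i * z i w) by exact: integrable_scale.
have Iq i j : intg (fun w => q i j * (z i w * z j w)) by exact: integrable_scale.
have [Ib' Eb] := Rintegral_sum Ib.
have [Iq' Eq] := Rintegral_sum (fun i => (Rintegral_sum (Iq i)).1).
pose L w := a0 + \sum_(i < d) b i * z i w +
  \sum_(i < d) \sum_(j < d) q i j * (z i w * z j w).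
have Ia : intg (fun=> a0) by exact: finite_measure_integrable_cst.
have IL : intg L by apply: integrable_add => //; exact: integrable_add.
have EL : \int[P]_w L w = a0 + 2 * s * \sum_(i < d) q i i.
  rewrite /L RintegralD//; last exact: integrable_add.
  rewrite RintegralD// Rintegral_cst_prob Eb Eq big1 ?addr0; last first.
    by move=> i _; rewrite RintegralZl// Ez mulr0.
  congr (_ + _); rewrite mulr_sumr; apply: eq_bigr => i _.
  rewrite (Rintegral_sum (Iq i)).2 (bigD1 i)//= big1 ?addr0.
    by rewrite RintegralZl// E2 eqxx mulrC.
  by move=> j ij; rewrite RintegralZl// E2 eq_sym (negbTE ij) mulr0.
pose r := Num.sqrt s.
have r0 : 0 < r by rewrite sqrtr_gt0.
have rr : r ^+ 2 = s by rewrite sqr_sqrtr// ltW.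
have Iz2 i : intg (fun w => z i w ^+ 2).
  by rewrite (_ : (fun w => _) = (fun w => z i w * z i w))//; exact: I2.
have [IS2 ES2] := Rintegral_sum Iz2.
have [IS4 ES4] := Rintegral_sum I4.
(* With N = |z| one has N^3 <= r N^2 + N^4/r; the choice r = sqrt s gives both terms a mean of order
   s^(3/2). The factor 2^d comes from bounding N^4 by the sum of the fourth powers. *)
pose C w := r * (\sum_(i < d) z i w ^+ 2) + 2 ^+ d / r * (\sum_(i < d) z i w ^+ 4).
have IC : intg C by apply: integrable_add; exact: integrable_scale.
have EC : \int[P]_w C w <= (2 * d%:R + 512 * d%:R * 2 ^+ d) * (s * r).
  rewrite /C RintegralD//; try exact: integrable_scale.
  rewrite !RintegralZl// ES2 ES4.
  have -> : \sum_(i < d) \int[P]_w z i w ^+ 2 = d%:R * (2 * s).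
    under eq_bigr => i _.
      rewrite (_ : \int[P]_w z i w ^+ 2 = 2 * s); last first.
        by have := E2 i i; rewrite eqxx => <-; apply: eq_Rintegral => w _; rewrite expr2.
      over.
    by rewrite sumr_const card_ord [RHS]mulr_natl.
  have S4 : \sum_(i < d) \int[P]_w z i w ^+ 4 <= d%:R * (512 * s ^+ 2).
    apply: le_trans (ler_sum _ (fun i _ => E4 i)) _.
    by rewrite sumr_const card_ord [leRHS]mulr_natl.
  have k0 : 0 <= 2 ^+ d / r by rewrite divr_ge0 ?exprn_ge0// ltW.
  have := ler_wpM2l k0 S4; rewrite -rr => S4'.
  have -> : (2 * d%:R + 512 * d%:R * 2 ^+ d) * (r ^+ 2 * r) =
    r * (d%:R * (2 * r ^+ 2)) + 2 ^+ d / r * (d%:R * (512 * r ^+ 2 ^+ 2)).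
    by field; rewrite gt_eqF.
  by rewrite lerD2l.
have MC w : M * Num.sqrt (\sum_(i < d) z i w ^+ 2) ^+ 3 <= M * C w.
  apply: ler_wpM2l => //; rewrite /C.
  set S := \sum_(i < d) z i w ^+ 2; set Q := \sum_(i < d) z i w ^+ 4.
  have S0 : 0 <= S by apply: sumr_ge0 => i _; exact: sqr_ge0.
  have SQ : S ^+ 2 <= 2 ^+ d * Q.
    apply: le_trans (sqr_sum_le _) _; apply: ler_wpM2l; first exact: exprn_ge0.
    by apply: ler_sum => i _; rewrite -exprM.
  set N := Num.sqrt S; have N0 : 0 <= N by exact: sqrtr_ge0.
  have NS : N ^+ 2 = S by rewrite sqr_sqrtr.
  apply: (@le_trans _ _ (r * S + S ^+ 2 / r)); last first.
    by rewrite lerD2l [leRHS]mulrAC; apply: ler_wpM2r => //; rewrite invr_ge0; exact: ltW.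
  rewrite -NS -(ler_pM2l r0).
  have -> : r * (r * N ^+ 2 + N ^+ 2 ^+ 2 / r) = r * N ^+ 3 +
      N ^+ 2 * (r ^+ 2 + N ^+ 2 - r * N) by field; rewrite gt_eqF.
  rewrite lerDl; apply: mulr_ge0; first exact: sqr_ge0.
  by have := sqr_ge0 (r - N); have := mulr_ge0 (ltW r0) N0; clearbody N r; nra.
have IMC := integrable_scale M IC.
have EMC : \int[P]_w (M * C w) <= M * ((2 * d%:R + 512 * d%:R * 2 ^+ d) * (s * r)).
  by rewrite RintegralZl//; exact: ler_wpM2l.
have U : \int[P]_w phi w <= \int[P]_w (L w + M * C w).
  apply: le_Rintegral => //; first exact: integrable_add.
  move=> w _; have := le_trans (H w) (MC w); rewrite ler_norml -/(L w) => /andP[_ h].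
  by move: h; rewrite lerBlDl.
have Lw : \int[P]_w L w <= \int[P]_w (phi w + M * C w).
  apply: le_Rintegral => //; first exact: integrable_add.
  move=> w _; have := le_trans (H w) (MC w); rewrite ler_norml -/(L w) => /andP[h _].
  by move: h; lra.
rewrite RintegralD// EL in U; rewrite RintegralD// EL in Lw.
by rewrite ler_norml -/r; apply/andP; split; lra.
Qed.

End StepExpectation.

(** * Increments of Brownian motion on a grid of step s *)

Section Increments.
Context (R : realType) (d : nat) (dO : measure_display) (Omega : measurableType dO).
Variables (P : probability Omega R) (B : R -> Omega -> d.-tuple R).
Hypothesis hB : is_BM P B.
Variable s : R.
Hypothesis s0 : 0 < s.
Notation leb := (@lebesgue_measure R).
Notation intg f := (P.-integrable setT (EFin \o f)).

Definition incr k w := tsub (B (k.+1%:R * s) w) (B (k%:R * s) w).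
Definition incr_law (A : set (d.-tuple R)) : \bar R :=
  intRd (fun y => (\1_A y * qker s (origin R d) y)%:E).
Definition past k w : k.-tuple (d.-tuple R) := [tuple incr j w | j < k].

Lemma measurable_BM t : measurable_fun setT (B t).
Proof. by case: hB. Qed.

Lemma measurable_incr k : measurable_fun setT (incr k).
Proof.
apply/measurable_fun_tnthP => i.
rewrite (_ : _ \o _ = fun w => tnth (B (k.+1%:R * s) w) i - tnth (B (k%:R * s) w) i).
  by apply: measurable_funB; apply: (measurableT_comp (measurable_tnth i)); exact: measurable_BM.
by apply/funext => w; rewrite /= tnth_mktuple.
Qed.

Lemma measurable_past k : measurable_fun setT (past k).
Proof.
apply/measurable_fun_tnthP => i.
rewrite (_ : _ \o _ = incr i); first exact: measurable_incr.
by apply/funext => w; rewrite /= tnth_mktuple.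
Qed.

Lemma prob_incr n (A : nat -> set (d.-tuple R)) : (forall k, measurable (A k)) ->
  P (\bigcap_(k in [set k | (k < n)%N]) [set w | A k (incr k w)]) =
  (\prod_(k < n) incr_law (A k))%E.
Proof.
move=> mA; case: hB => _ _ _ H.
rewrite (H n (fun k => k%:R * s) A)//.
- apply: eq_bigr => k _; apply: eq_intRd => y.
  by rewrite -mulrBl -natr1 addrAC subrr add0r mul1r.
- by rewrite mul0r.
- by move=> k; rewrite ltr_pM2r// ltr_nat.
Qed.

(** Read off from the increment clause of [is_BM] with n = 1 rather than computed. *)
Lemma incr_lawT : incr_law setT = 1%E.
Proof.
have := @prob_incr 1 (fun _ => setT) (fun _ => measurableT).
rewrite big_ord_recl big_ord0 mule1 => <-.
by rewrite -[RHS](probability_setT P); congr (P _); apply/seteqP; split.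
Qed.

Lemma prob_incr1 k A : measurable A -> P (incr k @^-1` A) = incr_law A.
Proof.
move=> mA.
have := @prob_incr k.+1 (fun j => if j == k then A else setT).
rewrite big_ord_recr/= eqxx big1 ?mul1e; last first.
  by move=> j _; rewrite ltn_eqF// incr_lawT.
move=> <-; last by move=> j; case: ifP.
congr (P _); apply/seteqP; split => w /=.
  by move=> Aw j _; case: eqP => // ->.
by move=> /(_ k); rewrite /= eqxx; apply.
Qed.

Lemma past_incr_indep k (A : set (k.-tuple (d.-tuple R))) (C : set (d.-tuple R)) :
  measurable A -> measurable C ->
  P (past k @^-1` A `&` incr k @^-1` C) = (P (past k @^-1` A) * P (incr k @^-1` C))%E.
Proof.
move: A C; apply: indep_tuple; [exact: measurable_past|exact: measurable_incr|].
move=> A C mA mC.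
(* The default value [C] is what index [k] receives, so that the joint event concerns the first k+1
   increments and [prob_incr] applies to it. *)
pose A' j := if insub j is Some i then A i else C.
have mA' j : measurable (A' j) by rewrite /A'; case: insubP => [i _ _|_].
have A'E (i : 'I_k) : A' i = A i by rewrite /A' valK.
have A'k : A' k = C by rewrite /A' insubF// ltnn.
have e1 : [set w | forall i, A i (tnth (past k w) i)] =
    \bigcap_(j in [set j | (j < k)%N]) [set w | A' j (incr j w)].
  apply/seteqP; split => w /= h.
    by move=> j /= jk; have := h (Ordinal jk); rewrite tnth_mktuple -A'E.
  by move=> i; rewrite tnth_mktuple -A'E; apply: h => /=.
have e2 : [set w | forall i, A i (tnth (past k w) i)] `&` incr k @^-1` C =
    \bigcap_(j in [set j | (j < k.+1)%N]) [set w | A' j (incr j w)].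
  rewrite e1; apply/seteqP; split => w /=.
    move=> [h Cw] j /=; rewrite ltnS leq_eqVlt => /predU1P[->|jk]; first by rewrite A'k.
    exact: h.
  move=> h; split; last by rewrite -A'k; apply: h => /=.
  by move=> j /= jk; apply: h => /=; rewrite ltnS ltnW.
by rewrite e2 e1 !prob_incr// big_ord_recr/= A'k prob_incr1.
Qed.

(** The heat kernel at the origin factorizes over coordinates; hence the coordinates of an increment
    are independent centred Gaussians. *)
Lemma incr_law_rect (A : 'I_d -> set R) : (forall i, measurable (A i)) ->
  incr_law [set y | forall i, A i (tnth y i)] =
  (\prod_(i < d) \int[leb]_(x in A i) (normal_pdf 0 (Num.sqrt (2 * s)) x)%:E)%E.
Proof.
move=> mA.
transitivity (intRd (fun y : d.-tuple R => (1 * \prod_(i < d)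
   (\1_(A i) (tnth y i) * normal_pdf 0 (Num.sqrt (2 * s)) (tnth y i)))%:E)).
  apply: eq_intRd => y; rewrite mul1r big_split/= qker_prod//; congr (_ * _)%:E.
  rewrite indicE; case: (boolP (y \in _)) => [/set_mem Ay|/negP nAy].
    by rewrite big1// => i _; rewrite indicE mem_set//; exact: Ay.
  have [i ni] : exists i, ~ A i (tnth y i).
    by apply/existsNP => Ay; apply: nAy; exact: mem_set.
  by rewrite (bigD1 i)//= indicE memNset// mul0r.
rewrite (@intRd_prod _ _ 1 (fun i x => \1_(A i) x * normal_pdf 0 (Num.sqrt (2 * s)) x))//.
- rewrite mul1e; apply: eq_bigr => i _; rewrite [RHS]integral_mkcond.
  apply: eq_integral => x _; rewrite patchE indicE; case: (x \in A i).
    by rewrite mul1r.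
  by rewrite mul0r.
- move=> i; apply: measurable_funM; first exact: measurable_indic.
  exact: measurable_normal_pdf.
- by move=> i x; rewrite mulr_ge0// normal_pdf_ge0.
Qed.

Lemma prob_incr_rect k (A : 'I_d -> set R) : (forall i, measurable (A i)) ->
  P [set w | forall i, A i (tnth (incr k w) i)] =
  (\prod_(i < d) \int[leb]_(x in A i) (normal_pdf 0 (Num.sqrt (2 * s)) x)%:E)%E.
Proof.
move=> mA; rewrite -incr_law_rect//.
by rewrite -(@prob_incr1 k)//; exact: measurable_cylinder.
Qed.

Lemma coord_law k i (A : set R) : measurable A ->
  P ((fun w => tnth (incr k w) i) @^-1` A) =
  (\int[leb]_(x in A) (normal_pdf 0 (Num.sqrt (2 * s)) x)%:E)%E.
Proof.
move=> mA; have := @prob_incr_rect k (fun j => if j == i then A else setT).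
rewrite (bigD1 i)//= eqxx big1 ?mule1; last first.
  by move=> j /negbTE ->; exact: integral_normal_pdf.
move=> <-; last by move=> j; case: ifP.
congr (P _); apply/seteqP; split => w /=; first by move=> Aw j; case: eqP => // ->.
by move=> /(_ i); rewrite eqxx.
Qed.

Lemma coord_indep k i j (A C : set R) : i != j -> measurable A -> measurable C ->
  P ((fun w => tnth (incr k w) i) @^-1` A `&` (fun w => tnth (incr k w) j) @^-1` C) =
  (P ((fun w => tnth (incr k w) i) @^-1` A) * P ((fun w => tnth (incr k w) j) @^-1` C))%E.
Proof.
move=> ij mA mC; rewrite !coord_law//.
have := @prob_incr_rect k (fun l => if l == i then A else if l == j then C else setT).
rewrite (bigD1 i)//= eqxx (bigD1 j)/=; last by rewrite eq_sym.
rewrite [j == i]eq_sym (negbTE ij) eqxx big1 ?mule1; last first.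
  by move=> l /andP[/negbTE -> /negbTE ->]; exact: integral_normal_pdf.
move=> <-; last by move=> l; case: ifP => //; case: ifP.
congr (P _); apply/seteqP; split => w /=.
  by move=> [Aw Cw] l; case: eqP => [->//|_]; case: eqP => // ->.
move=> h; split; first by have := h i; rewrite eqxx.
by have := h j; rewrite eq_sym (negbTE ij) eqxx.
Qed.

Lemma measurable_coord k i : measurable_fun setT (fun w => tnth (incr k w) i).
Proof. exact: (measurableT_comp (measurable_tnth i) (measurable_incr k)). Qed.

Lemma coord_moments k i :
  [/\ intg (fun w => tnth (incr k w) i), \int[P]_w tnth (incr k w) i = 0,
      intg (fun w => tnth (incr k w) i ^+ 2) &
      \int[P]_w tnth (incr k w) i ^+ 2 = 2 * s] /\
  (intg (fun w => tnth (incr k w) i ^+ 4) /\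
   \int[P]_w tnth (incr k w) i ^+ 4 <= 512 * s ^+ 2).
Proof.
have mZ := measurable_coord k i.
have lZ A := @coord_law k i A.
have [I1 E1] := gauss_moment1 s0 mZ lZ.
have [I4 E4] := gauss_moment4 s0 mZ lZ.
have I2 := gauss_integrable2 s0 mZ lZ.
have E2 := gauss_moment2 s0 mZ lZ.
by split.
Qed.

(** [indep_integral] handles non-negative integrands only, so the mixed moment is recovered by
    polarization: for distinct coordinates the mean of (a+b)^2 is 4s by independence, which leaves
    nothing for 2ab. *)
Lemma coord_mul k i j :
  intg (fun w => tnth (incr k w) i * tnth (incr k w) j) /\
  \int[P]_w (tnth (incr k w) i * tnth (incr k w) j) = if i == j then 2 * s else 0.
Proof.
have [[I1 E1 I2 E2] _] := coord_moments k i; have [[J1 F1 J2 F2] _] := coord_moments k j.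
have mi := measurable_coord k i; have mj := measurable_coord k j.
set a := fun w => tnth (incr k w) i in I1 E1 I2 E2 mi *.
set b := fun w => tnth (incr k w) j in J1 F1 J2 F2 mj *.
have Iab : intg (fun w => a w * b w).
  apply: integrable_le_real (integrable_add I2 J2); first exact: measurable_funM.
  by move=> w; exact: normrM_le_sqr.
split => //; case: eqP => [ij|/eqP ij].
  by rewrite -E2; apply: eq_Rintegral => w _; rewrite /a /b -ij expr2.
have I1c (c : R) : intg (fun=> c) by exact: finite_measure_integrable_cst.
have inner c : intg (fun w => (c + b w) ^+ 2) /\ \int[P]_w (c + b w) ^+ 2 = c ^+ 2 + 2 * s.
  have -> : (fun w => (c + b w) ^+ 2) = (fun w => (c ^+ 2 + (2 * c) * b w) + b w ^+ 2).
    by apply/funext => w; ring.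
  have Ic := integrable_scale (2 * c) J1.
  have Ic' := integrable_add (I1c (c ^+ 2)) Ic.
  split; first exact: integrable_add.
  by rewrite !RintegralD// RintegralZl// F1 F2 Rintegral_cst_prob mulr0 addr0.
have Iab2 : intg (fun w => (a w + b w) ^+ 2).
  have -> : (fun w => (a w + b w) ^+ 2) = (fun w => (a w ^+ 2 + 2 * (a w * b w)) + b w ^+ 2).
    by apply/funext => w; ring.
  by apply: integrable_add => //; apply: integrable_add => //; exact: integrable_scale.
have H : (\int[P]_w ((a w + b w) ^+ 2)%:E = \int[P]_w (a w ^+ 2 + 2 * s)%:E)%E.
  rewrite (@indep_integral _ _ _ P _ _ _ _ a b (fun x y => ((x + y) ^+ 2)%:E))//.
  - apply: eq_integral => w _; have [Ii <-] := inner (a w).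
    by rewrite /Rintegral fineK//; exact: integrable_fin_num Ii.
  - by move=> A C mA mC; exact: coord_indep.
  - apply/measurable_EFinP; apply: measurable_funX.
    by apply: measurable_funD; [exact: measurable_fst|exact: measurable_snd].
  - by move=> x y; rewrite lee_fin sqr_ge0.
have {H} : \int[P]_w (a w + b w) ^+ 2 = \int[P]_w (a w ^+ 2 + 2 * s).
  by rewrite /Rintegral H.
rewrite RintegralD// Rintegral_cst_prob.
have -> : (fun w => (a w + b w) ^+ 2) = (fun w => (a w ^+ 2 + 2 * (a w * b w)) + b w ^+ 2).
  by apply/funext => w; ring.
have Iab' := integrable_scale 2 Iab.
have Iab'' := integrable_add I2 Iab'.
rewrite !RintegralD// RintegralZl// E2 F2; lra.
Qed.

End Increments.

(** * Derivative rules and Taylor's inequality on [0,1] *)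

Section DerivativeRules.
Context (R : realType).
Implicit Types (f g : R -> R) (x a b : R).

Lemma isder_add f g x a b : is_derive x 1 f a -> is_derive x 1 g b ->
  is_derive x 1 (fun y => f y + g y) (a + b).
Proof. by move=> df dg; exact: is_deriveD. Qed.

Lemma isder_mul f g x a b : is_derive x 1 f a -> is_derive x 1 g b ->
  is_derive x 1 (fun y => f y * g y) (a * g x + f x * b).
Proof.
move=> df dg; have H : is_derive x 1 (f * g) (f x *: b + g x *: a) by exact: is_deriveM.
by move: H; rewrite /GRing.scale/= addrC [g x * a]mulrC.
Qed.

Lemma isder_comp f g x a b : is_derive (g x) 1 f a -> is_derive x 1 g b ->
  is_derive x 1 (fun y => f (g y)) (a * b).
Proof. by move=> df dg; exact: is_derive1_comp. Qed.

Lemma isder_cst c x : is_derive x 1 (fun=> c : R) 0.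
Proof. exact: is_derive_cst. Qed.

Lemma isder_id x : is_derive x 1 (fun y : R => y) 1.
Proof. exact: is_derive_id. Qed.

Lemma isder_scale c f x a : is_derive x 1 f a -> is_derive x 1 (fun y => c * f y) (c * a).
Proof.
move=> df; have := isder_mul (isder_cst c x) df.
by rewrite mul0r add0r.
Qed.

Lemma isder_inv x : x != 0 -> is_derive x 1 (fun y : R => y^-1) (- (x^-1 * x^-1)).
Proof.
move=> x0; have := @is_deriveV R id x 1 1 x0 (isder_id x).
by rewrite /GRing.scale/= mulr1 expr2 invfM.
Qed.

Lemma isder_continuous f x a : is_derive x 1 f a -> {for x, continuous f}.
Proof. by move=> [df _]; apply: differentiable_continuous; exact/derivable1_diffP. Qed.

Lemma mvt_bound f f' (K : R) : (forall t : R, 0 <= t <= 1 -> is_derive t 1 f (f' t)) ->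
  (forall t : R, 0 <= t <= 1 -> `|f' t| <= K) ->
  forall t : R, 0 <= t <= 1 -> `|f t - f 0| <= K.
Proof.
move=> df fK t /andP[]; rewrite le_eqVlt => /predU1P[<- _|t0 t1].
  by rewrite subrr normr0 (le_trans _ (fK 0 _))// lexx ler01.
have [||c ct ->] := @MVT R f f' 0 t t0.
- move=> x; rewrite in_itv/= => /andP[x0 xt]; apply: df.
  by rewrite (ltW x0) (le_trans (ltW xt)).
- apply: continuous_in_subspaceT => x; rewrite inE/= in_itv/= => /andP[x0 xt].
  by apply: isder_continuous (df x _); rewrite x0 (le_trans xt).
- move: ct; rewrite in_itv/= => /andP[c0 ct].
  have c1 : 0 <= c <= 1 by rewrite (ltW c0) (le_trans (ltW ct)).
  rewrite subr0 normrM [`|t|]ger0_norm; last exact: ltW.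
  by rewrite (le_trans _ (fK c c1))// ler_piMr.
Qed.

(** The mean value bound is applied three times, each time after subtracting the Taylor polynomial
    found so far. The factor 1/6 is given up, as only the order of the error matters later. *)
Lemma taylor2_bound g0 g1 g2 g3 (K : R) :
  (forall t : R, 0 <= t <= 1 -> is_derive t 1 g0 (g1 t)) ->
  (forall t : R, 0 <= t <= 1 -> is_derive t 1 g1 (g2 t)) ->
  (forall t : R, 0 <= t <= 1 -> is_derive t 1 g2 (g3 t)) ->
  (forall t : R, 0 <= t <= 1 -> `|g3 t| <= K) ->
  `|g0 1 - (g0 0 + g1 0 + g2 0 / 2)| <= K.
Proof.
move=> d0 d1 d2 gK.
have B2 := mvt_bound d2 gK.
have B1 : forall t : R, 0 <= t <= 1 -> `|g1 t - g1 0 - g2 0 * t| <= K.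
  move=> t t01.
  have := @mvt_bound (fun t => g1 t + (- g2 0) * t) (fun t => g2 t - g2 0) K _ B2 t t01.
  rewrite mulr0 addr0 mulNr => H; rewrite (_ : _ - _ = g1 t - g2 0 * t - g1 0); last by ring.
  apply: H => y y01; have := isder_add (d1 y y01) (isder_scale (- g2 0) (isder_id y)).
  by rewrite mulr1.
have t11 : 0 <= (1 : R) <= 1 by rewrite ler01 lexx.
have := @mvt_bound (fun t => g0 t + ((- g1 0) * t + (- g2 0 / 2) * (t * t)))
  (fun t => g1 t - g1 0 - g2 0 * t) K _ B1 1 t11.
rewrite !mulr0 !mulr1 !addr0 => H.
rewrite (_ : _ - _ = g0 1 + (- g1 0 + - g2 0 / 2) - g0 0); last by ring.
apply: H => y y01.
have dyy := isder_mul (isder_id y) (isder_id y).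
have := isder_add (d0 y y01)
  (isder_add (isder_scale (- g1 0) (isder_id y)) (isder_scale (- g2 0 / 2) dyy)).
rewrite (_ : g1 y + _ = g1 y - g1 0 - g2 0 * y)//.
by field.
Qed.

End DerivativeRules.

(** * The radial profile, its derivatives and their bounds *)

Section Profile.
Context (R : realType).
Variables (p b al : R).
Hypotheses (b0 : 0 < b) (al0 : 0 < al).

(** With u = |x|^2 and [al] = beta/2 this is |x|^(-beta). *)
Definition Xp (u : R) : R := u `^ (- al).

Lemma Xp_expR (u : R) : 0 < u -> Xp u = expR (- al * ln u).
Proof. by move=> u0; rewrite /Xp /powR gt_eqF. Qed.

(** The term in ln(1+u) leaves the behaviour at 0 unchanged and keeps the profile bounded at
    infinity for either sign of [p]. *)
Definition logprof (u : R) : R := p * ln u - p * ln (1 + u) - b * Xp u.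
Definition prof0 (u : R) : R := expR (logprof u).
(** [ell1], [ell2], [ell3] are the successive derivatives of [logprof], and [prof1], [prof2],
    [prof3] those of its exponential. *)
Definition ell1 (u : R) : R := p * (u^-1 - (1 + u)^-1) + b * al * (u^-1 * Xp u).
Definition ell2 (u : R) : R :=
  p * ((1 + u)^-1 * (1 + u)^-1 - u^-1 * u^-1) - b * al * (al + 1) * (u^-1 * u^-1 * Xp u).
Definition ell3 (u : R) : R :=
  2 * p * (u^-1 * u^-1 * u^-1 - (1 + u)^-1 * (1 + u)^-1 * (1 + u)^-1) +
  b * al * (al + 1) * (al + 2) * (u^-1 * u^-1 * u^-1 * Xp u).
Definition prof1 u := ell1 u * prof0 u.
Definition prof2 u := (ell2 u + ell1 u ^+ 2) * prof0 u.
Definition prof3 u := (ell3 u + 3 * ell1 u * ell2 u + ell1 u ^+ 3) * prof0 u.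
(** The value 0 at u = 0 is the limit there, so a step landing exactly on the origin needs no
    exceptional set. *)
Definition prof u := if 0 < u then prof0 u else 0.

Lemma isder_Xp (u : R) : 0 < u -> is_derive u 1 Xp (- al * (u^-1 * Xp u)).
Proof.
move=> u0; have := is_derive1_powR (- al) u0.
have <- // : u^-1 * Xp u = u `^ (- al - 1).
have aE : u^-1 = expR (- ln u) by rewrite expRN lnK.
by rewrite /Xp /powR gt_eqF// aE -expRD; congr expR; ring.
Qed.

Lemma isder_inv1 (u : R) : 0 < u ->
  is_derive u 1 (fun y : R => (1 + y)^-1) (- ((1 + u)^-1 * (1 + u)^-1)).
Proof.
move=> u0; have n0 : 1 + u != 0 by rewrite gt_eqF// addr_gt0.
have := isder_comp (isder_inv n0) (isder_add (isder_cst 1 u) (isder_id u)).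
by rewrite add0r mulr1.
Qed.

Lemma isder_prof0 (u : R) : 0 < u -> is_derive u 1 prof0 (prof1 u).
Proof.
move=> u0; have u1 : 0 < 1 + u by rewrite addr_gt0.
have dl1 := isder_comp (is_derive1_ln u1) (isder_add (isder_cst 1 u) (isder_id u)).
have dl := isder_add (isder_add (isder_scale p (is_derive1_ln u0)) (isder_scale (- p) dl1))
  (isder_scale (- b) (isder_Xp u0)).
have dE := isder_comp (is_derive_expR _) dl.
move: dE; rewrite (_ : (fun y => expR _) = prof0); last first.
  by apply/funext => y; rewrite /prof0 /logprof !mulNr.
rewrite (_ : _ * _ = prof1 u)//.
rewrite /prof1 mulrC /prof0 /logprof !mulNr; congr (_ * _).
by rewrite /ell1; ring.
Qed.

Lemma isder_ell1 (u : R) : 0 < u -> is_derive u 1 ell1 (ell2 u).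
Proof.
move=> u0; have un : u != 0 by rewrite gt_eqF.
have := isder_add (isder_scale p (isder_add (isder_inv un) (isder_scale (-1) (isder_inv1 u0))))
  (isder_scale (b * al) (isder_mul (isder_inv un) (isder_Xp u0))).
rewrite (_ : (fun y => _) = ell1); last first.
  by apply/funext => y; rewrite /ell1 mulN1r.
by rewrite (_ : _ + _ = ell2 u)// /ell2; ring.
Qed.

Lemma isder_ell2 (u : R) : 0 < u -> is_derive u 1 ell2 (ell3 u).
Proof.
move=> u0; have un : u != 0 by rewrite gt_eqF.
have di := isder_inv un; have di1 := isder_inv1 u0.
have := isder_add (isder_scale p (isder_add (isder_mul di1 di1)
    (isder_scale (-1) (isder_mul di di))))
  (isder_scale (- (b * al * (al + 1))) (isder_mul (isder_mul di di) (isder_Xp u0))).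
rewrite (_ : (fun y => _) = ell2); last first.
  by apply/funext => y; rewrite /ell2 mulN1r mulNr.
by rewrite (_ : _ + _ = ell3 u)// /ell3; ring.
Qed.

Lemma isder_prof1 (u : R) : 0 < u -> is_derive u 1 prof1 (prof2 u).
Proof.
move=> u0; have := isder_mul (isder_ell1 u0) (isder_prof0 u0).
by rewrite (_ : _ + _ = prof2 u)// /prof2 /prof1; ring.
Qed.

Lemma isder_prof2 (u : R) : 0 < u -> is_derive u 1 prof2 (prof3 u).
Proof.
move=> u0; have d1 := isder_ell1 u0.
have := isder_mul (isder_add (isder_ell2 u0) (isder_mul d1 d1)) (isder_prof0 u0).
rewrite (_ : (fun y => _) = prof2); last by apply/funext => y; rewrite /prof2 expr2.
by rewrite (_ : _ + _ = prof3 u)// /prof3 /prof1; ring.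
Qed.

Lemma prof0_gt0 u : 0 < prof0 u. Proof. exact: expR_gt0. Qed.

(* Every monomial in 1/u and u^-al is absorbed by exp(- b u^-al): with
   L = max(- ln u, 0) the product is at most exp(c L + c' - b e^(al L)). *)
Lemma prof0_bound (i j : nat) : exists M : R, 0 < M /\
  forall u : R, 0 < u -> u^-1 ^+ i * Xp u ^+ j * prof0 u <= M.
Proof.
pose c := i%:R + j%:R * al + `|p|.
have c0 : 0 <= c by rewrite !addr_ge0// mulr_ge0// ltW.
pose C := `|p| * ln 2 + b + c ^+ 2 / (b * al ^+ 2).
exists (expR C); split; first exact: expR_gt0.
move=> u u0; pose L := Num.max (- ln u) 0.
have L0 : 0 <= L by rewrite le_max lexx orbT.
have Lu : - ln u <= L by rewrite le_max lexx.
have aE : u^-1 = expR (- ln u) by rewrite expRN lnK.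
have XE : Xp u = expR (- al * ln u) by rewrite /Xp /powR gt_eqF.
have -> : u^-1 ^+ i * Xp u ^+ j * prof0 u =
    expR (i%:R * (- ln u) + j%:R * (- al * ln u) + logprof u).
  by rewrite aE XE -!expRM_natl -!expRD.
rewrite ler_expR /logprof.
have lnle : ln u <= ln (1 + u) by rewrite ler_ln ?posrE ?addr_gt0// lerDr.
have lnge : ln (1 + u) <= ln u + L + ln 2.
  rewrite -ler_expR !expRD !lnK ?posrE ?addr_gt0//.
  have e1 : 1 <= u * expR L.
    by rewrite -ler_pdivrMl// mulr1 aE ler_expR.
  have e2 : u <= u * expR L by rewrite ler_pMr// -expR0 ler_expR.
  lra.
have pb : p * ln u - p * ln (1 + u) <= `|p| * (L + ln 2).
  rewrite -mulrBr; apply: le_trans (ler_norm _) _; rewrite normrM ler_wpM2l//.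
  by rewrite ler_norml; apply/andP; split; [lra|]; have := ln_ge0 (ler1n R 2 : 1 <= 2 :> R); lra.
have XL : (al * L) ^+ 2 / 4 <= Xp u + 1.
  have X0 : 0 <= Xp u by exact: powR_ge0.
  have [ln0|ln0] := leP 0 (ln u).
    have -> : L = 0 by apply/max_idPr; rewrite oppr_le0.
    by rewrite mulr0 expr0n mul0r addr_ge0.
  have -> : L = - ln u by apply/max_idPl; rewrite oppr_ge0 ltW.
  rewrite XE mulNr -mulrN; set y := al * _.
  have y0 : 0 <= y by apply: mulr_ge0; [exact: ltW|rewrite oppr_ge0 ltW].
  have := expR_ge1Dx (y / 2).
  have -> : expR y = expR (y / 2) ^+ 2 by rewrite expr2 -expRD; congr expR; field.
  set e := expR _ => he; clearbody y e.
  have : 0 <= (e - y / 2) * (e + y / 2) by apply: mulr_ge0; lra.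
  lra.
have iL : i%:R * (- ln u) <= i%:R * L by rewrite ler_wpM2l.
have jL : j%:R * (- al * ln u) <= j%:R * (al * L).
  by rewrite ler_wpM2l// mulNr -mulrN ler_wpM2l// ltW.
have bX := ler_wpM2l (ltW b0) XL.
have key : c * L <= b * ((al * L) ^+ 2 / 4) + c ^+ 2 / (b * al ^+ 2).
  rewrite -subr_ge0.
  have -> : b * ((al * L) ^+ 2 / 4) + c ^+ 2 / (b * al ^+ 2) - c * L =
    b * (al * L / 2 - c / (b * al)) ^+ 2 by field; rewrite !gt_eqF.
  by rewrite mulr_ge0 ?sqr_ge0// ltW.
rewrite /C; move: key iL jL pb bX; rewrite /c !mulrDl !mulrDr mulr1 => key iL jL pb bX.
rewrite mulrA in jL *.
lra.
Qed.

End Profile.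

Section ProfileBounds.
Context (R : realType).
Variables (p b al : R).
Hypotheses (b0 : 0 < b) (al0 : 0 < al).
Notation Xp := (Xp al).
Notation prof := (prof p b al).
Notation prof0 := (prof0 p b al).
Notation prof1 := (prof1 p b al).
Notation prof2 := (prof2 p b al).
Notation prof3 := (prof3 p b al).

Lemma prof_ge0 u : 0 <= prof u.
Proof. by rewrite /prof; case: ifP => // _; exact: expR_ge0. Qed.

Lemma profE u : 0 < u -> prof u = prof0 u.
Proof. by rewrite /prof => ->. Qed.

Lemma Xp_gt0 u : 0 < u -> 0 < Xp u.
Proof. by move=> u0; rewrite powR_gt0. Qed.

Lemma prof_bounded : exists D : R, 0 < D /\ forall u, prof u <= D.
Proof.
have [D [D0 H]] := prof0_bound p b0 al0 0 0; exists D; split => // u.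
rewrite /prof; case: ifP => [u0|_]; last exact: ltW.
by have := H u u0; rewrite !expr0 !mul1r.
Qed.

Lemma prof0_le_lin : exists D : R, 0 < D /\ forall u : R, 0 < u -> prof0 u <= D * u.
Proof.
have [D [D0 H]] := prof0_bound p b0 al0 1 0; exists D; split => // u u0.
by have := H u u0; rewrite expr1 expr0 mulr1 ler_pdivrMl// mulrC.
Qed.

(** Replacing exp(-sv) by 1 - sv costs an error of size (sv)^2 times the profile; this bound makes
    that error O(s^2) uniformly in space. *)
Lemma prof_potential_bound (k K : R) : 0 <= k -> 0 <= K -> exists D : R, 0 < D /\
  forall u v : R, 0 < u -> 0 <= v <= k * (u^-1 * Xp u ^+ 2) + K -> prof0 u * v ^+ 2 <= D.
Proof.
move=> k0 K0.
have [D1 [D10 H1]] := prof0_bound p b0 al0 2 4.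
have [D2 [D20 H2]] := prof0_bound p b0 al0 0 0.
exists (2 * k ^+ 2 * D1 + 2 * K ^+ 2 * D2 + 1); split.
  by apply: ltr_wpDl => //; rewrite addr_ge0// !mulr_ge0 ?sqr_ge0// ltW.
move=> u v u0 /andP[v0 vk]; have := H1 u u0; have := H2 u u0.
rewrite !expr0 !mul1r; set F := prof0 u => hF1 hF2.
have F0 : 0 <= F by exact: expR_ge0.
have X0 := Xp_gt0 u0; have a0 : 0 < u^-1 by rewrite invr_gt0.
set w := u^-1 * Xp u ^+ 2 in vk *.
have w0 : 0 <= w by rewrite mulr_ge0 ?sqr_ge0// ltW.
have v2 : v ^+ 2 <= 2 * k ^+ 2 * w ^+ 2 + 2 * K ^+ 2.
  have : v ^+ 2 <= (k * w + K) ^+ 2 by rewrite lerXn2r// nnegrE// addr_ge0// mulr_ge0.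
  by have := sqr_ge0 (k * w - K); lra.
apply: le_trans (ler_wpM2l F0 v2) _.
have hw : w ^+ 2 * F <= D1 by apply: le_trans hF2; rewrite /w exprMn -exprM.
have := ler_wpM2l (mulr_ge0 (ler0n R 2) (sqr_ge0 k)) hw.
have := ler_wpM2l (mulr_ge0 (ler0n R 2) (sqr_ge0 K)) hF1.
lra.
Qed.

(** Each derivative costs one factor 1/u. The contributions of 1+u are dominated through (1+u)^-1 <=
    u^-1, so one constant serves all u > 0. *)
Lemma ell_bounds : exists K : R, 0 < K /\ forall u : R, 0 < u ->
  [/\ `|ell1 p b al u| <= K * (u^-1 * (1 + Xp u)),
      `|ell2 p b al u| <= K * (u^-1 ^+ 2 * (1 + Xp u)) &
      `|ell3 p b al u| <= K * (u^-1 ^+ 3 * (1 + Xp u))].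
Proof.
pose q := `|p|; have q0 : 0 <= q by exact: normr_ge0.
pose m := b * al * (al + 1) * (al + 2) + b * al * (al + 1) + b * al.
have m1 : 0 <= b * al by rewrite mulr_ge0// ltW.
have m2 : 0 <= b * al * (al + 1) by rewrite mulr_ge0// addr_ge0// ltW.
have m3 : 0 <= b * al * (al + 1) * (al + 2) by rewrite mulr_ge0// addr_ge0// ltW.
exists (2 * q + m + 1); split; first by rewrite /m; lra.
move=> u u0; have X0 := ltW (Xp_gt0 u0); have a0 : 0 < u^-1 by rewrite invr_gt0.
have c0 : 0 < (1 + u)^-1 by rewrite invr_gt0 addr_gt0.
have ca : (1 + u)^-1 <= u^-1 by rewrite lef_pV2 ?posrE ?addr_gt0// lerDr.
have key (n : nat) (e f g : R) : `|e| <= u^-1 ^+ n -> 0 <= f <= m -> 0 <= g <= 2 ->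
    `|g * p * e + f * (u^-1 ^+ n * Xp u)| <= (2 * q + m + 1) * (u^-1 ^+ n * (1 + Xp u)).
  move=> he /andP[f0 fm] /andP[g0 g2]; set A := u^-1 ^+ n in he *.
  have A0 : 0 <= A by rewrite exprn_ge0// ltW.
  have AX : 0 <= A * Xp u by rewrite mulr_ge0.
  apply: le_trans (ler_normD _ _) _.
  rewrite [X in _ + X]ger0_norm; last exact: mulr_ge0.
  have h1 : `|g * p * e| <= 2 * q * A.
    rewrite !normrM -/q (ger0_norm g0); apply: ler_pM => //; first exact: mulr_ge0.
    by rewrite ler_wpM2r.
  have h2 := ler_wpM2r AX fm.
  have h3 := mulr_ge0 q0 AX.
  have h4 : 0 <= m * A by rewrite mulr_ge0//; exact: le_trans f0 fm.
  lra.
split.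
- have := @key 1 (u^-1 - (1 + u)^-1) (b * al) 1; rewrite !expr1 mul1r; apply.
  + by rewrite ger0_norm; lra.
  + by rewrite /m m1/=; lra.
  + by rewrite ler01 ler1n.
- set c := (1 + u)^-1 in c0 ca *; set a := u^-1 in a0 ca *.
  rewrite -normrN (_ : - ell2 p b al u = 1 * p * (a ^+ 2 - c ^+ 2) +
    b * al * (al + 1) * (a ^+ 2 * Xp u)); last by rewrite /ell2 -/c -/a; ring.
  have c2 : c ^+ 2 <= a ^+ 2 by rewrite lerXn2r// nnegrE ltW.
  apply: (@key 2 (a ^+ 2 - c ^+ 2) (b * al * (al + 1)) 1).
  + by rewrite ger0_norm ?subr_ge0// lerBlDr lerDl sqr_ge0.
  + by rewrite /m m2/=; lra.
  + by rewrite ler01 ler1n.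
- have := @key 3 (u^-1 ^+ 3 - (1 + u)^-1 ^+ 3) (b * al * (al + 1) * (al + 2)) 2.
  set c := (1 + u)^-1 in c0 ca *; set a := u^-1 in a0 ca *.
  rewrite (_ : ell3 p b al u = 2 * p * (a ^+ 3 - c ^+ 3) +
    b * al * (al + 1) * (al + 2) * (a ^+ 3 * Xp u)); last by rewrite /ell3 -/c -/a; ring.
  have c3 : c ^+ 3 <= a ^+ 3 by rewrite lerXn2r// nnegrE ltW.
  apply.
  + by rewrite ger0_norm ?subr_ge0// lerBlDr lerDl exprn_ge0// ltW.
  + by rewrite /m m3/=; lra.
  + by rewrite ler0n lexx.
Qed.

(** These are the combinations met in the third derivative of F(|x+tz|^2) in t: F''' comes with the
    cube of a quantity of size |x+tz| |z|, and F'' with its first power. *)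
Lemma prof23_bound : exists M : R, 0 < M /\ forall u : R, 0 < u ->
  `|prof2 u| * Num.sqrt u <= M /\ `|prof3 u| * Num.sqrt u ^+ 3 <= M.
Proof.
have [K [K0 HK]] := ell_bounds.
have [D1 [D10 H1]] := prof0_bound p b0 al0 0 0.
have [D2 [D20 H2]] := prof0_bound p b0 al0 0 3.
have [D3 [D30 H3]] := prof0_bound p b0 al0 2 0.
have [D4 [D40 H4]] := prof0_bound p b0 al0 2 3.
pose S := 4 * (D1 + D2 + D3 + D4).
have S0 : 0 < S by rewrite /S; lra.
exists ((K + 3 * K ^+ 2 + K ^+ 3) * S); split.
  by rewrite mulr_gt0// !addr_gt0 ?mulr_gt0 ?exprn_gt0.
move=> u u0; have [h1 h2 h3] := HK u u0.
have X0 := ltW (Xp_gt0 u0); have a0 : 0 < u^-1 by rewrite invr_gt0.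
have F0 : 0 <= prof0 u by exact: expR_ge0.
have := H1 u u0; have := H2 u u0; have := H3 u u0; have := H4 u u0.
rewrite !expr0 !mul1r !mulr1.
set F := prof0 u in F0 *; set X := Xp u in X0 h1 h2 h3 *.
move=> b4 b3 b2 b1.
pose r := (Num.sqrt u)^-1; have sq0 : 0 < Num.sqrt u by rewrite sqrtr_gt0.
have r0 : 0 < r by rewrite invr_gt0.
have rs : r * Num.sqrt u = 1 by rewrite mulVf// gt_eqF.
have ar : u^-1 = r ^+ 2 by rewrite /r exprVn sqr_sqrtr// ltW.
rewrite ar in h1 h2 h3 b3 b4.
(* [prof0_bound] covers integer powers of 1/u = r^2 only, so the odd power r^3 is first replaced by
   1 + r^4. *)
have r3 : r ^+ 3 <= 1 + r ^+ 2 ^+ 2.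
  have : 0 <= r ^+ 2 * (r - 1) ^+ 2 by rewrite mulr_ge0 ?sqr_ge0.
  have : 0 <= (r ^+ 2 - 1) ^+ 2 by exact: sqr_ge0.
  lra.
have Y3 : (1 + X) ^+ 3 <= 4 * (1 + X ^+ 3).
  have : 0 <= (1 + X) * (1 - X) ^+ 2 by rewrite mulr_ge0 ?sqr_ge0// addr_ge0.
  lra.
have Y0 : 0 <= (1 + X) ^+ 3 by rewrite exprn_ge0// addr_ge0.
have main : r ^+ 3 * (1 + X) ^+ 3 * F <= S.
  apply: (@le_trans _ _ ((1 + r ^+ 2 ^+ 2) * (4 * (1 + X ^+ 3)) * F)).
    by rewrite ler_wpM2r//; apply: ler_pM => //; rewrite exprn_ge0// ltW.
  by rewrite /S; lra.
pose Y := 1 + X; rewrite -/Y in h1 h2 h3 main Y0.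
have Y1 : 1 <= Y by rewrite /Y; lra.
have YY : Y <= Y ^+ 3 by rewrite -[leLHS]expr1 ler_weXn2l.
have YY2 : Y ^+ 2 <= Y ^+ 3 by rewrite ler_weXn2l.
have Y00 : 0 <= Y by lra.
have l12 : `|ell1 p b al u| ^+ 2 <= K ^+ 2 * (r ^+ 4 * Y ^+ 3).
  apply: (@le_trans _ _ ((K * (r ^+ 2 * Y)) ^+ 2)).
    by rewrite lerXn2r// nnegrE// ltW// mulr_gt0// mulr_gt0 ?exprn_gt0//; lra.
  have -> : (K * (r ^+ 2 * Y)) ^+ 2 = K ^+ 2 * (r ^+ 4 * Y ^+ 2) by ring.
  apply: ler_wpM2l; first exact: sqr_ge0.
  by apply: ler_wpM2l => //; rewrite exprn_ge0// ltW.
have l13 : `|ell1 p b al u| ^+ 3 <= K ^+ 3 * (r ^+ 6 * Y ^+ 3).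
  apply: (@le_trans _ _ ((K * (r ^+ 2 * Y)) ^+ 3)).
    by rewrite lerXn2r// nnegrE// ltW// mulr_gt0// mulr_gt0 ?exprn_gt0//; lra.
  by have -> : (K * (r ^+ 2 * Y)) ^+ 3 = K ^+ 3 * (r ^+ 6 * Y ^+ 3) by ring.
have l112 : `|ell1 p b al u| * `|ell2 p b al u| <= K ^+ 2 * (r ^+ 6 * Y ^+ 3).
  apply: (@le_trans _ _ ((K * (r ^+ 2 * Y)) * (K * (r ^+ 2 ^+ 2 * Y)))).
    exact: ler_pM.
  have -> : (K * (r ^+ 2 * Y)) * (K * (r ^+ 2 ^+ 2 * Y)) = K ^+ 2 * (r ^+ 6 * Y ^+ 2).
    by ring.
  apply: ler_wpM2l; first exact: sqr_ge0.
  by apply: ler_wpM2l => //; rewrite exprn_ge0// ltW.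
have l2 : `|ell2 p b al u| <= K * (r ^+ 4 * Y ^+ 3).
  apply: le_trans h2 _; rewrite -exprM; apply: ler_wpM2l; first exact: ltW.
  by apply: ler_wpM2l => //; rewrite exprn_ge0// ltW.
have l3 : `|ell3 p b al u| <= K * (r ^+ 6 * Y ^+ 3).
  apply: le_trans h3 _; rewrite -exprM; apply: ler_wpM2l; first exact: ltW.
  by apply: ler_wpM2l => //; rewrite exprn_ge0// ltW.
have s4 : r ^+ 4 * Num.sqrt u = r ^+ 3 by rewrite exprSr -mulrA rs mulr1.
have s6 : r ^+ 6 * Num.sqrt u ^+ 3 = r ^+ 3.
  by rewrite (exprD r 3 3) -mulrA -exprMn rs expr1n mulr1.
have K2 := sqr_ge0 K; have K3 : 0 <= K ^+ 3 by rewrite exprn_ge0// ltW.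
split.
- rewrite /prof2 -/F normrM (ger0_norm F0).
  apply: (@le_trans _ _ ((K + K ^+ 2) * (r ^+ 4 * Y ^+ 3) * F * Num.sqrt u)).
    apply: ler_wpM2r; first exact: ltW.
    apply: ler_wpM2r => //; apply: le_trans (ler_normD _ _) _.
    by rewrite normrX; lra.
  have -> : (K + K ^+ 2) * (r ^+ 4 * Y ^+ 3) * F * Num.sqrt u =
    (K + K ^+ 2) * ((r ^+ 4 * Num.sqrt u) * Y ^+ 3 * F) by ring.
  rewrite s4; apply: (@le_trans _ _ ((K + K ^+ 2) * S)).
    by apply: ler_wpM2l => //; rewrite addr_ge0// ltW.
  by apply: ler_wpM2r; [exact: ltW|lra].
- rewrite /prof3 -/F normrM (ger0_norm F0).
  apply: (@le_trans _ _ ((K + 3 * K ^+ 2 + K ^+ 3) * (r ^+ 6 * Y ^+ 3) * F * Num.sqrt u ^+ 3)).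
    apply: ler_wpM2r; first by rewrite exprn_ge0// ltW.
    apply: ler_wpM2r => //; apply: le_trans (ler_normD _ _) _.
    rewrite normrX; apply: le_trans (lerD (ler_normD _ _) (lexx _)) _.
    by rewrite !normrM [`|3|]ger0_norm//; lra.
  have -> : (K + 3 * K ^+ 2 + K ^+ 3) * (r ^+ 6 * Y ^+ 3) * F * Num.sqrt u ^+ 3 =
    (K + 3 * K ^+ 2 + K ^+ 3) * ((r ^+ 6 * Num.sqrt u ^+ 3) * Y ^+ 3 * F) by ring.
  rewrite s6; apply: ler_wpM2l => //.
  by rewrite !addr_ge0 ?mulr_ge0// ltW.
Qed.

End ProfileBounds.

Section ProfileTaylor.
Context (R : realType).
Variables (p b al : R).
Hypotheses (b0 : 0 < b) (al0 : 0 < al).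
Notation Xp := (Xp al).
Notation prof := (prof p b al).
Notation prof0 := (prof0 p b al).
Notation prof1 := (prof1 p b al).
Notation prof2 := (prof2 p b al).
Notation prof3 := (prof3 p b al).

Lemma continuous_prof : continuous prof.
Proof.
move=> u; have [u0|u0|u0] := ltgtP u 0.
- have e : \forall y \near u, (fun=> 0 : R) y = prof y.
    near=> y; rewrite /prof ltNge ltW//.
    by near: y; exact: lt_nbhsl.
  rewrite /continuous_at /prof ltNge ltW//.
  by apply: cvg_trans (near_eq_cvg e) _; exact: cvg_cst.
- have e : \forall y \near u, prof0 y = prof y.
    near=> y; rewrite /prof ifT//.
    by near: y; exact: lt_nbhsr.
  rewrite /continuous_at /prof u0.
  apply: cvg_trans (near_eq_cvg e) _.
  exact: (isder_continuous (isder_prof0 p b al u0)).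
- rewrite u0 /continuous_at {2}/prof ltxx.
  have [D [D0 H]] := prof0_le_lin p b0 al0.
  apply: (@squeeze_cvgr _ _ _ _ (fun=> 0) (fun x => D * `|x|)).
  + near=> x; rewrite prof_ge0/= /prof; case: ifP => [x0|_].
      by rewrite (ger0_norm (ltW x0)) H.
    by rewrite mulr_ge0// ltW.
  + exact: cvg_cst.
  + rewrite -[X in _ --> X](mulr0 D); apply: cvgM; first exact: cvg_cst.
    by rewrite -[X in _ --> X](normr0 R); exact: norm_continuous.
Unshelve. all: by end_near. Qed.

Lemma measurable_prof : measurable_fun setT prof.
Proof. by apply: continuous_measurable_fun; exact: continuous_prof. Qed.

(* Expansion along t |-> A t^2 + B t + u, which stands for |x + t z|^2; a shift
   of the path away from 0 is removed at the end by continuity. *)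
Lemma prof_taylor : exists M : R, 0 < M /\ forall u A B : R, 0 < u -> 0 <= A ->
  B ^+ 2 <= 4 * u * A ->
  `|prof (u + B + A) - (prof0 u + prof1 u * B + prof2 u * B ^+ 2 / 2 + prof1 u * A)| <=
  M * Num.sqrt A ^+ 3.
Proof.
have [M [M0 HM]] := prof23_bound p b0 al0.
exists (20 * M); split; first by rewrite mulr_gt0.
move=> u A B u0 A0 BA.
pose q (e t : R) := A * (t * t) + (B * t + (u + e)).
have qge t : 0 <= A * (t * t) + (B * t + u).
  have [Ae|A1] := eqVneq A 0.
    have -> : B = 0.
      by apply/eqP; rewrite -sqrf_eq0 eq_le sqr_ge0 andbT; move: BA; rewrite Ae mulr0.
    by rewrite Ae !mul0r !add0r ltW.
  have Ap : 0 < A by rewrite lt_neqAle eq_sym A1.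
  rewrite -(ler_pM2l Ap) mulr0; have := sqr_ge0 (2 * A * t + B); lra.
have dq (e t : R) : is_derive t 1 (q e) (2 * A * t + B).
  have d1 := isder_id t; have d2 := isder_mul d1 d1.
  have := isder_add (isder_scale A d2) (isder_add (isder_scale B d1) (isder_cst (u + e) t)).
  by have -> : A * (1 * t + t * 1) + (B * 1 + 0) = 2 * A * t + B by ring.
have dq' (t : R) : is_derive t 1 (fun t : R => 2 * A * t + B) (2 * A).
  have := isder_add (isder_scale (2 * A) (isder_id t)) (isder_cst B t).
  by rewrite mulr1 addr0.
have T e : 0 < e -> `|prof0 (u + B + A + e) - (prof0 (u + e) + prof1 (u + e) * B +
    prof2 (u + e) * B ^+ 2 / 2 + prof1 (u + e) * A)| <= 20 * M * Num.sqrt A ^+ 3.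
  move=> e0; have qp t : 0 < q e t by rewrite /q; have := qge t; lra.
  pose g0 t := prof0 (q e t).
  pose g1 t := prof1 (q e t) * (2 * A * t + B).
  pose g2 t := prof2 (q e t) * (2 * A * t + B) * (2 * A * t + B) + prof1 (q e t) * (2 * A).
  pose g3 t := (prof3 (q e t) * (2 * A * t + B) * (2 * A * t + B) + prof2 (q e t) * (2 * A))
     * (2 * A * t + B) + prof2 (q e t) * (2 * A * t + B) * (2 * A) +
     (prof2 (q e t) * (2 * A * t + B)) * (2 * A).
  have q1 : q e 1 = u + B + A + e by rewrite /q; ring.
  have q0 : q e 0 = u + e by rewrite /q; ring.
  have d0 (t : R) : is_derive t 1 g0 (g1 t).
    exact: (@isder_comp R prof0 (q e) t _ _ (isder_prof0 p b al (qp t)) (dq e t)).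
  have d1 (t : R) : is_derive t 1 g1 (g2 t).
    have dp := @isder_comp R prof1 (q e) t _ _ (isder_prof1 p b al (qp t)) (dq e t).
    exact: isder_mul dp (dq' t).
  have d2 (t : R) : is_derive t 1 g2 (g3 t).
    have dp1 := @isder_comp R prof1 (q e) t _ _ (isder_prof1 p b al (qp t)) (dq e t).
    have dp := @isder_comp R prof2 (q e) t _ _ (isder_prof2 p b al (qp t)) (dq e t).
    have dd := isder_mul (isder_mul dp (dq' t)) (dq' t).
    have := isder_add dd (isder_mul dp1 (isder_cst (2 * A) t)).
    by rewrite mulr0 addr0.
  (* The constant 20 is 8 + 12: with D = 2At + B, the condition on the discriminant gives |D| <= 2
     sqrt A sqrt q, so F''' D^3 contributes 8M and 6 A F'' D contributes 12M, each times (sqrt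
     A)^3. *)
  have B3 (t : R) : `|g3 t| <= 20 * M * Num.sqrt A ^+ 3.
    have [h2 h3] := HM _ (qp t).
    rewrite (_ : g3 t = prof3 (q e t) * (2 * A * t + B) ^+ 3 +
      6 * A * (prof2 (q e t) * (2 * A * t + B))); last by rewrite /g3; ring.
    set D := 2 * A * t + B; set N := Num.sqrt A; set S := Num.sqrt (q e t) in h2 h3.
    move: (prof2 (q e t)) (prof3 (q e t)) h2 h3 => P2 P3 h2 h3.
    have N0 : 0 <= N by exact: sqrtr_ge0.
    have S0 : 0 <= S by exact: sqrtr_ge0.
    have NA : A = N ^+ 2 by rewrite sqr_sqrtr.
    have SD : `|D| <= 2 * N * S.
      rewrite -[leRHS]ger0_norm; last by rewrite !mulr_ge0.
      rewrite -ler_sqr ?nnegrE// !real_normK ?num_real// !exprMn -NA sqr_sqrtr; last exact: ltW.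
      by rewrite /D /q; have := mulr_ge0 A0 (ltW e0); lra.
    apply: le_trans (ler_normD _ _) _; rewrite normrM normrX !normrM (ger0_norm A0) [`|6|]ger0_norm//.
    have D3 : `|D| ^+ 3 <= (2 * N * S) ^+ 3 by rewrite lerXn2r// nnegrE !mulr_ge0.
    have := ler_wpM2l (normr_ge0 P3) D3.
    have := ler_wpM2l (normr_ge0 P2) SD.
    have N3 : 0 <= N ^+ 3 by rewrite exprn_ge0.
    have := ler_wpM2l (mulr_ge0 (ler0n R 8) N3) h3.
    have := ler_wpM2l (mulr_ge0 (ler0n R 12) N3) h2.
    move: (`|P3|) (`|P2|) => p3 p2 k1 k2 k3 k4.
    have k3' := ler_wpM2l (mulr_ge0 (ler0n R 6) A0) k3.
    rewrite NA in k3' *.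
    lra.
  have := @taylor2_bound R g0 g1 g2 g3 (20 * M * Num.sqrt A ^+ 3)
    (fun t _ => d0 t) (fun t _ => d1 t) (fun t _ => d2 t) (fun t _ => B3 t).
  rewrite /g0 /g1 /g2 q1 q0 !mulr0 !add0r.
  by congr (`|_ - _| <= _); field.
have cvh (c : R) : (c + @harmonic R n) @[n --> \oo] --> c.
  by rewrite -[X in _ --> X](addr0 c); apply: cvgD; [exact: cvg_cst|exact: cvg_harmonic].
have cvf (c : R) (f : R -> R) a : is_derive c 1 f a -> f (c + @harmonic R n) @[n --> \oo] --> (f c : R).
  move=> df; exact: (@continuous_cvg _ _ _ _ _ (fun n => c + @harmonic R n) f c (isder_continuous df) (cvh c)).
have v0 : 0 <= u + B + A by have := qge 1; rewrite !mulr1; lra.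
have cv0 : prof0 (u + B + A + @harmonic R n) @[n --> \oo] --> prof (u + B + A).
  move: v0; rewrite le_eqVlt => /predU1P[<-|v0].
    rewrite /prof ltxx; have [D [D0 H]] := prof0_le_lin p b0 al0.
    apply: (@squeeze_cvgr _ _ _ _ (fun=> 0) (fun n => D * @harmonic R n)).
    - near=> n; rewrite add0r; apply/andP; split; first exact: expR_ge0.
      by apply: H; exact: harmonic_gt0.
    - exact: cvg_cst.
    - rewrite -[X in _ --> X](mulr0 D).
      by apply: cvgM; [exact: cvg_cst|exact: cvg_harmonic].
  by rewrite profE//; exact: cvf (isder_prof0 p b al v0).
have c0 := cvf _ _ _ (isder_prof0 p b al u0).
have c1 := cvf _ _ _ (isder_prof1 p b al u0).
have c2 := cvf _ _ _ (isder_prof2 p b al u0).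
pose h n := `|prof0 (u + B + A + @harmonic R n) - (prof0 (u + @harmonic R n) +
  prof1 (u + @harmonic R n) * B + prof2 (u + @harmonic R n) * B ^+ 2 / 2 +
  prof1 (u + @harmonic R n) * A)|.
apply: (@cvgr_to_le _ (nbhs \oo) _ _ h).
- apply: cvg_norm; apply: cvgB => //; apply: cvgD; last by apply: cvgM => //; exact: cvg_cst.
  apply: cvgD; first by apply: cvgD => //; apply: cvgM => //; exact: cvg_cst.
  by apply: cvgM; [apply: cvgM => //|]; exact: cvg_cst.
- by near=> n; apply: T; exact: harmonic_gt0.
Unshelve. all: by end_near. Qed.

End ProfileTaylor.

(** * The Laplacian of the test function *)

Section Generator.
Context (R : realType) (d : nat).
Variables (beta kappa theta : R).
Hypotheses (beta0 : 0 < beta) (kappa0 : 0 < kappa).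

(** At [theta] = 0 this is the exponent of h written in u = |x|^2. It is the one value for which the
    term of order |x|^(-2-beta) in the quotient (Delta phi)/phi cancels; a shift by [theta] restores
    4 sqrt(kappa) [theta] of it. *)
Definition prof_exp : R := (2 + beta - d%:R) / 4 + theta.
Notation p := prof_exp.
Notation b := (Num.sqrt kappa / beta).
Notation al := (beta / 2).
Notation Xp := (Xp al).

(** The Laplacian in R^d of x -> F(|x|^2), at |x|^2 = u. *)
Definition generator (u : R) : R :=
  4 * u * prof2 p b al u + 2 * d%:R * prof1 p b al u.

(** Once the two leading terms are removed, what is left ([rem]) contains at most one of the
    singular factors 1/u and u^(-beta/2) in each term, never their product. *)
Lemma generator_expand : exists C0 : R, 0 < C0 /\ forall u : R, 0 < u ->
  `|generator u - (kappa * (u^-1 * Xp u ^+ 2) + 4 * Num.sqrt kappa * theta * (u^-1 * Xp u)) *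
     prof0 p b al u| <= C0 * (u^-1 + Xp u) * prof0 p b al u.
Proof.
pose q := `|p|; have q0 : 0 <= q by exact: normr_ge0.
pose rk := Num.sqrt kappa; have rk0 : 0 < rk by rewrite sqrtr_gt0.
have kE : kappa = rk ^+ 2 by rewrite sqr_sqrtr// ltW.
have d0 : 0 <= d%:R :> R by exact: ler0n.
exists (4 * q + 4 * p ^+ 2 + 2 * d%:R * q + 4 * rk * q + 1); split.
  apply: ltr_wpDl => //; apply: addr_ge0; last by rewrite !mulr_ge0// ltW.
  apply: addr_ge0; last by rewrite !mulr_ge0.
  by apply: addr_ge0; apply: mulr_ge0 => //; exact: sqr_ge0.
move=> u u0; have F0 := ltW (prof0_gt0 p b al u).
have X0 := ltW (Xp_gt0 al u0); set X := Xp u in X0 *.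
have a0 : 0 < u^-1 by rewrite invr_gt0.
have c0 : 0 < (1 + u)^-1 by rewrite invr_gt0 addr_gt0.
have ca : (1 + u)^-1 <= u^-1 by rewrite lef_pV2 ?posrE ?addr_gt0// lerDr.
have c1 : (1 + u)^-1 <= 1 by rewrite invf_le1 ?addr_gt0// lerDl ltW.
pose rem := p * (4 * u * ((1 + u)^-1 ^+ 2 - u^-1 ^+ 2)) +
  4 * p ^+ 2 * (u * (u^-1 - (1 + u)^-1) ^+ 2) +
  2 * d%:R * p * (u^-1 - (1 + u)^-1) - 4 * rk * p * ((1 + u)^-1 * X).
have -> : generator u - (kappa * (u^-1 * X ^+ 2) + 4 * rk * theta * (u^-1 * X)) * prof0 p b al u =
    rem * prof0 p b al u.
  have pE : 4 * p = 2 + beta - d%:R + 4 * theta by rewrite /prof_exp; field.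
  have thE : theta = p - (2 + beta - d%:R) / 4 by rewrite /prof_exp; field.
  rewrite /generator /prof2 /prof1 /ell2 /ell1 -/X -/rk.
  clearbody X; move: (prof0 p b al u) => F0'.
  rewrite /rem [in X in _ - X]thE kE; move: p => P; clearbody rk.
  field; rewrite !gt_eqF ?addr_gt0//.
rewrite normrM (ger0_norm F0); apply: ler_wpM2r => //.
set a := u^-1 in a0 ca *; set c := (1 + u)^-1 in c0 ca c1 *.
have ua : u * a ^+ 2 = a by rewrite /a expr2 mulrA mulfV ?gt_eqF// mul1r.
have c2 : c ^+ 2 <= a ^+ 2 by rewrite lerXn2r// nnegrE ltW.
have uac : 0 <= u * (a ^+ 2 - c ^+ 2) <= a.
  rewrite mulr_ge0 ?subr_ge0 ?(ltW u0)//= mulrBr ua lerBlDr lerDl.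
  by rewrite mulr_ge0 ?sqr_ge0// ltW.
have ac2 : 0 <= u * (a - c) ^+ 2 <= a.
  rewrite mulr_ge0 ?sqr_ge0 ?(ltW u0)//= -[leRHS]ua ler_wpM2l//; first exact: ltW.
  by rewrite lerXn2r ?nnegrE ?subr_ge0// ?(ltW a0)// lerBlDr lerDl ltW.
have acc : 0 <= a - c <= a by rewrite subr_ge0 ca lerBlDr lerDl ltW.
have cX : 0 <= c * X <= X by rewrite mulr_ge0 ?(ltW c0)//= ler_piMl.
have pq : p <= q by exact: ler_norm.
have pq' : - p <= q by rewrite /q -normrN; exact: ler_norm.
rewrite /rem (_ : 4 * u * (c ^+ 2 - a ^+ 2) = - 4 * (u * (a ^+ 2 - c ^+ 2))); last by ring.
move: uac ac2 acc cX; set U1 := u * _; set U2 := u * _; set U3 := a - c; set U4 := c * X.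
move=> /andP[u1 u1a] /andP[u2 u2a] /andP[u3 u3a] /andP[u4 u4X].
have n1 : `|p * (- 4 * U1)| <= 4 * q * a.
  have -> : p * (- 4 * U1) = - (4 * p * U1) by ring.
  by rewrite normrN normrM (ger0_norm u1) normrM [`|4|]ger0_norm// -/q ler_wpM2l// mulr_ge0.
have n2 : `|4 * p ^+ 2 * U2| <= 4 * p ^+ 2 * a.
  have p2 : 0 <= 4 * p ^+ 2 by apply: mulr_ge0 => //; exact: sqr_ge0.
  by rewrite ger0_norm; [exact: ler_wpM2l|exact: mulr_ge0].
have n3 : `|2 * d%:R * p * U3| <= 2 * d%:R * q * a.
  rewrite normrM (ger0_norm u3) normrM -/q ger0_norm; last by rewrite mulr_ge0.
  by rewrite ler_wpM2l// !mulr_ge0.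
have n4 : `|4 * rk * p * U4| <= 4 * rk * q * X.
  rewrite normrM (ger0_norm u4) normrM -/q ger0_norm; last by rewrite mulr_ge0// ltW.
  by rewrite ler_wpM2l// !mulr_ge0// ltW.
apply: le_trans (ler_normB _ _) _; apply: le_trans (lerD (ler_normD _ _) (lexx _)) _.
apply: le_trans (lerD (lerD (ler_normD _ _) (lexx _)) (lexx _)) _.
have h1 : 0 <= q * X by rewrite mulr_ge0.
have h2 : 0 <= p ^+ 2 * X by rewrite mulr_ge0 ?sqr_ge0.
have h3 : 0 <= d%:R * q * X by rewrite !mulr_ge0.
have h4 : 0 <= rk * q * a by rewrite !mulr_ge0// ltW.
clear -n1 n2 n3 n4 h1 h2 h3 h4 X0 a0.
lra.
Qed.

(** Where [Xp u] >= 2/del, the product dominates 1/u; elsewhere u is bounded below and 1/u is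
    bounded. The roles are then exchanged for [Xp u]. The constants are the bounds at the two
    thresholds. *)
Lemma absorb (del : R) : 0 < del -> exists K : R, 0 < K /\ forall u : R, 0 < u ->
  u^-1 + Xp u <= del * (u^-1 * Xp u) + K.
Proof.
move=> del0; have al0 : 0 < al by rewrite divr_gt0.
pose L := ln (2 / del); have dd : 0 < 2 / del by rewrite divr_gt0.
exists (expR (L / al) + expR (al * L)); split; first by rewrite addr_gt0 ?expR_gt0.
move=> u u0; have aE : u^-1 = expR (- ln u) by rewrite expRN lnK.
have XE := Xp_expR al u0.
have X0 := Xp_gt0 al u0; have a0 : 0 < u^-1 by rewrite invr_gt0.
have e1 := expR_gt0 (L / al); have e2 := expR_gt0 (al * L).
have hh : del * (2 / del) = 2 by rewrite mulrC divfK// gt_eqF.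
have dX : 0 <= del / 2 * (u^-1 * Xp u).
  by apply: mulr_ge0; [rewrite divr_ge0// ltW|rewrite mulr_ge0// ltW].
have A1 : u^-1 <= del / 2 * (u^-1 * Xp u) + expR (L / al).
  have [h|h] := leP (2 / del) (Xp u).
    have : u^-1 * (2 / del) <= u^-1 * Xp u by rewrite ler_pM2l.
    move/(ler_wpM2l (ltW del0)); rewrite mulrCA hh; lra.
  have : u^-1 <= expR (L / al).
    rewrite aE ler_expR ler_pdivlMr// -ler_expR /L lnK ?posrE//.
    by rewrite (_ : - ln u * al = - al * ln u) -?XE ?ltW//; ring.
  lra.
have A2 : Xp u <= del / 2 * (u^-1 * Xp u) + expR (al * L).
  have [h|h] := leP (2 / del) u^-1.
    have : (2 / del) * Xp u <= u^-1 * Xp u by rewrite ler_pM2r.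
    move/(ler_wpM2l (ltW del0)); rewrite mulrA hh; lra.
  have : Xp u <= expR (al * L).
    rewrite XE ler_expR mulNr -mulrN ler_pM2l// -ler_expR /L lnK ?posrE//.
    by rewrite -aE ltW.
  lra.
lra.
Qed.

(** Used with half of the correction constant of V: one half is produced by [theta], the other half
    pays for the lower order terms. *)
Lemma generator_bound (C : R) : 0 < C -> exists K : R, 0 < K /\ forall u : R, 0 < u ->
  `|generator u - (kappa * (u^-1 * Xp u ^+ 2) + 4 * Num.sqrt kappa * theta * (u^-1 * Xp u)) *
     prof0 p b al u| <= (C * (u^-1 * Xp u) + K) * prof0 p b al u.
Proof.
move=> C_gt0; have [C0 [C00 H]] := generator_expand.
have [K [K0 HK]] := absorb (divr_gt0 C_gt0 C00).
exists (C0 * K); split; first exact: mulr_gt0.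
move=> u u0; apply: le_trans (H u u0) _; apply: ler_wpM2r; first exact/ltW/prof0_gt0.
have := ler_wpM2l (ltW C00) (HK u u0).
rewrite (_ : C0 * (C / C0 * (u^-1 * Xp u) + K) = C * (u^-1 * Xp u) + C0 * K)//.
by field; rewrite !gt_eqF.
Qed.

End Generator.

(** * One Gaussian step applied to the test function *)

Section SquaredNorm.
Context (R : realType) (d : nat).
Implicit Types x y z : d.-tuple R.

Definition sqn x : R := \sum_(i < d) tnth x i ^+ 2.

Lemma sqn_ge0 x : 0 <= sqn x.
Proof. by apply: sumr_ge0 => i _; exact: sqr_ge0. Qed.

Lemma enorm_sqr x : enorm x ^+ 2 = sqn x.
Proof. by rewrite /enorm sqr_sqrtr// sqn_ge0. Qed.

Lemma sqn_eq0 x : sqn x = 0 -> x = origin R d.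
Proof.
move=> /eqP; rewrite psumr_eq0; last by move=> i _; exact: sqr_ge0.
move=> /allP h; apply: eq_from_tnth => i; rewrite tnth_mktuple.
by apply/eqP; rewrite -sqrf_eq0; apply: h; rewrite mem_index_enum.
Qed.

Lemma sqn_gt0 x : x <> origin R d -> 0 < sqn x.
Proof.
by move=> x0; rewrite lt_neqAle sqn_ge0 andbT eq_sym; apply/eqP => /sqn_eq0.
Qed.

Lemma sqn_origin : sqn (origin R d) = 0.
Proof. by apply: big1 => i _; rewrite tnth_mktuple expr0n. Qed.

Lemma sqn_add x z : sqn (tadd x z) =
  sqn x + 2 * (\sum_(i < d) tnth x i * tnth z i) + sqn z.
Proof.
rewrite /sqn mulr_sumr -!big_split/=; apply: eq_bigr => i _.
by rewrite tnth_mktuple; ring.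
Qed.

Lemma cauchy_schwarz x z : (\sum_(i < d) tnth x i * tnth z i) ^+ 2 <= sqn x * sqn z.
Proof.
have [x0|x0] := eqVneq (sqn x) 0.
  rewrite x0 mul0r (sqn_eq0 x0) big1 ?expr0n//.
  by move=> i _; rewrite tnth_mktuple mul0r.
have xp : 0 < sqn x by rewrite lt_neqAle eq_sym x0 sqn_ge0.
set S := \sum_(i < d) _.
have : 0 <= \sum_(i < d) (sqn x * tnth z i - S * tnth x i) ^+ 2.
  by apply: sumr_ge0 => i _; exact: sqr_ge0.
have -> : \sum_(i < d) (sqn x * tnth z i - S * tnth x i) ^+ 2 =
    sqn x * (sqn x * sqn z - S ^+ 2).
  transitivity (\sum_(i < d) (sqn x ^+ 2 * tnth z i ^+ 2 + (- (2 * sqn x * S)) *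
     (tnth x i * tnth z i) + S ^+ 2 * tnth x i ^+ 2)).
    by apply: eq_bigr => i _; ring.
  by rewrite !big_split/= -!mulr_sumr -/S -/(sqn x) -/(sqn z); ring.
by rewrite pmulr_rge0// subr_ge0.
Qed.

Lemma measurable_sqn : measurable_fun setT sqn.
Proof.
apply: measurable_sum => i; apply: measurable_funX; exact: measurable_tnth.
Qed.

Lemma measurable_tadd dT (T : measurableType dT) (f g : T -> d.-tuple R) :
  measurable_fun setT f -> measurable_fun setT g ->
  measurable_fun setT (fun t => tadd (f t) (g t)).
Proof.
move=> mf mg; apply/measurable_fun_tnthP => i.
rewrite (_ : _ \o _ = fun t => tnth (f t) i + tnth (g t) i); last first.
  by apply/funext => t; rewrite /= tnth_mktuple.
by apply: measurable_funD; apply: (measurableT_comp (measurable_tnth i)).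
Qed.

End SquaredNorm.

Section OneStep.
Context (R : realType) (d : nat) (dO : measure_display) (Omega : measurableType dO).
Variables (P : probability Omega R) (B : R -> Omega -> d.-tuple R).
Hypothesis hB : is_BM P B.
Variables (beta kappa theta : R).
Hypotheses (beta0 : 0 < beta) (kappa0 : 0 < kappa).
Notation p := (prof_exp d beta theta).
Notation b := (Num.sqrt kappa / beta).
Notation al := (beta / 2).
Notation phi := (fun x : d.-tuple R => prof p b al (sqn x)).

Lemma measurable_phi : measurable_fun setT phi.
Proof.
apply: measurableT_comp; last exact: measurable_sqn.
by apply: measurable_prof; rewrite divr_gt0// sqrtr_gt0.
Qed.

(** [prof_taylor] is used with A = |z|^2 and B = 2 x.z, whose discriminant condition is the
    Cauchy-Schwarz inequality. The constant depends neither on the point nor on the step, although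
    1/u blows up near the origin. *)
Lemma one_step : exists M : R, 0 < M /\ forall (s : R) k x, 0 < s -> 0 < sqn x ->
  `|\int[P]_w phi (tadd x (incr B s k w)) -
     (prof0 p b al (sqn x) + s * generator d beta kappa theta (sqn x))| <= M * (s * Num.sqrt s).
Proof.
have b0 : 0 < b by rewrite divr_gt0// sqrtr_gt0.
have al0 : 0 < al by rewrite divr_gt0.
have [M [M0 HM]] := prof_taylor p b0 al0.
have [D [D0 HD]] := prof_bounded p b0 al0.
exists (M * (2 * d%:R + 512 * d%:R * 2 ^+ d) + 1); split.
  apply: ltr_wpDl; last exact: ltr01.
  apply: mulr_ge0; first exact: ltW.
  apply: addr_ge0; first by apply: mulr_ge0; exact: ler0n.
  apply: mulr_ge0; last by apply: exprn_ge0; exact: ler0n.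
  by apply: mulr_ge0; exact: ler0n.
move=> s k x s0 u0; set u := sqn x in u0 *.
pose z i w := tnth (incr B s k w) i.
pose F1 := prof1 p b al u; pose F2 := prof2 p b al u.
have r0 : 0 <= s * Num.sqrt s by rewrite mulr_ge0 ?sqrtr_ge0// ltW.
apply: (@le_trans _ _ (M * ((2 * d%:R + 512 * d%:R * 2 ^+ d) * (s * Num.sqrt s)))); last first.
  by rewrite [leRHS]mulrDl mul1r mulrA lerDl.
have cm i := coord_moments hB s0 k i; have cp i j := coord_mul hB s0 k i j.
(* The coefficients supplied are the gradient and half the Hessian of phi at [x]; 2s times the trace
   of the latter is s times [generator]. *)
have := @step_expectation _ Omega R P d z s s0
  (fun i => let: conj (And4 h _ _ _) _ := cm i in h)
  (fun i => let: conj (And4 _ h _ _) _ := cm i in h)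
  (fun i j => (cp i j).1) (fun i j => (cp i j).2)
  (fun i => (cm i).2.1) (fun i => (cm i).2.2)
  (fun w => phi (tadd x (incr B s k w))) D M (prof0 p b al u)
  (fun i => 2 * F1 * tnth x i)
  (fun i j => 2 * F2 * (tnth x i * tnth x j) + (if i == j then F1 else 0)).
have -> : 2 * s * \sum_(i < d) (2 * F2 * (tnth x i * tnth x i) + (if i == i then F1 else 0)) =
    s * generator d beta kappa theta u.
  under eq_bigr do rewrite eqxx -expr2.
  rewrite big_split/= -mulr_sumr sumr_const card_ord -/(sqn x) -/u /generator -/F1 -/F2.
  by rewrite -[F1 *+ d]mulr_natl; ring.
apply; first exact: ltW.
- apply: (@measurableT_comp _ _ _ _ _ _ phi _ (fun w => tadd x (incr B s k w))).
    exact: measurable_phi.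
  by apply: measurable_tadd; [exact: measurable_cst|exact: (measurable_incr hB)].
- by move=> w; rewrite ger0_norm ?prof_ge0.
- move=> w; set S := \sum_(i < d) tnth x i * z i w.
  have AE : \sum_(i < d) z i w ^+ 2 = sqn (incr B s k w) by [].
  have CS : S ^+ 2 <= u * sqn (incr B s k w) by exact: cauchy_schwarz.
  have := HM u (sqn (incr B s k w)) (2 * S) u0 (sqn_ge0 _).
  rewrite AE -/F1 -/F2 sqn_add -/S -/u.
  have -> : \sum_(i < d) 2 * F1 * tnth x i * z i w = F1 * (2 * S).
    by rewrite /S !mulr_sumr; apply: eq_bigr => i _; ring.
  have -> : \sum_(i < d) \sum_(j < d) (2 * F2 * (tnth x i * tnth x j) +
      (if i == j then F1 else 0)) * (z i w * z j w) =
      F2 * (2 * S) ^+ 2 / 2 + F1 * sqn (incr B s k w).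
    transitivity (\sum_(i < d) (2 * F2 * S * (tnth x i * z i w) + F1 * z i w ^+ 2)).
      apply: eq_bigr => i _; under eq_bigr do rewrite mulrDl.
      rewrite big_split/=; congr (_ + _).
        by rewrite /S mulr_sumr mulr_suml; apply: eq_bigr => j _; ring.
      rewrite (bigD1 i)//= eqxx big1 ?addr0 ?expr2//.
      by move=> j ij; rewrite eq_sym (negbTE ij) mul0r.
    by rewrite big_split/= -!mulr_sumr -/S AE; field.
  rewrite !addrA => H; apply: H.
  by rewrite exprMn; lra.
Qed.

End OneStep.

(** * Discrete Feynman-Kac products along a random walk *)

Section Chain.
Context (R : realType) (d : nat) (dO : measure_display) (Omega : measurableType dO).
Variables (P : probability Omega R) (B : R -> Omega -> d.-tuple R).
Hypothesis hB : is_BM P B.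
Variable s : R.
Hypothesis s0 : 0 < s.
Variables (x : d.-tuple R) (g f : d.-tuple R -> R) (D : R).
Hypotheses (mg : measurable_fun setT g) (g01 : forall y, 0 <= g y <= 1).
Hypotheses (mf : measurable_fun setT f) (f0D : forall y, 0 <= f y <= D).
Notation intg f := (P.-integrable setT (EFin \o f)).

Definition walk j w := tadd x (B (j%:R * s) w).
(** Rebuilds the walk from a tuple of increments, so that positions become measurable functions of
    [past], for which independence of the next increment is available. *)
Definition walk_of k (t : k.-tuple (d.-tuple R)) j : d.-tuple R :=
  [tuple tnth x l + \sum_(i < j) tnth (nth (origin R d) t i) l | l < d].
Definition weight k w := \prod_(j < k) g (walk j w).
(** The index [k] is kept although all steps have the same law: one-step bounds uniform in [k] spare
    the identification of these operators. *)
Definition trans k y := \int[P]_w f (tadd y (incr B s k w)).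

Lemma walk0 w : walk 0 w = x.
Proof.
case: hB => h0 _ _ _; apply: eq_from_tnth => l.
by rewrite /walk mul0r h0 !tnth_mktuple addr0.
Qed.

Lemma walkS k w : tadd (walk k w) (incr B s k w) = walk k.+1 w.
Proof. by apply: eq_from_tnth => l; rewrite /walk /incr !tnth_mktuple; ring. Qed.

Lemma walk_of_past k j w : (j <= k)%N -> walk_of (past B s k w) j = walk j w.
Proof.
move=> jk; apply: eq_from_tnth => l; rewrite !tnth_mktuple; congr (_ + _).
transitivity (\sum_(i < j) (tnth (B (i.+1%:R * s) w) l - tnth (B (i%:R * s) w) l)).
  apply: eq_bigr => i _; have ik : (i < k)%N by exact: leq_trans (ltn_ord i) jk.
  by rewrite -(tnth_nth _ (past B s k w) (Ordinal ik)) !tnth_mktuple.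
rewrite -(big_mkord xpredT (fun i => tnth (B (i.+1%:R * s) w) l - tnth (B (i%:R * s) w) l)).
rewrite telescope_sumr//; case: hB => h0 _ _ _.
by rewrite mul0r h0 tnth_mktuple subr0.
Qed.

Lemma measurable_walk j : measurable_fun setT (walk j).
Proof.
by apply: measurable_tadd; [exact: measurable_cst|exact: (measurable_BM hB)].
Qed.

Lemma measurable_walk_of k j :
  measurable_fun setT (fun t : k.-tuple (d.-tuple R) => walk_of t j).
Proof.
apply/measurable_fun_tnthP => l.
rewrite (_ : _ \o _ = fun t : k.-tuple (d.-tuple R) =>
    tnth x l + \sum_(i < j) tnth (nth (origin R d) t i) l); last first.
  by apply/funext => t; rewrite /= tnth_mktuple.
apply: measurable_funD; first exact: measurable_cst.
apply: measurable_sum => i; apply: (measurableT_comp (measurable_tnth l)).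
have [ik|ik] := ltnP i k.
  rewrite (_ : (fun t => _) = fun t : k.-tuple (d.-tuple R) => tnth t (Ordinal ik)).
    exact: measurable_tnth.
  by apply/funext => t; rewrite (tnth_nth (origin R d)).
rewrite (_ : (fun t => _) = fun=> origin R d); first exact: measurable_cst.
by apply/funext => t; rewrite nth_default// size_tuple.
Qed.

Lemma measurable_weight k : measurable_fun setT (weight k).
Proof.
apply: measurable_prod => j _.
exact: (measurableT_comp mg (measurable_walk j)).
Qed.

Lemma prod01 k (a : 'I_k -> R) : (forall j, 0 <= a j <= 1) -> 0 <= \prod_(j < k) a j <= 1.
Proof.
move=> a01; apply: (big_ind (fun v => 0 <= v <= 1)) => //.
  by rewrite ler01 lexx.
move=> u v /andP[u0 u1] /andP[v0 v1].
by rewrite mulr_ge0//= mulr_ile1.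
Qed.

Lemma weight01 k w : 0 <= weight k w <= 1.
Proof. exact: prod01. Qed.

Lemma trans_EFin k y :
  ((trans k y)%:E = \int[P]_w (f (tadd y (incr B s k w)))%:E)%E.
Proof.
rewrite /trans /Rintegral fineK//; apply: integrable_fin_num => //.
apply: (@integrable_bounded _ _ _ _ _ D).
  apply: (measurableT_comp mf); apply: measurable_tadd; first exact: measurable_cst.
  exact: (measurable_incr hB).
by move=> w; case/andP: (f0D (tadd y (incr B s k w))) => a b; rewrite ger0_norm.
Qed.

Lemma trans_bound k y : 0 <= trans k y <= D.
Proof.
apply/andP; split.
  by apply: Rintegral_ge0 => w _; case/andP: (f0D (tadd y (incr B s k w))).
rewrite -[leRHS](Rintegral_cst_prob P); apply: le_Rintegral => //.
- apply: (@integrable_bounded _ _ _ _ _ D).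
    apply: (measurableT_comp mf); apply: measurable_tadd; first exact: measurable_cst.
    exact: (measurable_incr hB).
  by move=> w; case/andP: (f0D (tadd y (incr B s k w))) => a b; rewrite ger0_norm.
- exact: finite_measure_integrable_cst.
- by move=> w _; case/andP: (f0D (tadd y (incr B s k w))).
Qed.

Lemma measurable_trans k : measurable_fun setT (trans k).
Proof.
apply/measurable_EFinP.
rewrite (_ : EFin \o _ = fun y => \int[P]_w (f (tadd y (incr B s k w)))%:E)%E; last first.
  by apply/funext => y; rewrite -trans_EFin.
apply: (@measurable_fun_fubini_tonelli_F _ _ _ _ _ P
  (fun z : d.-tuple R * Omega => (f (tadd z.1 (incr B s k z.2)))%:E)).
  apply/measurable_EFinP; apply: (measurableT_comp mf); apply: measurable_tadd.
    exact: measurable_fst.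
  exact: (measurableT_comp (measurable_incr hB s k) measurable_snd).
by move=> z; rewrite lee_fin; case/andP: (f0D (tadd z.1 (incr B s k z.2))).
Qed.

Definition expect k := \int[P]_w (weight k w * f (walk k w)).

Lemma integrable_weight k (h : d.-tuple R -> R) (C : R) : measurable_fun setT h ->
  (forall y, 0 <= h y <= C) -> intg (fun w => weight k w * h (walk k w)).
Proof.
move=> mh h0C; apply: (@integrable_bounded _ _ _ _ _ C).
  apply: measurable_funM; first exact: measurable_weight.
  exact: (measurableT_comp mh (measurable_walk k)).
move=> w; have /andP[w0 w1] := weight01 k w; have /andP[a b] := h0C (walk k w).
by rewrite ger0_norm ?mulr_ge0// (le_trans _ b)// ler_piMl.
Qed.

(** Markov property at step k: the weight up to and including [g] at the k-th position is a function
    of the first k increments, and the next increment is integrated out independently. *)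
Lemma expectS k :
  expect k.+1 = \int[P]_w (weight k w * (g (walk k w) * trans k (walk k w))).
Proof.
pose G (t : k.-tuple (d.-tuple R)) := \prod_(j < k.+1) g (walk_of t j).
have G0 t : 0 <= G t by apply: prodr_ge0 => j _; case/andP: (g01 (walk_of t j)).
pose F (t : k.-tuple (d.-tuple R)) (z : d.-tuple R) := (G t * f (tadd (walk_of t k) z))%:E.
have GE w : G (past B s k w) = weight k w * g (walk k w).
  rewrite /G /weight big_ord_recr/= walk_of_past//; congr (_ * _).
  by apply: eq_bigr => j _; rewrite walk_of_past// ltnW.
have mF : measurable_fun [set: k.-tuple (d.-tuple R) * d.-tuple R] (fun z => F z.1 z.2).
  have mw (j : nat) : measurable_fun [set: k.-tuple (d.-tuple R) * d.-tuple R]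
      (fun z => walk_of z.1 j).
    apply: (@measurableT_comp _ _ _ _ _ _ (fun t : k.-tuple (d.-tuple R) => walk_of t j) _ fst).
      exact: measurable_walk_of.
    exact: measurable_fst.
  apply/measurable_EFinP; apply: measurable_funM.
    apply: measurable_prod => j _; apply: (measurableT_comp mg); exact: mw.
  by apply: (measurableT_comp mf); apply: measurable_tadd; [exact: mw|exact: measurable_snd].
have F0 t z : (0 <= F t z)%E.
  by rewrite lee_fin mulr_ge0//; case/andP: (f0D (tadd (walk_of t k) z)).
have mp : measurable_fun setT (past B s k) by exact: (measurable_past hB).
have mi : measurable_fun setT (incr B s k) by exact: (measurable_incr hB).
have IE := @indep_integral _ _ _ P _ _ _ _ (past B s k) (incr B s k) F
  mp mi
  (fun A C mA mC => past_incr_indep hB s0 mA mC) mF F0.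
rewrite /expect /Rintegral; congr fine.
transitivity (\int[P]_w F (past B s k w) (incr B s k w))%E.
  apply: eq_integral => w _; rewrite /F GE walk_of_past// walkS.
  by rewrite /weight big_ord_recr.
rewrite IE; apply: eq_integral => w _; rewrite /F.
under eq_integral do rewrite EFinM walk_of_past//.
rewrite ge0_integralZl//.
- by rewrite -trans_EFin GE -EFinM mulrA.
- apply/measurable_EFinP; apply: (measurableT_comp mf); apply: measurable_tadd.
    exact: measurable_cst.
  exact: (measurable_incr hB).
- by move=> w' _; rewrite lee_fin; case/andP: (f0D (tadd (walk k w) (incr B s k w'))).
- by rewrite lee_fin.
Qed.

Lemma expect0 : expect 0 = f x.
Proof.
rewrite /expect -[RHS](Rintegral_cst_prob P); apply: eq_Rintegral => w _.
by rewrite /weight big_ord0 mul1r walk0.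
Qed.

Lemma integrable_next k :
  intg (fun w => weight k w * (g (walk k w) * trans k (walk k w))).
Proof.
apply: (@integrable_weight k (fun y => g y * trans k y) D).
  by apply: measurable_funM => //; exact: measurable_trans.
move=> y; have /andP[a b] := g01 y; have /andP[a' b'] := trans_bound k y.
by rewrite mulr_ge0//= (le_trans _ b')// ler_piMl.
Qed.

(** A discrete Gronwall inequality; since weights are at most 1, each step adds at most [e], later
    magnified by no more than the power of 1 + a. *)
Lemma chain_upper (a e : R) : 0 <= a -> 0 <= e ->
  (forall k y, g y * trans k y <= (1 + a) * f y + e) ->
  forall n, expect n <= (1 + a) ^+ n * (f x + n%:R * e).
Proof.
move=> a0 e0 H; have a1 : 1 <= 1 + a by rewrite lerDl.
elim=> [|k IH]; first by rewrite expect0 expr0 mul1r mul0r addr0.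
have If := integrable_weight k mf f0D.
have step : expect k.+1 <= (1 + a) * expect k + e.
  rewrite expectS -RintegralZl// -[X in _ + X](Rintegral_cst_prob P).
  have Ie : intg (fun=> e) by exact: finite_measure_integrable_cst.
  rewrite -RintegralD//; last exact: integrable_scale.
  apply: le_Rintegral => //; first exact: integrable_next.
    by apply: integrable_add => //; exact: integrable_scale.
  move=> w _; have /andP[w0 w1] := weight01 k w.
  apply: le_trans (ler_wpM2l w0 (H k _)) _; rewrite mulrDr mulrCA lerD2l.
  by rewrite ler_piMl.
apply: le_trans step _; apply: le_trans (lerD (ler_wpM2l _ IH) (lexx e)) _.
  exact: le_trans ler01 a1.
have ek : e <= (1 + a) ^+ k.+1 * e by rewrite ler_peMl// exprn_ege1.
by rewrite mulrA -exprS -natr1 mulrDl addrA mul1r [leRHS]mulrDr lerD2l.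
Qed.

(** Here 1 - a lies in [0,1], so the errors of earlier steps are not magnified and simply add up. *)
Lemma chain_lower (a e : R) : 0 <= a <= 1 -> 0 <= e ->
  (forall k y, (1 - a) * f y - e <= g y * trans k y) ->
  forall n, (1 - a) ^+ n * f x - n%:R * e <= expect n.
Proof.
move=> /andP[a0 a1] e0 H; have b0 : 0 <= 1 - a by rewrite subr_ge0.
have b1 : 1 - a <= 1 by rewrite lerBlDr lerDl.
elim=> [|k IH]; first by rewrite expect0 expr0 mul1r mul0r subr0.
have If := integrable_weight k mf f0D.
have step : (1 - a) * expect k <= expect k.+1 + e.
  rewrite expectS -RintegralZl// -[X in _ <= _ + X](Rintegral_cst_prob P).
  have Ie : intg (fun=> e) by exact: finite_measure_integrable_cst.
  have In := integrable_next k.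
  rewrite -RintegralD//; apply: le_Rintegral => //; [exact: integrable_scale|exact: integrable_add|].
  move=> w _; have /andP[w0 w1] := weight01 k w.
  have := ler_wpM2l w0 (H k (walk k w)); rewrite mulrBr lerBlDr mulrCA => h.
  by apply: le_trans h _; rewrite lerD2l ler_piMl.
rewrite -lerBlDr in step; apply: le_trans _ step.
have := ler_wpM2l b0 IH; rewrite mulrBr mulrA -exprS => h.
have : (1 - a) * (k%:R * e) <= k%:R * e by rewrite ler_piMl// mulr_ge0.
by rewrite -natr1 mulrDl mul1r; lra.
Qed.

End Chain.

(** * Riemann sums and upper and lower limits *)

Section Riemann.
Context (R : realType).
Notation leb := (@lebesgue_measure R).

Lemma unif_continuous01 (h : R -> R) : {within `[0, 1], continuous h} ->
  forall e, 0 < e -> exists2 del : R, 0 < del & forall s t, 0 <= s <= 1 -> 0 <= t <= 1 ->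
    `|s - t| < del -> `|h s - h t| < e.
Proof.
move=> ch e e0.
have cpt : near_covering [set` `[(0:R), 1]] by apply/compact_near_coveringP; exact: segment_compact.
pose Q (del s : R) := forall t, 0 <= s <= 1 -> 0 <= t <= 1 -> `|s - t| < del -> `|h s - h t| < e.
have loc (x : R) : [set` `[(0:R), 1]] x ->
    \forall x' \near x & del \near (0 : R)^'+, Q del x'.
  move=> x01; move/subspace_continuousP : ch => /(_ x x01).
  move/cvgrPdist_lt => /(_ (e / 2) (divr_gt0 e0 (ltr0Sn _ 1))).
  rewrite near_withinE => /nbhs_ballP[eta /= eta0 Heta].
  exists (ball x (eta / 2), [set del | del < eta / 2]).
    split => /=; first by apply: nbhsx_ballx; rewrite divr_gt0.
    by apply: nbhs_right_lt; rewrite divr_gt0.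
  move=> [x' del]/= [bx ld] t x'01 t01 xt.
  have hx' : `|h x - h x'| < e / 2.
    apply: Heta; last by rewrite /= in_itv.
    by apply: le_ball bx; move: eta0; lra.
  have ht : `|h x - h t| < e / 2.
    apply: Heta; last by rewrite /= in_itv.
    rewrite /ball/= in bx *; have -> : x - t = (x - x') + (x' - t) by ring.
    by apply: le_lt_trans (ler_normD _ _) _; lra.
  have -> : h x' - h t = - (h x - h x') + (h x - h t) by ring.
  by apply: le_lt_trans (ler_normD _ _) _; rewrite normrN; lra.
have HQ : \forall del \near (0 : R)^'+, [set` `[(0:R), 1]] `<=` Q del by apply: cpt loc.
have HQ' : \forall del \near (0 : R)^'+, ([set` `[(0:R), 1]] `<=` Q del) /\ 0 < del.
  near=> del; split; first by near: del; exact: HQ.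
  by near: del; exact: nbhs_right_gt.
case: (@filter_ex _ _ (at_right_proper_filter (0 : R)) _ HQ') => del [dQ d0].
exists del => // s t s01 t01 st; apply: dQ => //.
Unshelve. all: by end_near. Qed.

(** Left endpoints are used, to match the products in [weight], which stop before the current
    position. *)
Lemma riemann_cvg (h : R -> R) : {within `[0, 1], continuous h} ->
  (n.+1%:R^-1 * \sum_(j < n.+1) h (j%:R * n.+1%:R^-1)) @[n --> \oo] -->
  \int[leb]_(s in `[0, 1]) h s.
Proof.
move=> ch; apply/cvgrPdist_le => e e0.
have [del del0 H] := unif_continuous01 ch e0.
have Ih : leb.-integrable `[0, 1] (EFin \o h).
  by apply: continuous_compact_integrable => //; exact: segment_compact.
near=> n.
have sd : n.+1%:R^-1 < del.
  by near: n; move: (@cvg_harmonic R) => /cvgr_lt /(_ _ del0).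
pose s : R := n.+1%:R^-1.
have s0 : 0 < s by rewrite invr_gt0.
rewrite -/s in sd.
have Ns : n.+1%:R * s = 1 by rewrite mulfV.
pose J k := \int[leb]_(u in `[0, k%:R * s]) h u.
have t1 k : (k <= n.+1)%N -> k%:R * s <= 1 by move=> kn; rewrite -[leRHS]Ns ler_pM2r// ler_nat.
have tk0 k : 0 <= k%:R * s by rewrite mulr_ge0// ltW.
have IJ k : (k <= n.+1)%N -> leb.-integrable `[0, k%:R * s] (EFin \o h).
  move=> kn; apply: integrableS Ih => //; apply: subset_itvl.
  by rewrite bnd_simp t1.
(* Induction on the number of cells: on each of them [h] varies by less than e, so the error grows
   by at most s e per cell. *)
have key k : (k <= n.+1)%N ->
    `|J k - s * \sum_(j < k) h (j%:R * s)| <= k%:R * s * e.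
  elim: k => [_|k IH kn].
    by rewrite /J big_ord0 !mul0r mulr0 subr0 set_itv1 Rintegral_set1 normr0.
  have kn' := ltnW kn.
  have tkk : k%:R * s <= k.+1%:R * s by rewrite ler_pM2r// ler_nat.
  have JB : J k.+1 - J k = \int[leb]_(u in `]k%:R * s, k.+1%:R * s]) h u.
    by apply: Rintegral_itvB; [exact: IJ|rewrite bnd_simp|rewrite bnd_simp].
  have Iu : leb.-integrable `]k%:R * s, k.+1%:R * s] (EFin \o h).
    by apply: integrableS (IJ _ kn) => //; apply: subset_itvr; rewrite bnd_simp.
  have cst c : \int[leb]_(u in `]k%:R * s, k.+1%:R * s]) c = c * s.
    rewrite Rintegral_cst// [X in fine X]lebesgue_measure_itv/= lte_fin ltr_pM2r// ltr_nat ltnSn.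
    by rewrite -EFinD/= -mulrBl -natr1 addrAC subrr add0r mul1r.
  have Ic c : leb.-integrable `]k%:R * s, k.+1%:R * s] (EFin \o (fun=> c)).
    apply/integrableP; split; first exact: measurable_cst.
    rewrite integral_cst//= lebesgue_measure_itv/= lte_fin ltr_pM2r// ltr_nat ltnSn.
    by rewrite -EFinD -EFinM ltry.
  have hu u : u \in `]k%:R * s, k.+1%:R * s] -> `|h (k%:R * s) - h u| < e.
    rewrite in_itv/= => /andP[ku uk]; apply: H.
    - by rewrite tk0 t1.
    - by rewrite (le_trans (tk0 k) (ltW ku)) (le_trans uk)// t1.
    - rewrite ler0_norm ?subr_le0 ?ltW// opprB (le_lt_trans _ sd)//.
      by rewrite lerBlDr (le_trans uk)// -natr1 mulrDl mul1r addrC.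
  have U : J k.+1 - J k <= (h (k%:R * s) + e) * s.
    rewrite JB -[leRHS]cst; apply: le_Rintegral => // u /hu.
    by rewrite ltr_norml => /andP[h1 h2]; lra.
  have L : (h (k%:R * s) - e) * s <= J k.+1 - J k.
    rewrite JB -[leLHS]cst; apply: le_Rintegral => // u /hu.
    by rewrite ltr_norml => /andP[h1 h2]; lra.
  have := IH kn'; rewrite big_ord_recr/= !ler_norml => /andP[i1 i2].
  rewrite -natr1; apply/andP; split; lra.
have := key n.+1 (leqnn _); rewrite /J Ns mul1r.
by rewrite /s.
Unshelve. all: by end_near. Qed.

End Riemann.

Section LimInf.
Context (R : realType).
Implicit Types u c : nat -> \bar R.

Lemma limn_einf_le u (l : \bar R) N0 : (forall n, (N0 <= n)%N -> (u n <= l)%E) ->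
  (limn_einf u <= l)%E.
Proof.
move=> ul; rewrite limn_einf_lim; apply: lime_le; first exact: is_cvg_einfs.
exists N0 => // n /= N0n; apply: le_trans (ul n N0n).
by apply: ereal_inf_lbound; exists n => /=.
Qed.

Lemma limn_einf_ge u c (l : \bar R) N0 : c @ \oo --> l ->
  (forall n, (N0 <= n)%N -> (c n <= u n)%E) -> (l <= limn_einf u)%E.
Proof.
move=> cl cu; have [<- _] := cvg_limn_einf_sup cl.
rewrite !limn_einf_lim; apply: lee_lim; [exact: is_cvg_einfs|exact: is_cvg_einfs|].
exists N0 => // n /= N0n; apply: le_ereal_inf_tmp => _ [m /= nm <-].
apply: le_trans (cu m (leq_trans N0n nm)).
by apply: ereal_inf_lbound; exists m.
Qed.

Lemma limn_esup_le u c (l : \bar R) N0 : c @ \oo --> l ->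
  (forall n, (N0 <= n)%N -> (u n <= c n)%E) -> (limn_esup u <= l)%E.
Proof.
move=> cl uc; rewrite -leeN2 -limn_einfN.
apply: (@limn_einf_ge _ (fun n => - c n)%E _ N0); first exact: cvgeN.
by move=> n N0n; rewrite leeN2; exact: uc.
Qed.

Lemma cvg_sum_ord (T : Type) (F : set_system T) {FF : Filter F} n
    (f : 'I_n -> T -> R) (l : 'I_n -> R) :
  (forall i, f i t @[t --> F] --> l i) ->
  (\sum_(i < n) f i t) @[t --> F] --> \sum_(i < n) l i.
Proof.
elim: n f l => [|n IH] f l fl.
  have -> : (fun t => \sum_(i < 0) f i t) = (fun=> 0).
    by apply/funext => t; rewrite big_ord0.
  by rewrite big_ord0; exact: cvg_cst.
have -> : (fun t => \sum_(i < n.+1) f i t) =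
    (fun t => f ord0 t + \sum_(i < n) f (lift ord0 i) t).
  by apply/funext => t; rewrite big_ord_recl.
rewrite big_ord_recl; apply: cvgD; first exact: fl.
exact: (IH (fun i => f (lift ord0 i)) (fun i => l (lift ord0 i))).
Qed.

Lemma harmonic_lt (e : R) : 0 < e -> exists N0, forall n, (N0 <= n)%N -> n.+1%:R^-1 < e.
Proof.
move=> e0; have : \forall n \near \oo, n.+1%:R^-1 < e.
  by move: (@cvg_harmonic R) => /cvgr_lt /(_ _ e0).
by case=> N0 _ H; exists N0 => n Nn; exact: H.
Qed.

Lemma sqrt_harmonic_lt (e : R) : 0 < e ->
  exists N0, forall n, (N0 <= n)%N -> Num.sqrt n.+1%:R^-1 < e.
Proof.
move=> e0; have [N0 H] := harmonic_lt (exprn_gt0 2 e0); exists N0 => n /H h.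
by rewrite -[ltRHS]ger0_norm ?ltW// -sqrtr_sqr ltr_sqrt// exprn_gt0.
Qed.

End LimInf.

(** * Passage to the limit: the Feynman-Kac estimates *)

Section FeynmanKac.
Context (R : realType) (d : nat) (dO : measure_display) (Omega : measurableType dO).
Variables (P : probability Omega R) (B : R -> Omega -> d.-tuple R).
Hypothesis hB : is_BM P B.
Variables (beta kappa theta : R).
Hypotheses (beta0 : 0 < beta) (kappa0 : 0 < kappa).
Notation p := (prof_exp d beta theta).
Notation b := (Num.sqrt kappa / beta).
Notation al := (beta / 2).
Notation phi := (fun x : d.-tuple R => prof p b al (sqn x)).
Notation Gen := (generator d beta kappa theta).
Notation leb := (@lebesgue_measure R).
(** The continuous radial comparison potential, as a function of |x|^2; [V] itself enters only
    through pointwise inequalities with it. *)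
Variable v : R -> R.
Hypotheses (mv : measurable_fun setT v) (v0 : forall u : R, 0 < u -> 0 <= v u).
Hypothesis cv : forall u : R, 0 < u -> {for u, continuous v}.

Let b0 : 0 < b. Proof. by rewrite divr_gt0// sqrtr_gt0. Qed.
Let al0 : 0 < al. Proof. by rewrite divr_gt0. Qed.

Section Path.
Variables (x : d.-tuple R) (w : Omega).
Let W s := tadd x (B s w).

Lemma path_continuous : {within `[0, 1], continuous (fun s => sqn (W s))}.
Proof.
case: hB => _ cB _ _; apply/subspace_continuousP => s s01.
have H (i : 'I_d) : tnth (W t) i ^+ 2 @[t --> within `[0, 1] (nbhs s)] --> tnth (W s) i ^+ 2.
  rewrite /W tnth_mktuple.
  under eq_fun do rewrite tnth_mktuple.
  have cBi : {within `[0, 1], continuous (fun t => tnth (B t w) i)}.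
    apply: continuous_subspaceW (cB w i) => t /=.
    by rewrite !in_itv/= andbT => /andP[].
  move/subspace_continuousP : cBi => /(_ s s01) h.
  by rewrite expr2; under eq_fun do rewrite expr2; apply: cvgM; apply: cvgD => //; exact: cvg_cst.
exact: cvg_sum_ord.
Qed.

(** A path avoiding the origin on [0,1] keeps v(|W|^2) continuous there, so its integral is finite
    and is the limit of the Riemann sums. *)
Lemma path_exp_cvg : (forall s, 0 <= s <= 1 -> 0 < sqn (W s)) ->
  let I := \int[leb]_(s in `[0, 1]) v (sqn (W s)) in
  expR (- (n.+1%:R^-1 * \sum_(j < n.+1) v (sqn (W (j%:R * n.+1%:R^-1)))))
    @[n --> \oo] --> expR (- I) /\
  (\int[leb]_(s in `[0%R, 1%R]%classic) (v (sqn (W s)))%:E = I%:E)%E.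
Proof.
move=> Wpos I.
have ch : {within `[0, 1], continuous (fun s => v (sqn (W s)))}.
  apply/subspace_continuousP => s s01.
  have us : 0 < sqn (W s) by apply: Wpos; move: s01; rewrite /= in_itv.
  apply: (@continuous_cvg _ _ _ _ _ (fun s => sqn (W s)) v _ (cv us)).
  by move: path_continuous => /subspace_continuousP; exact.
split.
  apply: (@continuous_cvg _ _ _ _ _ _ expR); first exact: continuous_expR.
  by apply: cvgN; exact: (riemann_cvg ch).
rewrite /I /Rintegral fineK//; apply: integrable_fin_num => //.
by apply: continuous_compact_integrable => //; exact: segment_compact.
Qed.

Lemma weight_exp (g : d.-tuple R -> R) (s : R) k :
  (forall j, (j < k)%N -> g (walk B s x j w) = expR (- (s * v (sqn (W (j%:R * s)))))) ->
  weight B s x g k w = expR (- (s * \sum_(j < k) v (sqn (W (j%:R * s))))).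
Proof.
move=> gE; rewrite mulr_sumr -sumrN expR_sum; apply: eq_bigr => j _.
by rewrite gE.
Qed.

Lemma exp_integral_le (V : d.-tuple R -> R) :
  (forall s, 0 <= s <= 1 -> 0 < sqn (W s)) ->
  (forall y, 0 < sqn y -> v (sqn y) <= V y) ->
  (expeR (- \int[leb]_(s in `[0%R, 1%R]%classic) (V (W s))%:E) <=
   (expR (- \int[leb]_(s in `[0, 1]) v (sqn (W s))))%:E)%E.
Proof.
move=> Wpos vV; have [_ IE] := path_exp_cvg Wpos.
set I := Rintegral _ _ _ in IE *.
rewrite -[leRHS]/(expeR (- I%:E)) lee_expeR leeN2 -IE.
apply: ge0_le_integral_any => s /=; rewrite in_itv/= => s01; rewrite lee_fin.
  exact/v0/Wpos.
exact/vV/Wpos.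
Qed.

Lemma exp_integral_ge (V : d.-tuple R -> R) :
  (forall s, 0 <= s <= 1 -> 0 < sqn (W s)) ->
  (forall y, 0 < sqn y -> 0 <= V y <= v (sqn y)) ->
  ((expR (- \int[leb]_(s in `[0, 1]) v (sqn (W s))))%:E <=
   expeR (- \int[leb]_(s in `[0%R, 1%R]%classic) (V (W s))%:E))%E.
Proof.
move=> Wpos vV; have [_ IE] := path_exp_cvg Wpos.
set I := Rintegral _ _ _ in IE *.
rewrite -[leLHS]/(expeR (- I%:E)) lee_expeR leeN2 -IE.
apply: ge0_le_integral_any => s /=; rewrite in_itv/= => s01; rewrite lee_fin.
  by case/andP: (vV _ (Wpos s s01)).
by case/andP: (vV _ (Wpos s s01)).
Qed.

End Path.

Lemma measurable_exp_potential (s : R) :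
  measurable_fun setT (fun y : d.-tuple R => expR (- (s * v (sqn y)))).
Proof.
apply: measurableT_comp => //; apply: measurableT_comp => //.
apply: measurable_funM; first exact: measurable_cst.
by apply: (measurableT_comp mv); exact: measurable_sqn.
Qed.

Lemma grid (n j : nat) : (j < n.+1)%N -> 0 <= (j%:R * n.+1%:R^-1 : R) <= 1.
Proof.
move=> jn; rewrite mulr_ge0//= ?invr_ge0//.
by rewrite ler_pdivrMr// mul1r ler_nat ltnW.
Qed.

(** On [A] the indicator is at most phi/m0, so it suffices to bound the functional of phi. The
    Laplacian bound makes phi almost a supersolution of each weighted step, and Fatou's lemma
    carries the discrete bound to the limit. *)
Lemma FK_upper (V : d.-tuple R -> R) (K m0 : R) (A : set (d.-tuple R)) :
  0 < K -> 0 < m0 ->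
  (forall u, 0 < u -> Gen u <= (v u + K) * prof0 p b al u) ->
  (forall y, 0 < sqn y -> v (sqn y) <= V y) ->
  (forall y, A y -> m0 <= phi y) ->
  forall x, 0 < sqn x ->
  (FKsemigroup P B V 1 x A <= (m0^-1 * (2 * expR K * phi x))%:E)%E.
Proof.
move=> K0 m00 HG vV Am0 x x0.
have [M [M0 HM]] := one_step hB theta beta0 kappa0.
have [D [D0 HD]] := prof_bounded p b0 al0.
pose s n : R := n.+1%:R^-1.
have s0 n : 0 < s n by rewrite invr_gt0.
have Ns n : n.+1%:R * s n = 1 by rewrite mulfV.
pose g t (y : d.-tuple R) := if 0 < sqn y then expR (- (t * v (sqn y))) else 0.
have mg t : measurable_fun setT (g t).
  apply: measurable_fun_ifT; [|exact: measurable_exp_potential|exact: measurable_cst].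
  by apply: measurable_fun_ltr; [exact: measurable_cst|exact: measurable_sqn].
have g01 n y : 0 <= g (s n) y <= 1.
  rewrite /g; case: ifP => [y0|_]; last by rewrite lexx ler01.
  rewrite expR_ge0/= -expR0 ler_expR oppr_le0 mulr_ge0 ?v0//.
  exact: ltW.
have mphi : measurable_fun setT phi by exact: measurable_phi.
have phi0D y : 0 <= phi y <= D by rewrite prof_ge0 HD.
have phix : 0 < phi x by rewrite profE//; exact: prof0_gt0.
pose E n := expect P B (s n) x (g (s n)) phi n.+1.
have EB n : E n <= expR K * (phi x + M * Num.sqrt (s n)).
  have r0 : 0 <= Num.sqrt (s n) by exact: sqrtr_ge0.
  have a0 : 0 <= K * s n by rewrite mulr_ge0// ltW.
  have e0 : 0 <= M * (s n * Num.sqrt (s n)) by rewrite !mulr_ge0// ltW.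
  have H k y : g (s n) y * trans P B (s n) phi k y <=
      (1 + K * s n) * phi y + M * (s n * Num.sqrt (s n)).
    rewrite /g; case: ifP => [y0|_]; last first.
      by rewrite mul0r addr_ge0// mulr_ge0 ?prof_ge0// addr_ge0.
    have := HM (s n) k y (s0 n) y0; rewrite ler_norml => /andP[_].
    rewrite lerBlDr -/(trans P B (s n) phi k y) => h1.
    have h2 := ler_wpM2l (ltW (s0 n)) (HG _ y0).
    rewrite (profE _ _ _ y0); set F := prof0 p b al _ in h1 h2 *.
    have F0 : 0 <= F by exact: expR_ge0.
    have sv : 0 <= s n * v (sqn y) by rewrite mulr_ge0 ?v0// ltW.
    set q := expR _; have q0 : 0 <= q by exact: expR_ge0.
    have q1 : q <= 1 by rewrite -expR0 ler_expR oppr_le0.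
    (* This is exact for every size of sv, so the singularity of the potential causes no error in
       this direction. *)
    have qv : q * (1 + s n * v (sqn y)) <= 1.
      rewrite /q expRN ler_pdivrMl ?expR_gt0// mulr1; exact: expR_ge1Dx.
    have h3 : trans P B (s n) phi k y <=
        (1 + s n * v (sqn y)) * F + (s n * K * F + M * (s n * Num.sqrt (s n))) by lra.
    apply: le_trans (ler_wpM2l q0 h3) _; rewrite mulrDr mulrA.
    have h4 : q * (1 + s n * v (sqn y)) * F <= F by rewrite -[leRHS]mul1r ler_wpM2r.
    have h5 : 0 <= s n * K * F + M * (s n * Num.sqrt (s n)).
      by rewrite addr_ge0// mulr_ge0// mulr_ge0// ltW.
    have := ler_piMl h5 q1; lra.
  have := chain_upper hB (s0 n) x (mg (s n)) (g01 n) mphi phi0D a0 e0 H n.+1.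
  move/le_trans; apply.
  have -> : n.+1%:R * (M * (s n * Num.sqrt (s n))) = M * Num.sqrt (s n).
    by rewrite mulrCA [n.+1%:R * _]mulrA Ns mul1r.
  apply: ler_wpM2r; first by rewrite addr_ge0 ?prof_ge0// mulr_ge0// ltW.
  have -> : expR K = expR (K * s n) ^+ n.+1.
    by rewrite -expRM_natl mulrCA Ns mulr1.
  by apply: lerXn2r; rewrite ?nnegrE ?expR_ge0 ?addr_ge0//; exact: expR_ge1Dx.
(* From rank [N0] on, which depends on [x], the error M sqrt(1/(n+1)) is below phi(x); this is the
   origin of the factor 2. *)
have [N0 HN0] := sqrt_harmonic_lt (divr_gt0 phix M0).
have EB' n : (N0 <= n)%N -> E n <= 2 * expR K * phi x.
  move=> /HN0; rewrite ltr_pdivlMr// mulrC => h; apply: le_trans (EB n) _.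
  by rewrite -mulrA mulrCA; apply: ler_wpM2l; [exact: expR_ge0|rewrite /s; lra].
pose f n w := (m0^-1 * (weight B (s n) x (g (s n)) n.+1 w * phi (walk B (s n) x n.+1 w)))%:E.
have Ipsi n := integrable_weight hB (s n) x (mg (s n)) (g01 n) n.+1 mphi phi0D.
have mf n : measurable_fun setT (f n).
  apply/measurable_EFinP; apply: measurable_funM; first exact: measurable_cst.
  by apply/measurable_EFinP; exact: measurable_int (Ipsi n).
have w0 n k w : 0 <= weight B (s n) x (g (s n)) k w.
  by apply: prodr_ge0 => j _; case/andP: (g01 n (walk B (s n) x j w)).
have f0 n w : (0 <= f n w)%E.
  rewrite lee_fin; apply: mulr_ge0; first by rewrite invr_ge0 ltW.
  by apply: mulr_ge0; [exact: w0|exact: prof_ge0].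
have If n : (\int[P]_w f n w = (m0^-1 * E n)%:E)%E.
  rewrite /E /expect -RintegralZl// /Rintegral fineK//.
  by apply: integrable_fin_num => //; exact: integrable_scale.
apply: (@le_trans _ _ (\int[P]_w limn_einf (f^~ w))%E); last first.
  apply: le_trans (fatou P measurableT mf _) _; first by move=> n w _; exact: f0.
  apply: (@limn_einf_le _ _ _ N0) => n Nn; rewrite If lee_fin.
  by apply: ler_wpM2l; [rewrite invr_ge0 ltW|exact: EB'].
apply: ge0_le_integral_any => w _.
  by rewrite !mule_ge0 ?expeR_ge0// lee_fin.
have liminf0 : (0 <= limn_einf (f^~ w))%E.
  by apply: (@limn_einf_ge _ _ (fun=> 0%E) _ 0%N) => //; exact: cvg_cst.
rewrite [X in (_ * X%:E)%E]indicE.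
case: (boolP (w \in _)) => [/set_mem/= surv|_]; last by rewrite mule0.
rewrite mule1 indicE; case: (boolP (_ \in A)) => [/set_mem Aw|_]; last by rewrite mule0.
rewrite mule1.
have Wpos t : 0 <= t <= 1 -> 0 < sqn (tadd x (B t w)).
  by move=> t01; apply: sqn_gt0; exact: surv.
apply: le_trans (exp_integral_le Wpos vV) _.
set I := Rintegral _ _ _; have [cI _] := path_exp_cvg Wpos.
have W1 n : walk B (s n) x n.+1 w = tadd x (B 1 w) by rewrite /walk Ns.
apply: (@le_trans _ _ (m0^-1 * (expR (- I) * phi (tadd x (B 1 w))))%:E).
  rewrite lee_fin ler_pdivlMl// mulrC; apply: ler_wpM2l; first exact: expR_ge0.
  exact: Am0.
apply: (@limn_einf_ge _ _ (fun n => (m0^-1 * (expR (- (n.+1%:R^-1 * \sum_(j < n.+1)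
    v (sqn (tadd x (B (j%:R * n.+1%:R^-1) w))))) * phi (tadd x (B 1 w))))%:E) _ 0%N).
- apply/fine_cvgP; split; first exact: nearW.
  by apply: cvgM; [exact: cvg_cst|apply: cvgM => //; exact: cvg_cst].
- move=> n _; rewrite /f W1 lee_fin (@weight_exp _ _ (g (s n)) (s n))//.
  by move=> j jn; rewrite /g /walk Wpos// grid.
Qed.

(* The cutoff at level eps kills the discrete weights of paths that come near 0,
   so that their upper limit is controlled by the killed functional. *)
Lemma FK_lower (K D2 : R) : 0 < K -> 0 < D2 ->
  (forall u, 0 < u -> (v u - K) * prof0 p b al u <= Gen u) ->
  (forall u, 0 < u -> prof0 p b al u * v u ^+ 2 <= D2) ->
  exists c : R, 0 < c /\ forall (V : d.-tuple R -> R),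
  (forall y, 0 < sqn y -> 0 <= V y <= v (sqn y)) ->
  forall x, 0 < sqn x ->
  ((c * phi x)%:E <= FKsemigroup P B V 1 x (~` [set origin R d]))%E.
Proof.
move=> K0 D20 HG HD2.
have [M [M0 HM]] := one_step hB theta beta0 kappa0.
have [D [D0 HD]] := prof_bounded p b0 al0.
(* The factor 2 comes from 1 - y >= exp(-2y) for 0 <= y <= 1/2, applied to each step with y = K
   s. *)
pose q0 := expR (- 2 * K); have q0p : 0 < q0 by exact: expR_gt0.
exists (D^-1 * (q0 / 2)); split; first by rewrite mulr_gt0 ?invr_gt0// divr_gt0.
move=> V vV x x0.
pose s n : R := n.+1%:R^-1.
have s0 n : 0 < s n by rewrite invr_gt0.
have s1 n : s n <= 1 by rewrite invf_le1// ler1n.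
have Ns n : n.+1%:R * s n = 1 by rewrite mulfV.
have phix : 0 < phi x by rewrite profE//; exact: prof0_gt0.
have qK : 0 < q0 + K by rewrite addr_gt0.
(* Chosen so that the whole loss due to the cutoff is a quarter of q0 phi(x); the discretization
   error will take at most another quarter. *)
pose eps := q0 * phi x / (4 * (q0 + K)).
have eps0 : 0 < eps by rewrite divr_gt0 ?mulr_gt0.
have epsE : (q0 + K) * eps = q0 * phi x / 4 by rewrite /eps; field; rewrite gt_eqF.
pose g t (y : d.-tuple R) := if eps < phi y then expR (- (t * v (sqn y))) else 0.
(* Lowering phi by the cutoff level makes the test function vanish wherever [g] does, so the
   one-step lower bound holds trivially there. *)
pose f y := Num.max (phi y - eps) 0.
have mphi : measurable_fun setT phi by exact: measurable_phi.
have phipos y : eps < phi y -> 0 < sqn y.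
  move=> ey; rewrite lt_neqAle sqn_ge0 andbT; apply/eqP => y0.
  by move: ey; rewrite -y0 /prof ltxx ltNge ltW.
have mg t : measurable_fun setT (g t).
  apply: measurable_fun_ifT; [|exact: measurable_exp_potential|exact: measurable_cst].
  by apply: measurable_fun_ltr; [exact: measurable_cst|exact: mphi].
have g01 n y : 0 <= g (s n) y <= 1.
  rewrite /g; case: ifPn => [/phipos y0|_]; last by rewrite lexx ler01.
  rewrite expR_ge0/= -expR0 ler_expR oppr_le0 mulr_ge0 ?v0//.
  exact: ltW.
have mf : measurable_fun setT f.
  apply: measurable_maxr; last exact: measurable_cst.
  by apply: measurable_funB; [exact: mphi|exact: measurable_cst].
have f0D y : 0 <= f y <= D.
  rewrite /f le_max lexx orbT/= ge_max (ltW D0) andbT.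
  by rewrite lerBlDr (le_trans (HD _))// lerDl ltW.
have fge y : phi y - eps <= f y by rewrite /f le_max lexx.
pose E n := expect P B (s n) x (g (s n)) f n.+1.
have EB n : K * s n <= 1 / 2 ->
    q0 * (phi x - eps) - (K * eps + (M + D2) * Num.sqrt (s n)) <= E n.
  move=> Ks; have r0 : 0 <= Num.sqrt (s n) by exact: sqrtr_ge0.
  have a0 : 0 <= K * s n by rewrite mulr_ge0// ltW.
  have a01 : 0 <= K * s n <= 1 by rewrite a0/=; lra.
  (* The shift by eps nearly cancels between the two sides of a step: only s K eps remains, so n+1
     steps lose K eps in all and not a multiple of n eps. *)
  pose e := s n * K * eps + (M + D2) * (s n * Num.sqrt (s n)).
  have sr0 : 0 <= s n * Num.sqrt (s n) by rewrite mulr_ge0// ltW.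
  have MD0 : 0 <= M + D2 by rewrite addr_ge0// ltW.
  have e0 : 0 <= e.
    apply: addr_ge0; last exact: mulr_ge0.
    by apply: mulr_ge0; [apply: mulr_ge0|]; exact: ltW.
  have H k y : (1 - K * s n) * f y - e <= g (s n) y * trans P B (s n) f k y.
    have /andP[t0 _] := trans_bound hB (s n) mf f0D k y.
    rewrite /g; case: ifPn => [ey|]; last first.
      rewrite -leNgt => ye; have -> : f y = 0.
        by apply/max_idPr; rewrite subr_le0.
      by rewrite mulr0 mul0r sub0r oppr_le0.
    have y0 := phipos _ ey.
    have := HM (s n) k y (s0 n) y0; rewrite ler_norml => /andP[+ _].
    set Tphi := Rintegral _ _ _ => h1.
    have Tf : Tphi - eps <= trans P B (s n) f k y.
      have mstep : measurable_fun setT (fun w => tadd y (incr B (s n) k w)).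
        by apply: measurable_tadd; [exact: measurable_cst|exact: (measurable_incr hB)].
      have I1 : P.-integrable setT (EFin \o (fun w => phi (tadd y (incr B (s n) k w)))).
        apply: (@integrable_bounded _ _ _ _ _ D); first exact: (measurableT_comp mphi mstep).
        by move=> w; rewrite ger0_norm ?prof_ge0.
      have I2 : P.-integrable setT (EFin \o (fun w => f (tadd y (incr B (s n) k w)))).
        apply: (@integrable_bounded _ _ _ _ _ D); first exact: (measurableT_comp mf mstep).
        by move=> w; case/andP: (f0D (tadd y (incr B (s n) k w))) => ? ?; rewrite ger0_norm.
      have Ie : P.-integrable setT (EFin \o (fun=> eps)) by exact: finite_measure_integrable_cst.
      rewrite -[X in _ - X](Rintegral_cst_prob P) -RintegralB//; apply: le_Rintegral => //.
        exact: (integrableB measurableT I1 Ie).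
    have -> : f y = phi y - eps by apply/max_idPl; rewrite subr_ge0 ltW.
    have h2 := ler_wpM2l (ltW (s0 n)) (HG _ y0).
    rewrite profE// in ey *; set F := prof0 p b al _ in ey h1 h2 *.
    have F0 : 0 <= F by exact: expR_ge0.
    have sv : 0 <= s n * v (sqn y) by rewrite mulr_ge0 ?v0// ltW.
    set q := expR _; have q00 : 0 <= q by exact: expR_ge0.
    have q1 : q <= 1 by rewrite -expR0 ler_expR oppr_le0.
    (* The reverse of the inequality used for the upper estimate; its second-order defect is paid by
       the bound [D2] on phi v^2 together with s^2 <= s sqrt s. *)
    have qv : 1 - (s n * v (sqn y)) ^+ 2 <= q * (1 + s n * v (sqn y)).
      have -> : 1 - (s n * v (sqn y)) ^+ 2 = (1 + - (s n * v (sqn y))) * (1 + s n * v (sqn y)).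
        by ring.
      by apply: ler_wpM2r; [rewrite addr_ge0|exact: expR_ge1Dx].
    have h3 : (1 + s n * v (sqn y)) * F - (s n * K * F + eps + M * (s n * Num.sqrt (s n))) <=
        trans P B (s n) f k y by lra.
    apply: le_trans _ (ler_wpM2l q00 h3); rewrite mulrBr mulrA.
    have h4 := ler_wpM2r F0 qv.
    have h5 : 0 <= s n * K * F + eps + M * (s n * Num.sqrt (s n)).
      apply: addr_ge0; last by apply: mulr_ge0 => //; exact: ltW.
      apply: addr_ge0; last exact: ltW.
      by apply: mulr_ge0 => //; apply: mulr_ge0; exact: ltW.
    have h6 := ler_piMl h5 q1.
    have h7 : (s n * v (sqn y)) ^+ 2 * F <= D2 * (s n * Num.sqrt (s n)).
      have ss : s n ^+ 2 <= s n * Num.sqrt (s n).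
        rewrite expr2; apply: ler_wpM2l; first exact: ltW.
        rewrite -[leLHS]ger0_norm; last exact: ltW.
        by rewrite -sqrtr_sqr ler_wsqrtr// expr2 ler_piMr// ltW.
      rewrite exprMn -mulrA mulrC; apply: ler_pM => //.
      - by rewrite mulr_ge0 ?sqr_ge0.
      - exact: sqr_ge0.
      - by rewrite mulrC; exact: HD2.
    by rewrite /e; lra.
  have := chain_lower hB (s0 n) x (mg (s n)) (g01 n) mf f0D a01 e0 H n.+1.
  apply: le_trans.
  have -> : n.+1%:R * e = K * eps + (M + D2) * Num.sqrt (s n).
    rewrite /e mulrDr [n.+1%:R * (_ * eps)]mulrA [n.+1%:R * (s n * K)]mulrA Ns mul1r.
    by rewrite [n.+1%:R * (_ * _)]mulrCA [n.+1%:R * (_ * _)]mulrA Ns mul1r.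
  rewrite lerD2r; have fx0 : 0 <= f x by case/andP: (f0D x).
  apply: (@le_trans _ _ (q0 * f x)); first by apply: ler_wpM2l; [exact: ltW|exact: fge].
  apply: ler_wpM2r => //.
  have -> : q0 = expR (- 2 * (K * s n)) ^+ n.+1.
    by rewrite -expRM_natl mulrCA [n.+1%:R * _]mulrCA Ns mulr1.
  apply: lerXn2r; rewrite ?nnegrE ?expR_ge0//; first by rewrite subr_ge0; lra.
  set y := K * s n in a0 Ks *.
  rewrite mulNr expRN -[leLHS]mul1r ler_pdivrMr ?expR_gt0//.
  have := expR_ge1Dx (2 * y) => hy.
  apply: (@le_trans _ _ ((1 - y) * (1 + 2 * y))); last by apply: ler_wpM2l => //; lra.
  by nra.
have [N1 HN1] := sqrt_harmonic_lt (divr_gt0 (mulr_gt0 q0p phix)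
  (mulr_gt0 (ltr0Sn R 3) (addr_gt0 M0 D20))).
have [N2 HN2] := harmonic_lt (divr_gt0 (ltr01 : 0 < 1 :> R) (mulr_gt0 (ltr0Sn R 1) K0)).
pose N0 := maxn N1 N2.
have EB' n : (N0 <= n)%N -> q0 * phi x / 2 <= E n.
  rewrite geq_max => /andP[/HN1 h1 /HN2 h2].
  have h3 : K * s n <= 1 / 2.
    by move: h2; rewrite ltr_pdivlMr ?mulr_gt0// -/(s n); lra.
  apply: le_trans _ (EB n h3).
  move: h1; rewrite ltr_pdivlMr ?mulr_gt0 ?addr_gt0// -/(s n) => h1.
  by move: epsE; lra.
(* Division by [D] places psi in [0,1], so Fatou's lemma can be applied to 1 - psi; this gives the
   inequality for the upper limit [m] of psi. *)
pose psi n w := D^-1 * (weight B (s n) x (g (s n)) n.+1 w * f (walk B (s n) x n.+1 w)).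
have Ipsi n := integrable_weight hB (s n) x (mg (s n)) (g01 n) n.+1 mf f0D.
have mpsi n : measurable_fun setT (psi n).
  apply: measurable_funM; first exact: measurable_cst.
  by apply/measurable_EFinP; exact: measurable_int (Ipsi n).
have w01 n k w : 0 <= weight B (s n) x (g (s n)) k w <= 1 by exact: (weight01 B (s n) x (g01 n) k w).
have psi01 n w : 0 <= psi n w <= 1.
  have /andP[a1 a2] := w01 n n.+1 w; have /andP[a3 a4] := f0D (walk B (s n) x n.+1 w).
  rewrite mulr_ge0 ?invr_ge0 ?(ltW D0) ?mulr_ge0//= ler_pdivrMl// mulr1.
  by rewrite (le_trans _ a4)// ler_piMl.
pose m w := limn_esup (fun n => (psi n w)%:E).
have mm : measurable_fun setT m.
  by apply: measurable_fun_limn_esup => n; exact/measurable_EFinP.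
have dualE w : limn_einf (fun n => (1 - psi n w)%:E) = (1 - m w)%E.
  by rewrite /m -limn_einfN -limn_einf_shift.
have m0 w : (0 <= m w)%E.
  apply: le_trans _ (limn_einf_sup _).
  apply: (@limn_einf_ge _ _ (fun=> 0%E) _ 0%N); first exact: cvg_cst.
  by move=> n _; rewrite lee_fin; case/andP: (psi01 n w).
have m1 w : (m w <= 1)%E.
  apply: (@limn_esup_le _ _ (fun=> 1%E) _ 0%N); first exact: cvg_cst.
  by move=> n _; rewrite lee_fin; case/andP: (psi01 n w).
have mfin w : m w \is a fin_num.
  by rewrite ge0_fin_numE// (le_lt_trans (m1 w))// ltry.
have d0 w : (0 <= 1 - m w)%E by rewrite sube_ge0 ?m1 ?mfin ?orbT.
have md : measurable_fun setT (fun w => 1 - m w)%E.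
  by apply: emeasurable_funB => //; exact: measurable_cst.
have Id : (\int[P]_w (1 - m w) <= (1 - D^-1 * (q0 / 2) * phi x)%:E)%E.
  under eq_integral do rewrite -dualE.
  apply: le_trans (fatou P measurableT _ _) _.
  - by move=> n; apply/measurable_EFinP; apply: measurable_funB.
  - by move=> n w _; rewrite lee_fin subr_ge0; case/andP: (psi01 n w).
  apply: (@limn_einf_le _ _ _ N0) => n Nn.
  have Ip : P.-integrable setT (EFin \o psi n) by exact: integrable_scale.
  have I1 : P.-integrable setT (EFin \o (fun=> 1 : R)) by exact: finite_measure_integrable_cst.
  have -> : (\int[P]_w (1 - psi n w)%:E = (1 - D^-1 * E n)%:E)%E.
    rewrite /E /expect -RintegralZl// -[X in (X - _)%:E](Rintegral_cst_prob P).
    rewrite -RintegralB// /Rintegral fineK//.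
    by apply: integrable_fin_num => //; exact: (integrableB measurableT I1 Ip).
  rewrite lee_fin lerD2l lerN2 -mulrA; apply: ler_wpM2l; first by rewrite invr_ge0 ltW.
  by have := EB' n Nn; lra.
have Im : ((D^-1 * (q0 / 2) * phi x)%:E <= \int[P]_w m w)%E.
  have : (1%:E = \int[P]_w (1 - m w) + \int[P]_w m w)%E.
    rewrite -ge0_integralD// -[LHS](probability_setT P) -[LHS]mul1e -integral_cst//.
    by apply: eq_integral => w _; rewrite subeK.
  have := integral_ge0 P (D := setT) (fun w _ => m0 w).
  case: (\int[P]_w m w)%E => [r| |]; [|by move=> _ _; exact: leey|by []].
  move=> _ h1; have := Id.
  have : ((\int[P]_w (1 - m w)) = (1 - r)%:E)%E.
    by move: h1; set I1 := (\int[P]_w (1 - m w))%E => h1; rewrite EFinB h1 addeK.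
  by move=> ->; rewrite !lee_fin; lra.
apply: le_trans Im _; apply: ge0_le_integral_any => w _ //.
have fk0 : (0 <= (expeR (- \int[leb]_(t in `[0%R, 1%R]%classic) (V (tadd x (B t w)))%:E) *
   (\1_(~` [set origin R d]) (tadd x (B 1 w)))%:E *
   (\1_[set w' | forall t, 0 <= t <= 1 -> tadd x (B t w') <> origin R d] w)%:E))%E.
  by rewrite !mule_ge0 ?expeR_ge0// lee_fin.
have W1 n : walk B (s n) x n.+1 w = tadd x (B 1 w) by rewrite /walk Ns.
(* If phi falls below eps at some t0, then by continuity it is still below at the grid time just
   before t0 for large n, and psi vanishes. Otherwise the path stays away from the origin and the
   discrete weights are compared with the exponential. *)
have [[t0 [t01 ht0]]|nohit] := pselect (exists t, 0 <= t <= 1 /\ phi (tadd x (B t w)) < eps).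
  apply: le_trans _ fk0.
  have cphi : {within `[0, 1], continuous (fun t => phi (tadd x (B t w)))}.
    apply/subspace_continuousP => t tt.
    apply: (@continuous_cvg _ _ _ _ _ (fun t => sqn (tadd x (B t w))) (prof p b al)).
      exact: continuous_prof.
    by move: (@path_continuous x w) => /subspace_continuousP; exact.
  have t0in : [set` `[(0:R), 1]] t0 by rewrite /= in_itv.
  move/subspace_continuousP : cphi => /(_ t0 t0in)/cvgr_lt/(_ _ ht0).
  rewrite near_withinE => /nbhs_ballP[eta /= eta0 Heta].
  have [N3 HN3] := harmonic_lt eta0.
  apply: (@limn_esup_le _ _ (fun=> 0%E) _ N3); first exact: cvg_cst.
  move=> n /HN3 hn; rewrite lee_fin.
  have /andP[u0 u1] := t01.
  have tn0 : 0 <= t0 * n.+1%:R by rewrite mulr_ge0.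
  have /andP[l1 l2] := truncn_itv tn0; set j := Num.truncn _ in l1 l2.
  have jle : (j <= n.+1)%N.
    by rewrite -(ler_nat R) (le_trans l1)// ler_piMl.
  have j1 : j%:R * s n <= t0 by rewrite /s ler_pdivrMr.
  have j2 : t0 < j%:R * s n + s n.
    by rewrite -[X in _ + X]mul1r -mulrDl natr1 /s ltr_pdivlMr.
  have small : phi (walk B (s n) x j w) < eps.
    rewrite /walk; apply: Heta.
      by rewrite /ball/= ger0_norm ?subr_ge0// ltrBlDl (lt_trans j2)// ltrD2l.
    by rewrite /= in_itv/= mulr_ge0//= ?(ltW (s0 n))// (le_trans j1).
  (* The weight covers the indices j < n+1 only; when t0 = 1 the grid time is the final one, and the
     vanishing comes from [f] instead. *)
  rewrite /psi; move: jle; rewrite leq_eqVlt => /predU1P[je|jn].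
    have -> : f (walk B (s n) x n.+1 w) = 0.
      by apply/max_idPr; rewrite subr_le0 -je ltW.
    by rewrite !mulr0.
  have gj : g (s n) (walk B (s n) x j w) = 0.
    by rewrite /g ifN// -leNgt ltW.
  have -> : weight B (s n) x (g (s n)) n.+1 w = 0.
    by rewrite /weight (bigD1 (Ordinal jn) isT) /= gj mul0r.
  by rewrite mul0r mulr0.
have Wpos t : 0 <= t <= 1 -> 0 < sqn (tadd x (B t w)).
  move=> t01; rewrite lt_neqAle sqn_ge0 andbT; apply/eqP => u0.
  by apply: nohit; exists t; split => //; rewrite -u0 /prof ltxx.
have alive t : 0 <= t <= 1 -> tadd x (B t w) <> origin R d.
  by move=> /Wpos h e; move: h; rewrite e sqn_origin ltxx.
rewrite indicE mem_set; last by apply: alive; rewrite ler01 lexx.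
rewrite indicE mem_set// !mule1.
apply: le_trans _ (exp_integral_ge Wpos vV).
have [cI _] := path_exp_cvg Wpos; set I := Rintegral _ _ _ in cI *.
apply: (@limn_esup_le _ _ (fun n => (expR (- (n.+1%:R^-1 * \sum_(j < n.+1)
    v (sqn (tadd x (B (j%:R * n.+1%:R^-1) w))))))%:E) _ 0%N).
  by apply/fine_cvgP; split; first exact: nearW.
move=> n _; rewrite lee_fin /psi.
have /andP[a3 a4] := f0D (walk B (s n) x n.+1 w).
have wle : weight B (s n) x (g (s n)) n.+1 w <= expR (- (n.+1%:R^-1 * \sum_(j < n.+1)
    v (sqn (tadd x (B (j%:R * n.+1%:R^-1) w))))).
  rewrite mulr_sumr -sumrN expR_sum; apply: ler_prod => j _.
  have /andP[-> _] := g01 n (walk B (s n) x j w).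
  by rewrite /g /=; case: ifP => // _; exact: expR_ge0.
rewrite ler_pdivrMl// mulrC; apply: ler_pM => //.
by case/andP: (w01 n n.+1 w).
Qed.

End FeynmanKac.

(** * The kernel bound at time 1 against the test function *)

Section Comparison.
Context (R : realType) (d : nat).
Hypothesis d0 : (0 < d)%N.
Variables (beta kappa : R).
Hypotheses (beta0 : 0 < beta) (kappa0 : 0 < kappa).
Notation b := (Num.sqrt kappa / beta).
Notation al := (beta / 2).
Notation Xp := (Xp al).
Implicit Types (x y : d.-tuple R) (u : R).

Let b0 : 0 < b. Proof. by rewrite divr_gt0// sqrtr_gt0. Qed.
Let al0 : 0 < al. Proof. by rewrite divr_gt0. Qed.
Let dR : 0 < d%:R :> R. Proof. by rewrite ltr0n. Qed.

(** A point of squared norm u with equal, positive coordinates; for d = 1 it lies on the same side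
    of 0 as [box]. *)
Definition diag u : d.-tuple R := [tuple Num.sqrt (u / d%:R) | _ < d].

Lemma sqn_diag u : 0 < u -> sqn (diag u) = u.
Proof.
move=> u0; rewrite /sqn; under eq_bigr do rewrite tnth_mktuple.
rewrite sumr_const card_ord sqr_sqrtr; last by rewrite divr_ge0 ?ltW.
by rewrite -[LHS]mulr_natr divfK// gt_eqF.
Qed.

Lemma sqn_gt0_neq x : 0 < sqn x -> x <> origin R d.
Proof. by move=> h e; move: h; rewrite e sqn_origin ltxx. Qed.

Lemma enormE x : enorm x = Num.sqrt (sqn x). Proof. by []. Qed.

Lemma enorm_le1 x : (enorm x <= 1) = (sqn x <= 1).
Proof. by rewrite enormE -[X in (_ <= X) = _]sqrtr1 ler_sqrt. Qed.

Lemma ln_sqrt u : 0 < u -> ln (Num.sqrt u) = ln u / 2.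
Proof.
move=> u0; have s0 : 0 < Num.sqrt u by rewrite sqrtr_gt0.
have {2}-> : u = Num.sqrt u ^+ 2 by rewrite sqr_sqrtr// ltW.
by rewrite lnXn//; field.
Qed.

Lemma powR_sqrt u (e : R) : 0 < u -> Num.sqrt u `^ e = expR (e / 2 * ln u).
Proof.
move=> u0; rewrite /powR gt_eqF ?sqrtr_gt0// ln_sqrt//.
by congr expR; ring.
Qed.

Lemma invE u : 0 < u -> u^-1 = expR (- ln u).
Proof. by move=> u0; rewrite expRN lnK. Qed.

Lemma potential2 x : 0 < sqn x ->
  kappa / enorm x `^ (2 + 2 * beta) = kappa * ((sqn x)^-1 * Xp (sqn x) ^+ 2).
Proof.
move=> u0; rewrite enormE powR_sqrt// -expRN (Xp_expR al u0) (invE u0) -expRM_natl -expRD.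
by congr (_ * expR _); field.
Qed.

Lemma potential1 (C : R) x : 0 < sqn x ->
  C / enorm x `^ (2 + beta) = C * ((sqn x)^-1 * Xp (sqn x)).
Proof.
move=> u0; rewrite enormE powR_sqrt// -expRN (Xp_expR al u0) (invE u0) -expRD.
by congr (_ * expR _); field.
Qed.

Lemma hbk_gt0 r : 0 < r -> 0 < hbk d beta kappa r.
Proof. by move=> r0; rewrite mulr_gt0 ?expR_gt0// powR_gt0// lt_min r0 ltr01. Qed.

(** Isolates the factor |x|^(2 theta) that separates phi from h; the remaining power of 1 + |x|^2 is
    bounded on the unit ball by [ln1D_bound]. *)
Lemma prof_hbk theta x : 0 < sqn x -> sqn x <= 1 ->
  prof0 (prof_exp d beta theta) b al (sqn x) = hbk d beta kappa (enorm x) *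
    expR (theta * ln (sqn x) - prof_exp d beta theta * ln (1 + sqn x)).
Proof.
move=> u0 u1; have e1 : Num.min (enorm x) 1 = enorm x by apply/min_idPl; rewrite enorm_le1.
rewrite /hbk e1 enormE !powR_sqrt// /prof0 /logprof -!expRD; congr expR.
have -> : Num.sqrt kappa / (beta * expR (beta / 2 * ln (sqn x))) = b * Xp (sqn x).
  by rewrite invfM Xp_expR// mulNr expRN mulrA.
by rewrite /prof_exp; field; rewrite gt_eqF.
Qed.

Lemma ln1D_bound u (q : R) : 0 < u <= 1 -> - (`|q| * ln 2) <= q * ln (1 + u) <= `|q| * ln 2.
Proof.
move=> /andP[u0 u1]; rewrite -ler_norml normrM.
have l0 : 0 <= ln (1 + u) by rewrite ln_ge0// lerDl ltW.
rewrite (ger0_norm l0); apply: ler_wpM2l => //.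
by rewrite ler_ln ?posrE ?addr_gt0//; lra.
Qed.

(** From |y|^2 <= 2|x|^2 + 2|x-y|^2: at the price of doubling the time, the kernel is dominated by
    one centred at the origin, whose mass in y does not depend on x. *)
Lemma qker_gauss_le (t : R) x y : 0 < t -> sqn x <= 1 ->
  qker t x y <= ((4 * pi * t) `^ (- (d%:R / 2)) / (4 * pi * (2 * t)) `^ (- (d%:R / 2)) *
    expR (1 / (4 * t))) * qker (2 * t) (origin R d) y.
Proof.
move=> t0 x1; rewrite /qker.
have P1 : 0 < (4 * pi * t) `^ (- (d%:R / 2)) by rewrite powR_gt0// !mulr_gt0// pi_gt0.
have P2 : 0 < (4 * pi * (2 * t)) `^ (- (d%:R / 2)) by rewrite powR_gt0// !mulr_gt0// pi_gt0.
move: (_ `^ _) (_ `^ _) P1 P2 => Q1 Q2 Q10 Q20.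
rewrite mulrACA divfK ?gt_eqF// -expRD; apply: ler_wpM2l; first exact: ltW.
rewrite ler_expR !enorm_sqr.
have E : sqn (tsub (origin R d) y) = sqn y.
  by apply: eq_bigr => i _; rewrite !tnth_mktuple sub0r sqrrN.
have S : sqn y <= 2 * sqn x + 2 * sqn (tsub x y).
  rewrite /sqn !mulr_sumr -big_split/=; apply: ler_sum => i _; rewrite tnth_mktuple.
  by have := sqr_ge0 (2 * tnth x i - tnth y i); lra.
rewrite E -(ler_pM2l (mulr_gt0 (ltr0Sn R 7) t0)).
have -> : 8 * t * (- sqn (tsub x y) / (4 * t)) = - 2 * sqn (tsub x y) by field; rewrite gt_eqF.
have -> : 8 * t * (1 / (4 * t) + - sqn y / (4 * (2 * t))) = 2 - sqn y by field; rewrite gt_eqF.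
lra.
Qed.

Lemma intRd_qker (c t : R) : 0 <= c -> 0 < t ->
  (intRd (fun y : d.-tuple R => (c * qker t (origin R d) y)%:E) = c%:E)%E.
Proof.
move=> c0 t0.
transitivity (intRd (fun y : d.-tuple R =>
    (c * \prod_(i < d) normal_pdf 0 (Num.sqrt (2 * t)) (tnth y i))%:E)).
  by apply: eq_intRd => y; rewrite qker_prod.
rewrite (@intRd_prod _ _ c (fun=> normal_pdf 0 (Num.sqrt (2 * t))))//.
- by rewrite big1 ?mule1// => i _; exact: integral_normal_pdf.
- by move=> _; exact: measurable_normal_pdf.
- by move=> _ y; exact: normal_pdf_ge0.
Qed.

(** A cube of unit volume, away from the origin and with positive coordinates, on which every factor
    depending on y is bounded below. *)
Definition box : set (d.-tuple R) := [set y | forall i, 1 <= tnth y i <= 2].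

Lemma intRd_box (c : R) : 0 <= c ->
  (intRd (fun y : d.-tuple R => (c * \1_box y)%:E) = c%:E)%E.
Proof.
move=> c0.
transitivity (intRd (fun y : d.-tuple R =>
    (c * \prod_(i < d) (\1_[set` `[(1 : R), 2]] (tnth y i) : R))%:E)).
  apply: eq_intRd => y; congr (c * _)%:E; rewrite indicE.
  case: (boolP (y \in _)) => [/set_mem yb|/negP nyb].
    by rewrite big1// => i _; rewrite indicE mem_set//= in_itv/=; exact: yb.
  have [i ni] : exists i, ~ (1 <= tnth y i <= 2).
    by apply/existsNP => h; apply: nyb; exact: mem_set.
  by rewrite (bigD1 i)//= indicE memNset ?mul0r//= in_itv.
rewrite (@intRd_prod _ _ c (fun=> \1_[set` `[(1 : R), 2]]))//.
rewrite big1 ?mule1// => i _; rewrite integral_indic// setIT [LHS]lebesgue_measure_itv/=.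
rewrite lte_fin ifT; last by lra.
by rewrite -EFinD; congr EFin; lra.
Qed.

Lemma box_sqn y : box y -> 1 <= sqn y <= 4 * d%:R.
Proof.
move=> yb; apply/andP; split.
  rewrite /sqn (bigD1 (Ordinal d0))//=; have /andP[h _] := yb (Ordinal d0).
  apply: le_trans (_ : 1 <= tnth y (Ordinal d0) ^+ 2) _; first by nra.
  by rewrite lerDl; apply: sumr_ge0 => i _; exact: sqr_ge0.
apply: (@le_trans _ _ (\sum_(i < d) (4 : R))); last by rewrite sumr_const card_ord mulr_natr.
by apply: ler_sum => i _; have /andP[h1 h2] := yb i; nra.
Qed.

Lemma prof_box theta y : box y ->
  expR (- (`|prof_exp d beta theta| * ln 2 + b)) <=
  prof (prof_exp d beta theta) b al (sqn y).
Proof.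
move=> /box_sqn/andP[y1 _]; have u0 : 0 < sqn y by lra.
set p := prof_exp d beta theta.
rewrite profE// ler_expR /logprof -mulrBr.
have X1 : Xp (sqn y) <= 1.
  rewrite Xp_expR// -[leRHS]expR0 ler_expR mulNr oppr_le0.
  by apply: mulr_ge0; [exact: (ltW al0)|exact: ln_ge0].
have bX : b * Xp (sqn y) <= b by rewrite ler_piMr// ltW.
have l1 : ln (sqn y) <= ln (1 + sqn y) by rewrite ler_ln ?posrE ?addr_gt0// lerDr.
have l2 : ln (1 + sqn y) <= ln 2 + ln (sqn y).
  by rewrite -lnM ?posrE// ler_ln ?posrE ?addr_gt0 ?mulr_gt0//; lra.
have : `|p * (ln (sqn y) - ln (1 + sqn y))| <= `|p| * ln 2.
  by rewrite normrM ler_wpM2l// ler_norml; lra.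
by rewrite ler_norml => /andP[h _]; lra.
Qed.

Lemma powR_ge1 (m e : R) : 1 <= m -> 0 <= e -> 1 <= m `^ e.
Proof.
move=> m1 e0; have m0 : 0 < m by lra.
by rewrite /powR gt_eqF// -expR0 ler_expR mulr_ge0// ln_ge0.
Qed.

(** The denominator in [bound_expr] at t = 1: a fixed positive number. *)
Definition hst : R := hbk d beta kappa (eta1 beta kappa * 1 `^ (2 + beta)^-1).

Lemma hst_gt0 : 0 < hst.
Proof.
have bb : 0 < 2 + beta by rewrite addr_gt0.
apply: hbk_gt0; rewrite mulr_gt0 ?powR_gt0// /eta1 /eta0 mulr_gt0 ?powR_gt0//.
by rewrite mulr_gt0 ?sqrtr_gt0// mulr_gt0 ?powR_gt0.
Qed.

(** Only the factor in x and the Gaussian are kept; the factor in y and the exponential are at most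
    1. *)
Lemma bound_expr_upper (c2 c3 : R) : 0 < c2 -> 0 < c3 -> exists Q : R, 0 < Q /\
  forall x y, 0 < sqn x <= 1 -> 0 < sqn y ->
  bound_expr beta kappa c2 c3 1 x y <=
    Q * hbk d beta kappa (enorm x) * qker (2 * c3) (origin R d) y.
Proof.
move=> c20 c30; have H0 := hst_gt0.
pose G := (4 * pi * c3) `^ (- (d%:R / 2)) / (4 * pi * (2 * c3)) `^ (- (d%:R / 2)) *
    expR (1 / (4 * c3)).
have G0 : 0 < G.
  by rewrite mulr_gt0 ?expR_gt0// divr_gt0// powR_gt0// !mulr_gt0// pi_gt0.
exists (G / hst); split; first exact: divr_gt0.
move=> x y /andP[x0 x1] y0; rewrite /bound_expr -/hst.
move: hst H0 => S H0.
have hx : 0 < hbk d beta kappa (enorm x) by apply: hbk_gt0; rewrite enormE sqrtr_gt0.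
have hy : 0 < hbk d beta kappa (enorm y) by apply: hbk_gt0; rewrite enormE sqrtr_gt0.
set hX := hbk d beta kappa (enorm x) in hx *; set hY := hbk d beta kappa (enorm y) in hy *; clearbody hX hY.
have r1 : 0 <= hX / S by exact: (divr_ge0 (ltW hx) (ltW H0)).
have r2 : 0 <= hY / S by exact: (divr_ge0 (ltW hy) (ltW H0)).
have min01 (r : R) : 0 <= r -> 0 <= Num.min 1 r by move=> r0; rewrite le_min ler01.
have a10 := min01 _ r1; have a20 := min01 _ r2.
have a11 : Num.min 1 (hX / S) <= hX / S by rewrite ge_min lexx orbT.
have a21 : Num.min 1 (hY / S) <= 1 by rewrite ge_min lexx.
set a1 := Num.min 1 (hX / S) in a10 a11 *; set a2 := Num.min 1 (hY / S) in a20 a21 *.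
clearbody a1 a2.
set e := expR _.
have e1 : 0 <= e <= 1.
  rewrite expR_ge0/= -expR0 ler_expR oppr_le0 divr_ge0 ?powR_ge0// mulr_ge0//.
  exact: ltW.
have q0 : 0 <= qker (c3 * 1) x y by rewrite mulr_ge0 ?powR_ge0 ?expR_ge0.
have q1 : qker (c3 * 1) x y <= G * qker (2 * c3) (origin R d) y.
  by rewrite mulr1; exact: qker_gauss_le.
case/andP: e1 => e0 e1.
have h1 : a1 * a2 * e <= hX / S.
  apply: le_trans a11; rewrite -[leRHS]mulr1 -mulrA; apply: ler_wpM2l => //.
  by rewrite mulr_ile1.
apply: (@le_trans _ _ (hX / S * (G * qker (2 * c3) (origin R d) y))).
  by apply: ler_pM => //; rewrite !mulr_ge0.
by rewrite le_eqVlt; apply/orP; left; apply/eqP; ring.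
Qed.

(** For y in the box h(|y|) = h(1) because h is constant beyond 1, the maximum in the exponential is
    at least 1, and |x-y|^2 <= 2|x|^2 + 2|y|^2 <= 2 + 8d. *)
Lemma bound_expr_lower (c5 c6 : R) : 0 < c5 -> 0 < c6 -> exists Q : R, 0 < Q /\
  forall x y, 0 < sqn x <= 1 -> box y ->
  Q * Num.min 1 (hbk d beta kappa (enorm x) / hst) <= bound_expr beta kappa c5 c6 1 x y.
Proof.
move=> c50 c60; rewrite /bound_expr -/hst; have := hst_gt0; move: hst => S H0.
have [h1 [h10 hyE]] : exists h1, 0 < h1 /\
    forall y, 1 <= enorm y -> hbk d beta kappa (enorm y) = h1.
  exists (hbk d beta kappa 1); split; first exact: hbk_gt0.
  by move=> y ey; rewrite /hbk minxx (min_idPr ey).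
have [m [m0 mE]] : exists m, 0 < m /\ m = Num.min 1 (h1 / S).
  by exists (Num.min 1 (h1 / S)); rewrite lt_min ltr01 divr_gt0.
have [G [G0 GE]] : exists G, 0 < G /\
    G = (4 * pi * c6) `^ (- (d%:R / 2)) * expR (- (2 + 8 * d%:R) / (4 * c6)).
  exists ((4 * pi * c6) `^ (- (d%:R / 2)) * expR (- (2 + 8 * d%:R) / (4 * c6))).
  by rewrite mulr_gt0 ?expR_gt0// powR_gt0// !mulr_gt0// pi_gt0.
exists (m * expR (- c5) * G); split.
  by apply: mulr_gt0 => //; apply: mulr_gt0 => //; exact: expR_gt0.
move=> x y /andP[x0 x1] yb; have /andP[y1 y4] := box_sqn yb.
have ey : 1 <= enorm y by rewrite enormE -sqrtr1 ler_wsqrtr.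
rewrite (hyE _ ey) -mE !mulr1.
set a := Num.min 1 (_ / S); have a0 : 0 <= a.
  rewrite le_min ler01/=; apply: (divr_ge0 _ (ltW H0)).
  by apply/ltW/hbk_gt0; rewrite enormE sqrtr_gt0.
clearbody a.
set e := expR (- (c5 / _)).
have e1 : expR (- c5) <= e.
  rewrite ler_expR lerN2 ler_pdivrMr; last first.
    by rewrite powR_gt0// !lt_max (lt_le_trans ltr01 ey) orbT.
  apply: ler_peMr; first exact: ltW.
  by apply: powR_ge1; [rewrite !le_max ey orbT|rewrite addr_ge0 ?mulr_ge0// ltW].
have q1 : G <= qker c6 x y.
  rewrite GE /qker; apply: ler_wpM2l; first exact: powR_ge0.
  rewrite ler_expR enorm_sqr; apply: ler_wpM2r; first by rewrite invr_ge0 mulr_ge0// ltW.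
  rewrite lerN2.
  have : sqn (tsub x y) <= 2 * sqn x + 2 * sqn y.
    rewrite /sqn !mulr_sumr -big_split/=; apply: ler_sum => i _; rewrite tnth_mktuple.
    by have := sqr_ge0 (tnth x i + tnth y i); lra.
  lra.
have -> : m * expR (- c5) * G * a = a * m * (expR (- c5) * G) by ring.
rewrite -[a * m * e * _]mulrA; apply: ler_wpM2l; first by rewrite mulr_ge0// ltW.
exact: (ler_pM (expR_ge0 _) (ltW G0) e1 q1).
Qed.

End Comparison.

Section PowerPotential.
Context (R : realType).
Variables (beta k c k0 : R).
Notation Xp := (Xp (beta / 2)).

(** The inverse is written as a real power so that measurability and differentiability both come
    from the rules for powers. *)
Definition pot (u : R) : R := k * (u `^ (-1) * (Xp u * Xp u)) + c * (u `^ (-1) * Xp u) + k0.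

Lemma potE u : 0 < u -> pot u = k * (u^-1 * Xp u ^+ 2) + c * (u^-1 * Xp u) + k0.
Proof. by move=> u0; rewrite /pot powR_inv1 ?ltW// expr2. Qed.

Lemma measurable_pot : measurable_fun setT pot.
Proof.
have mX : measurable_fun setT Xp by exact: measurable_powR.
have mA : measurable_fun setT (fun u : R => u `^ (-1)) by exact: measurable_powR.
apply: measurable_funD; last exact: measurable_cst.
by apply: measurable_funD; apply: measurable_funM; try exact: measurable_cst;
  apply: measurable_funM => //; exact: measurable_funM.
Qed.

Lemma continuous_pot (u : R) : 0 < u -> {for u, continuous pot}.
Proof.
move=> u0; have dA := is_derive1_powR (-1) u0; have dX := is_derive1_powR (- (beta / 2)) u0.
exact: (isder_continuous (isder_add (isder_add
  (isder_scale k (isder_mul dA (isder_mul dX dX))) (isder_scale c (isder_mul dA dX)))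
  (isder_cst k0 u))).
Qed.

End PowerPotential.

(** * The two contradictions *)

Section Halves.
Context (R : realType) (d : nat) (dO : measure_display) (Omega : measurableType dO).
Hypothesis hd : (0 < d)%N.
Variables (P : probability Omega R) (B : R -> Omega -> d.-tuple R).
Hypothesis hB : is_BM P B.
Variables (V : d.-tuple R -> R) (hV : potential_assumptions V).
Variables (p : R -> d.-tuple R -> d.-tuple R -> R) (hp : is_trans_density P B V p).
Variables (beta kappa : R) (beta0 : 0 < beta) (kappa0 : 0 < kappa).
Notation b := (Num.sqrt kappa / beta).
Notation al := (beta / 2).
Notation Xp := (Xp al).

Let b0 : 0 < b. Proof. by rewrite divr_gt0// sqrtr_gt0. Qed.
Let al0 : 0 < al. Proof. by rewrite divr_gt0. Qed.
Let rk0 : 0 < Num.sqrt kappa. Proof. by rewrite sqrtr_gt0. Qed.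

Let inv_le1 (u : R) : 1 <= u -> 0 < u^-1 <= 1.
Proof. by move=> u1; rewrite invr_gt0 invf_le1 ?(lt_le_trans ltr01 u1)//= u1. Qed.

Let Xp_le1 (u : R) : 1 <= u -> 0 < Xp u <= 1.
Proof.
move=> u1; have u0 : 0 < u := lt_le_trans ltr01 u1.
rewrite (Xp_gt0 _ u0)/= (Xp_expR _ u0) -[leRHS]expR0 ler_expR mulNr oppr_le0.
by apply: mulr_ge0; [exact: (ltW al0)|exact: ln_ge0].
Qed.

Let enorm_ge1 (y : d.-tuple R) : 1 <= sqn y -> 1 <= enorm y.
Proof. by move=> y1; rewrite enormE -[leLHS]sqrtr1 ler_wsqrtr. Qed.

Lemma no_upper_bound :
  (exists C : R, 0 < C /\ forall x, x <> origin R d -> enorm x <= 1 ->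
     V x <= kappa / powR (enorm x) (2 + 2 * beta) - C / powR (enorm x) (2 + beta)) ->
  ~ (exists c1 c2 c3 : R, [/\ 0 < c1, 0 < c2, 0 < c3 &
      forall t x y, 0 < t <= 1 -> x <> origin R d -> y <> origin R d ->
        p t x y <= c1 * bound_expr beta kappa c2 c3 t x y]).
Proof.
move=> [C [C0 HC]] [c1 [c2 [c3 [c10 c20 c30 Hp]]]].
case: hV => _ V0 _ [M0 HM0] _.
pose M := `|M0|; have M00 : 0 <= M by exact: normr_ge0.
(* Half of the correction [C] goes into theta and half into the tolerance of [generator_bound];
   together they match -C/|x|^(2+beta) in the bound on V. *)
have [theta [theta0 th]] : exists theta, theta < 0 /\ 4 * Num.sqrt kappa * theta = - (C / 2).
  exists (- (C / (8 * Num.sqrt kappa))); split; last by field; rewrite gt_eqF.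
  by rewrite oppr_lt0 divr_gt0// mulr_gt0.
set pe := prof_exp d beta theta.
have C20 : 0 < C / 2 by rewrite divr_gt0.
have [K [K0 HK]] := @generator_bound R d beta kappa theta beta0 kappa0 (C / 2) C20.
(* Outside the unit ball the middle term is at least -C, so the constant M + C keeps v above the
   bound M on V there. *)
pose v := pot beta kappa (- C) (M + C).
have MC0 : 0 <= M + C by rewrite addr_ge0// ltW.
have vV y : 0 < sqn y -> 0 <= V y <= v (sqn y).
  move=> y0; have yn := sqn_gt0_neq y0; rewrite V0//= /v potE//.
  have [y1|y1] := leP (sqn y) 1.
    have := HC y yn; rewrite enorm_le1 => /(_ y1).
    by rewrite (potential2 _ _ y0) (potential1 _ _ y0); lra.
  have := HM0 y (enorm_ge1 (ltW y1)); have := ler_norm M0; rewrite -/M.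
  have /andP[a0 a1] := inv_le1 (ltW y1); have /andP[X0 X1] := Xp_le1 (ltW y1).
  have aX1 : (sqn y)^-1 * Xp (sqn y) <= 1 by rewrite mulr_ile1// ltW.
  have aX2 : 0 <= kappa * ((sqn y)^-1 * Xp (sqn y) ^+ 2).
    by apply: mulr_ge0; [exact: ltW|apply: mulr_ge0; [exact: ltW|exact: sqr_ge0]].
  have := ler_wpM2l (ltW C0) aX1; rewrite mulr1 mulNr; lra.
(* Inherited from 0 <= V <= v, since every u > 0 is the squared norm of some point. *)
have v0 u : 0 < u -> 0 <= v u.
  move=> u0; have := vV (diag d u); rewrite (sqn_diag hd u0) => /(_ u0)/andP[].
  exact: le_trans.
have [D2 [D20 HD2]] := @prof_potential_bound R pe b al b0 al0 kappa (M + C) (ltW kappa0) MC0.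
have KK : 0 < K + (M + C) by lra.
have HG u : 0 < u -> (v u - (K + (M + C))) * prof0 pe b al u <=
    generator d beta kappa theta u.
  move=> u0; have := HK u u0; rewrite th -/pe ler_norml => /andP[+ _].
  rewrite /v potE//; move: (u^-1 * Xp u) (u^-1 * Xp u ^+ 2) (prof0 _ _ _ u) => w1 w2 F.
  lra.
have HD u : 0 < u -> prof0 pe b al u * v u ^+ 2 <= D2.
  move=> u0; apply: HD2 => //; rewrite v0//= /v potE//.
  have X0 := ltW (Xp_gt0 al u0).
  have : 0 <= C * (u^-1 * Xp u) by rewrite !mulr_ge0// ?ltW// invr_gt0.
  by rewrite mulNr; lra.
have [c [c0 Hc]] := @FK_lower R d dO Omega P B hB beta kappa theta beta0 kappa0 v
  (measurable_pot _ _ _ _) v0 (@continuous_pot R beta kappa (- C) (M + C))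
  (K + (M + C)) D2 KK D20 HG HD.
have [Q [Q0 HQ]] := bound_expr_upper d beta0 kappa0 c20 c30.
have mA : measurable (~` [set origin R d]).
  apply: measurableC.
  rewrite (_ : [set origin R d] = [set y | forall i, [set 0 : R] (tnth y i)]).
    by apply: (measurable_cylinder (C := fun=> [set 0 : R])) => i; exact: measurable_set1.
  apply/seteqP; split => y /=; first by move=> -> i; rewrite tnth_mktuple.
  by move=> h; apply: eq_from_tnth => i; rewrite h tnth_mktuple.
have key (x : d.-tuple R) : 0 < sqn x <= 1 ->
    c * prof pe b al (sqn x) <= c1 * (Q * hbk d beta kappa (enorm x)).
  move=> /andP[x0 x1]; have xn := sqn_gt0_neq x0; rewrite -lee_fin.
  have h0 : 0 < hbk d beta kappa (enorm x) by apply: hbk_gt0; rewrite enormE sqrtr_gt0.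
  have := Hc V vV x x0; rewrite (hp.2 1 x _ ltr01 xn mA) => /le_trans; apply.
  have cc : 0 <= c1 * (Q * hbk d beta kappa (enorm x)).
    by apply: mulr_ge0; [exact: ltW|apply: mulr_ge0; exact: ltW].
  have c32 : 0 < 2 * c3 by rewrite mulr_gt0.
  rewrite -(intRd_qker d cc c32); apply: le_intRd => y.
    by rewrite lee_fin mulr_ge0//; exact: hp.1.
  rewrite lee_fin indicE; case: (boolP (y \in _)) => [/set_mem/= yn|_].
    rewrite mulr1; have t01 : 0 < (1 : R) <= 1 by rewrite ltr01 lexx.
    apply: le_trans (Hp 1 x y t01 xn yn) _; rewrite -mulrA; apply: ler_wpM2l; first exact: ltW.
    by apply: HQ; [rewrite x0 x1|exact: sqn_gt0].
  by rewrite mulr0; apply: mulr_ge0 => //; apply: mulr_ge0; [exact: powR_ge0|exact: expR_ge0].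
(* At |x|^2 = exp(-T) the quotient phi/h is at least exp(- theta T - |pe| ln 2), and T makes this
   exponent equal to Y; hence phi/h >= 1 + Y, whereas the bounds would force phi/h <= Y. *)
pose Y := c1 * Q / c; have Y0 : 0 < Y by rewrite divr_gt0// mulr_gt0.
have l2 : 0 <= `|pe| * ln 2 by rewrite mulr_ge0// ln_ge0// ler1n.
pose T := (Y + `|pe| * ln 2) / (- theta).
have T0 : 0 <= T by rewrite divr_ge0// ?oppr_ge0 ?(ltW theta0)// addr_ge0// ltW.
have TE : - theta * T = Y + `|pe| * ln 2.
  by rewrite /T mulrC divfK// oppr_eq0 lt_eqF.
have u0 : 0 < expR (- T) by exact: expR_gt0.
have u1 : expR (- T) <= 1 by rewrite -expR0 ler_expR oppr_le0.
have su := sqn_diag hd u0.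
have u01 : 0 < expR (- T) <= 1 by rewrite u0 u1.
have := key (diag d (expR (- T))); rewrite su => /(_ u01).
have sx0 : 0 < sqn (diag d (expR (- T))) by rewrite su.
have sx1 : sqn (diag d (expR (- T))) <= 1 by rewrite su.
have h0 : 0 < hbk d beta kappa (enorm (diag d (expR (- T)))).
  by apply: hbk_gt0; rewrite enormE sqrtr_gt0.
rewrite (profE _ _ _ u0); have := @prof_hbk R d beta kappa beta0 theta _ sx0 sx1; rewrite su -/pe => ->.
rewrite expRK; set e := expR (_ - _).
have ye : 1 + Y <= e.
  apply: le_trans _ (expR_ge1Dx _); rewrite lerD2l.
  have /andP[_ h] := ln1D_bound pe u01.
  by rewrite mulrN -mulNr TE; lra.
have cY : c * Y = c1 * Q by rewrite /Y mulrC divfK// gt_eqF.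
move: h0 ye; set h := hbk _ _ _ _ => h0 ye; clearbody h e.
have -> : c * (h * e) = h * (c * e) by ring.
have -> : c1 * (Q * h) = h * (c1 * Q) by ring.
rewrite ler_pM2l// -cY ler_pM2l// => eY.
by have := le_trans ye eY; lra.
Qed.

Lemma no_lower_bound :
  (exists C : R, 0 < C /\ forall x, x <> origin R d -> enorm x <= 1 ->
     kappa / powR (enorm x) (2 + 2 * beta) + C / powR (enorm x) (2 + beta) <= V x) ->
  ~ (exists c4 c5 c6 : R, [/\ 0 < c4, 0 < c5, 0 < c6 &
      forall t x y, 0 < t <= 1 -> x <> origin R d -> y <> origin R d ->
        (d = 1%N -> 0 < nth 0 (val x) 0 * nth 0 (val y) 0) ->
        c4 * bound_expr beta kappa c5 c6 t x y <= p t x y]).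
Proof.
move=> [C [C0 HC]] [c4 [c5 [c6 [c40 c50 c60 Hp]]]].
case: hV => _ V0 _ _ _.
have [theta [theta0 th]] : exists theta, 0 < theta /\ 4 * Num.sqrt kappa * theta = C / 2.
  exists (C / (8 * Num.sqrt kappa)); split; last by field; rewrite gt_eqF.
  by rewrite divr_gt0// mulr_gt0.
set pe := prof_exp d beta theta.
have C20 : 0 < C / 2 by rewrite divr_gt0.
have [K [K0 HK]] := @generator_bound R d beta kappa theta beta0 kappa0 (C / 2) C20.
pose w := pot beta kappa C (- (kappa + C)).
(* The positive part of [w], in a form that shows continuity and measurability. The constant -(kappa
   + C) makes [w] non-positive outside the unit ball, so v = 0 <= V there. *)
pose v u := (w u + `|w u|) * 2^-1.
have mv : measurable_fun setT v.
  have mw : measurable_fun setT w by exact: measurable_pot.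
  apply: measurable_funM; last exact: measurable_cst.
  by apply: measurable_funD => //; exact: measurableT_comp.
have v0 u : 0 < u -> 0 <= v u.
  by move=> _; rewrite /v; have := ler_norm (- w u); rewrite normrN; lra.
have wv u : w u <= v u by rewrite /v; have := ler_norm (w u); lra.
have cv (u : R) : 0 < u -> {for u, continuous v}.
  move=> u0; have cw : {for u, continuous w} by exact: continuous_pot.
  by apply: cvgM; [apply: cvgD => //; exact: cvg_norm|exact: cvg_cst].
have vV y : 0 < sqn y -> v (sqn y) <= V y.
  move=> y0; have yn := sqn_gt0_neq y0; have Vy := V0 y yn.
  have [w0|w0] := lerP (w (sqn y)) 0.
    by rewrite /v ler0_norm// subrr mul0r.
  have -> : v (sqn y) = w (sqn y) by rewrite /v gtr0_norm//; field.
  have [y1|y1] := leP (sqn y) 1.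
    have := HC y yn; rewrite enorm_le1 => /(_ y1).
    by rewrite /w potE// (potential2 _ _ y0) (potential1 _ _ y0); move: kappa0 C0; lra.
  have /andP[a0 a1] := inv_le1 (ltW y1); have /andP[X0 X1] := Xp_le1 (ltW y1).
  have aX1 : (sqn y)^-1 * Xp (sqn y) <= 1 by rewrite mulr_ile1// ltW.
  have aX2 : (sqn y)^-1 * Xp (sqn y) ^+ 2 <= 1.
    apply: mulr_ile1; [exact: (ltW a0)|exact: sqr_ge0|exact: a1|].
    by rewrite expr2; apply: (mulr_ile1 (ltW X0) (ltW X0) X1 X1).
  have h1 := ler_wpM2l (ltW C0) aX1; have h2 := ler_wpM2l (ltW kappa0) aX2.
  by exfalso; move: w0 h1 h2; rewrite /w potE//; lra.
have KK : 0 < K + (kappa + C) by rewrite !addr_gt0.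
have HG u : 0 < u -> generator d beta kappa theta u <=
    (v u + (K + (kappa + C))) * prof0 pe b al u.
  move=> u0; have := HK u u0; rewrite th -/pe ler_norml => /andP[_].
  have F0 : 0 <= prof0 pe b al u by exact: expR_ge0.
  have := ler_wpM2r F0 (wv u); rewrite {1}/w potE//.
  move: (u^-1 * Xp u) (u^-1 * Xp u ^+ 2) (prof0 _ _ _ u) (v u) => w1 w2 F vu.
  lra.
have [m0 [m00 Hm0]] : exists m0, 0 < m0 /\ forall y : d.-tuple R, box y -> m0 <= prof pe b al (sqn y).
  exists (expR (- (`|pe| * ln 2 + b))); split; first exact: expR_gt0.
  by move=> y; exact: prof_box.
have HU := @FK_upper R d dO Omega P B hB beta kappa theta beta0 kappa0 v mv v0 cv
  V (K + (kappa + C)) m0 (@box R d) KK m00 HG vV Hm0.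
have [Cst [Cst0 CstE]] : exists Cst, 0 < Cst /\ m0^-1 * (2 * expR (K + (kappa + C))) = Cst.
  by exists (m0^-1 * (2 * expR (K + (kappa + C)))); rewrite !mulr_gt0 ?invr_gt0 ?expR_gt0.
have [Q [Q0 HQ]] := bound_expr_lower hd beta0 kappa0 c50 c60.
have mA : measurable (@box R d : set (d.-tuple R)).
  rewrite (_ : @box R d = [set y | forall i, [set` `[(1 : R), 2]] (tnth y i)]).
    by apply: (measurable_cylinder (C := fun=> [set` `[(1 : R), 2]])) => i; exact: measurable_itv.
  by apply/seteqP; split => y /= h i; have := h i; rewrite /= in_itv.
have S0 := hst_gt0 d beta0 kappa0; move: (hst d beta kappa) S0 HQ => S S0 HQ.
have key u : 0 < u <= 1 ->
    c4 * (Q * Num.min 1 (hbk d beta kappa (enorm (diag d u)) / S)) <= Cst * prof0 pe b al u.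
  move=> u01; have /andP[u0 u1] := u01; have su := sqn_diag hd u0.
  have x0 : 0 < sqn (diag d u) by rewrite su.
  have xn := sqn_gt0_neq x0; rewrite -lee_fin.
  have H := HU _ x0; rewrite su (profE _ _ _ u0) mulrA CstE in H.
  rewrite (hp.2 1 _ _ ltr01 xn mA) in H; apply: le_trans _ H.
  have h0 : 0 <= hbk d beta kappa (enorm (diag d u)) / S.
    by apply: divr_ge0 (ltW S0); apply/ltW/hbk_gt0; rewrite enormE sqrtr_gt0.
  have cc : 0 <= c4 * (Q * Num.min 1 (hbk d beta kappa (enorm (diag d u)) / S)).
    apply: mulr_ge0; first exact: ltW.
    by apply: mulr_ge0; [exact: ltW|rewrite le_min ler01].
  rewrite -(intRd_box d cc); apply: le_intRd => y; rewrite lee_fin; first exact: mulr_ge0.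
  rewrite indicE; case: (boolP (y \in _)) => [/set_mem yb|_]; last by rewrite !mulr0.
  rewrite !mulr1; have t01 : 0 < (1 : R) <= 1 by rewrite ltr01 lexx.
  have /andP[y1 _] := box_sqn hd yb.
  have yn : y <> origin R d by apply: sqn_gt0_neq; exact: lt_le_trans ltr01 y1.
  have xy : d = 1%N -> 0 < nth 0 (val (diag d u)) 0 * nth 0 (val y) 0.
    move=> _; rewrite -!(tnth_nth 0 _ (Ordinal hd)) tnth_mktuple mulr_gt0//.
      by rewrite sqrtr_gt0 divr_gt0// ltr0n.
    by have /andP[h _] := yb (Ordinal hd); exact: lt_le_trans ltr01 h.
  apply: le_trans _ (Hp 1 _ y t01 xn yn xy); apply: ler_wpM2l; first exact: ltW.
  by apply: HQ => //; rewrite su.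
have [D [D0 HD]] := prof0_le_lin pe b0 al0.
have l2 : 0 <= `|pe| * ln 2 by rewrite mulr_ge0// ln_ge0// ler1n.
have q0 : 0 < c4 * Q by rewrite mulr_gt0.
have [Y [Y0 YE]] : exists Y, 0 < Y /\ c4 * Q * Y = Cst * S.
  exists (Cst * S / (c4 * Q)); split; first by rewrite divr_gt0// mulr_gt0.
  by rewrite mulrC divfK// gt_eqF.
have [Z [Z0 ZE]] : exists Z, 0 < Z /\ c4 * Q * Z = Cst * D.
  exists (Cst * D / (c4 * Q)); split; first by rewrite divr_gt0// mulr_gt0.
  by rewrite mulrC divfK// gt_eqF.
(* One T for both values of the minimum in the kernel bound: T >= Z contradicts the value 1, and
   theta T >= |pe| ln 2 + Y contradicts the quotient. *)
have [T [T0 TZ TY]] : exists T, [/\ 0 <= T, Z <= T & `|pe| * ln 2 + Y <= theta * T].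
  have r0 : 0 <= (`|pe| * ln 2 + Y) / theta by rewrite divr_ge0 ?addr_ge0 ?(ltW theta0)// ltW.
  exists ((`|pe| * ln 2 + Y) / theta + Z); split.
  - by rewrite addr_ge0// ltW.
  - by rewrite lerDr.
  - by rewrite mulrDr [theta * (_ / _)]mulrC divfK ?gt_eqF// lerDl mulr_ge0// ltW.
have u0 : 0 < expR (- T) by exact: expR_gt0.
have u1 : expR (- T) <= 1 by rewrite -expR0 ler_expR oppr_le0.
have u01 : 0 < expR (- T) <= 1 by rewrite u0 u1.
have su := sqn_diag hd u0.
have sx0 : 0 < sqn (diag d (expR (- T))) by rewrite su.
have sx1 : sqn (diag d (expR (- T))) <= 1 by rewrite su.
have h0 : 0 < hbk d beta kappa (enorm (diag d (expR (- T)))).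
  by apply: hbk_gt0; rewrite enormE sqrtr_gt0.
have := key _ u01.
(* If the minimum is 1, the left side is a positive constant while phi is at most D exp(-T) <=
   D/(1+T); so no decay of h itself has to be proved. *)
have [hS|hS] := leP 1 (hbk d beta kappa (enorm (diag d (expR (- T)))) / S).
  rewrite mulr1 => h.
  have h' := le_trans h (ler_wpM2l (ltW Cst0) (HD _ u0)).
  have uT : expR (- T) * (1 + T) <= 1.
    by rewrite expRN ler_pdivrMl ?expR_gt0// mulr1 expR_ge1Dx.
  have T10 : 0 <= 1 + T by rewrite addr_ge0.
  have h2 := ler_wpM2r T10 h'.
  have h3 : Cst * (D * expR (- T)) * (1 + T) <= Cst * D.
    rewrite mulrA -mulrA; apply: ler_piMr => //.
    by apply: mulr_ge0; exact: ltW.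
  have h4 := le_trans h2 h3; have h5 := ler_wpM2l (ltW q0) TZ.
  rewrite -ZE in h4; move: h4 h5 q0; lra.
have := @prof_hbk R d beta kappa beta0 theta _ sx0 sx1; rewrite su -/pe => ->.
rewrite expRK; set e := expR (_ - _).
have ye : e * (1 + Y) <= 1.
  rewrite /e -[X in expR X]opprK expRN ler_pdivrMl ?expR_gt0// mulr1.
  apply: le_trans _ (expR_ge1Dx _); rewrite lerD2l.
  have /andP[h _] := ln1D_bound pe u01.
  by move: TY; rewrite mulrN; lra.
move: h0 ye; set h := hbk _ _ _ _ => h0 ye; clearbody h e => H.
have H1 : h * (c4 * Q) <= h * (Cst * S * e).
  have := ler_wpM2r (ltW S0) H.
  have -> : c4 * (Q * (h / S)) * S = h * (c4 * Q) by field; rewrite gt_eqF.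
  by have -> : Cst * (h * e) * S = h * (Cst * S * e) by ring.
move: H1; rewrite ler_pM2l// -YE => H1.
have Y10 : 0 <= 1 + Y by rewrite addr_ge0// ltW.
have H2 := ler_wpM2r Y10 H1.
have H3 : c4 * Q * Y * e * (1 + Y) <= c4 * Q * Y.
  by rewrite -mulrA; apply: ler_piMr => //; rewrite mulr_ge0// ltW.
by move: (le_trans H2 H3) q0; lra.
Qed.

End Halves.

Unset Implicit Arguments.

Theorem theorem5p6 (R : realType) (d : nat) (hd : (1 <= d)%N)
  (dO : measure_display) (Omega : measurableType dO) (P : probability Omega R)
  (B : R -> Omega -> d.-tuple R) (hB : is_BM P B)
  (V : d.-tuple R -> R) (hV : potential_assumptions V)
  (p : R -> d.-tuple R -> d.-tuple R -> R) (hp : is_trans_density P B V p)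
  (beta kappa : R) (hbeta : 0 < beta) (hkappa : 0 < kappa) :
  ((exists C : R, 0 < C /\
      forall x, x <> origin R d -> enorm x <= 1 ->
        V x <= kappa / powR (enorm x) (2 + 2 * beta) - C / powR (enorm x) (2 + beta)) ->
   ~ (exists c1 c2 c3 : R, [/\ 0 < c1, 0 < c2, 0 < c3 &
       forall t x y, 0 < t <= 1 -> x <> origin R d -> y <> origin R d ->
         p t x y <= c1 * bound_expr beta kappa c2 c3 t x y])) /\
  ((exists C : R, 0 < C /\
      forall x, x <> origin R d -> enorm x <= 1 ->
        kappa / powR (enorm x) (2 + 2 * beta) + C / powR (enorm x) (2 + beta) <= V x) ->
   ~ (exists c4 c5 c6 : R, [/\ 0 < c4, 0 < c5, 0 < c6 &
       forall t x y, 0 < t <= 1 -> x <> origin R d -> y <> origin R d ->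
         (d = 1%N -> 0 < nth 0 (val x) 0 * nth 0 (val y) 0) ->
         c4 * bound_expr beta kappa c5 c6 t x y <= p t x y])).
Proof.
split; first exact: (no_upper_bound hd hB hV hp hbeta hkappa).
exact: (no_lower_bound hd hB hV hp hbeta hkappa).
Qed.
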